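(* For each fixed $d\ge2$ there are constants $C_d<\infty$ and $\varepsilon_d>0$, depending only on $d$, with the following property. Let $q=\frac{2d}{d+1}$, $n\ge1$, $\mathbb K\in\{\mathbb R,\mathbb C\}$, and let $T:(\mathbb K^n)^d\to\mathbb K$ be a $d$-linear form with \[ \|T\|_{\mathrm{cb}}=1,\qquad \|T\|_q\ge1-\varepsilon,\qquad 0\le\varepsilon\le\varepsilon_d . \] Then there are an integer $1\le m\le n$, sets $J_1,\ldots,J_d\subseteq[n]$ with $|J_1|=\cdots=|J_d|=m$, unimodular matrices $H_r$ over $\mathbb K$ indexed by $J_r\times J_{r+1}$, and unitary matrices $U_r$ over $\mathbb K$ of order $m$ indexed by $J_r\times J_{r+1}$ ($r=1,\ldots,d-1$), such that, with $J=J_1\times\cdots\times J_d$, both of the following hold. (1) The $d$-linear form $P$ with $P(e_{i_1},\ldots,e_{i_d})=m^{-(d+1)/2}\prod_{r=1}^{d-1}H_r(i_r,i_{r+1})$ for $(i_1,\ldots,i_d)\in J$ and $P(e_{i_1},\ldots,e_{i_d})=0$ otherwise satisfies \[ \|T-P\|_q\le C_d\sqrt\varepsilon,\qquad \|P\|_q=1,\qquad \sum_{(i_1,\ldots,i_d)\in[n]^d\setminus J}|T(e_{i_1},\ldots,e_{i_d})|^q\le C_d\,\varepsilon . \] (2) The $d$-linear form $Q$ with $Q(e_{i_1},\ldots,e_{i_d})=\frac1m\prod_{r=1}^{d-1}U_r(i_r,i_{r+1})$ for $(i_1,\ldots,i_d)\in J$ and $Q(e_{i_1},\ldots,e_{i_d})=0$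 otherwise satisfies \[ \|T-Q\|_q\le C_d\sqrt\varepsilon,\qquad \|Q\|_{\mathrm{cb}}=1,\qquad \|Q\|_F=m^{-1/2}, \] and \[ \max_{1\le r\le d-1}\frac{\|H_r-\sqrt m\,U_r\|_F}{m}\le C_d\sqrt\varepsilon . \] Over $\mathbb K=\mathbb R$, every entry of every $H_r$ belongs to $\{\pm1\}$ and the $U_r$ are orthogonal.
   Context: $[n]=\{1,\dots,n\}$ and $e_1,\dots,e_n$ is the canonical basis of $\mathbb K^n$. The coefficient norm is $\|T\|_q=\big(\sum_{i_1,\ldots,i_d=1}^n|T(e_{i_1},\ldots,e_{i_d})|^q\big)^{1/q}$. The Frobenius norm $\|\cdot\|_F$ of a matrix or of a coefficient tensor is the square root of the sum of squared moduli of its entries. The completely bounded norm is \[ \|T\|_{\mathrm{cb}}=\sup_{\mathcal H}\ \sup_{(X_j^s)}\Big\|\sum_{i_1,\ldots,i_d=1}^n T(e_{i_1},\ldots,e_{i_d})\,X^1_{i_1}X^2_{i_2}\cdots X^d_{i_d}\Big\|_{\mathcal B(\mathcal H)}, \] where $\mathcal H$ ranges over all Hilbert spaces over $\mathbb K$ and $(X_j^s)_{s\in[d],\,j\in[n]}$ over all families of bounded linear operators on $\mathcal H$ with operator norm $\le1$ (not necessarily commuting; products are compositions in the displayed order). A matrix is unimodular if all its entries have modulus one. A square matrix $U$ is unitary if $UU^*=I$, where $U^*$ is the transpose over $\mathbb R$ (so unitary means orthogonal) and the conjugate transpose over $\mathbb C$. *)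

(* Defs.v *)
From HB Require Import structures.
From mathcomp Require Import all_boot all_order all_algebra.
From mathcomp Require Import complex.
From mathcomp Require Import all_classical all_reals all_analysis.

Set Implicit Arguments.
Unset Strict Implicit.
Unset Printing Implicit Defensive.
Import Order.TTheory GRing.Theory Num.Theory.
Import numFieldNormedType.Exports.
Local Open Scope classical_set_scope.
Local Open Scope complex_scope.
Local Open Scope ring_scope.
Local Open Scope sesquilinear_scope.

Inductive ground_field := RealField | ComplexField.

Section Scalars.
Variable R : realType.

Definition scalars (k : ground_field) : numFieldType :=
  match k with RealField => R | ComplexField => R[i] end.

Definition conjK (k : ground_field) : scalars k -> scalars k :=
  match k with RealField => idfun | ComplexField => @Num.conj R[i] end.

Definition reK (k : ground_field) : scalars k -> R :=
  match k with RealField => idfun | ComplexField => @complex.Re R end.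

Definition ofR (k : ground_field) : R -> scalars k :=
  match k with RealField => idfun | ComplexField => real_complex R end.

(* Norms over a numFieldType K take their values in K; over R[i] these values
   are real complex numbers, which reK turns into elements of R. *)
Definition absK (k : ground_field) (x : scalars k) : R := reK `|x|.

Section HilbertSpaces.
Variable k : ground_field.
Local Notation K := (scalars k).

(* The inner product is linear on the left and conjugate-linear on the right. *)
Record hilbertSpace := HilbertSpace {
  hilbert_carrier :> completeNormedModType K;
  inner : {dot hilbert_carrier for @conjK k};
  hilbert_normE : forall x : hilbert_carrier, `|x| ^+ 2 = inner x x }.

Definition vnorm (H : hilbertSpace) (x : H) : R := reK `|x|.

(* The value is +oo exactly when a linear map A is unbounded. *)
Definition opnorm (H : hilbertSpace) (A : H -> H) : \bar R :=
  ereal_sup [set (vnorm (A x))%:E | x in [set x : H | vnorm x <= 1]].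

End HilbertSpaces.

Section Forms.
Variables (k : ground_field) (d n : nat).
Local Notation K := (scalars k).
Local Notation args := ('I_d -> 'rV[K]_n).

(* dfwith x v is the family x with its s-th member replaced by v. *)
Definition multilinear (T : args -> K) : Prop :=
  forall (s : 'I_d) (x : args),
    scalar (fun v : 'rV[K]_n => T (@dfwith 'I_d (fun=> 'rV[K]_n) x s v)).

Definition coef (T : args -> K) (i : {ffun 'I_d -> 'I_n}) : K :=
  T (fun s => delta_mx 0 (i s)).

Definition coef_norm (q : R) (T : args -> K) : R :=
  (\sum_(i : {ffun 'I_d -> 'I_n}) absK (coef T i) `^ q) `^ q^-1.

Definition coef_frobenius (T : args -> K) : R :=
  Num.sqrt (\sum_(i : {ffun 'I_d -> 'I_n}) absK (coef T i) ^+ 2).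

(* The operator
     \sum_i T(e_(i_1), ..., e_(i_d)) X^1_(i_1) \o ... \o X^d_(i_d). *)
Definition form_operator (T : args -> K) (H : hilbertSpace k)
    (X : 'I_d -> 'I_n -> {linear H -> H}) (h : H) : H :=
  \sum_(i : {ffun 'I_d -> 'I_n})
    coef T i *: foldr (fun s y => X s (i s) y) h (enum 'I_d).

Definition cb_norm (T : args -> K) : \bar R :=
  ereal_sup [set y : \bar R | exists (H : hilbertSpace k)
      (X : 'I_d -> 'I_n -> {linear H -> H}),
    (forall s j, (opnorm (X s j) <= 1%:E)%E) /\ y = opnorm (form_operator T X)].

End Forms.

Section Matrices.
Variable k : ground_field.
Local Notation K := (scalars k).

Definition unimodular m n (M : 'M[K]_(m, n)) : Prop :=
  forall i j, absK (M i j) = 1.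

(* Meaningful for m = n; the rectangular type only avoids casts between equal
   cardinals. *)
Definition unitary m n (U : 'M[K]_(m, n)) : Prop :=
  U *m (U ^t @conjK k) = 1%:M.

Definition frobenius m n (M : 'M[K]_(m, n)) : R :=
  Num.sqrt (\sum_i \sum_j absK (M i j) ^+ 2).

(* A matrix indexed by A * B is represented by an n x n matrix whose entries
   outside A * B are irrelevant; restr extracts the meaningful block, with rows
   and columns listed in the order of enum A and enum B. *)
Definition restr n (A B : {set 'I_n}) (M : 'M[K]_n) : 'M[K]_(#|A|, #|B|) :=
  mxsub (fun a : 'I_#|A| => enum_val a) (fun b : 'I_#|B| => enum_val b) M.

End Matrices.
End Scalars.

(* For r : 'I_d.-1, the positions r and r + 1 among the d arguments. *)
Definition pos d (r : 'I_d.-1) : 'I_d := widen_ord (leq_pred d) r.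

Lemma next_pos_subproof d (r : 'I_d.-1) : (r.+1 < d)%N.
Proof. by rewrite -ltn_predRL. Qed.

Definition next_pos d (r : 'I_d.-1) : 'I_d := Ordinal (next_pos_subproof r).

(* Main.v *)
Require Import Defs.
From HB Require Import structures.
From mathcomp Require Import all_boot all_order all_algebra.
From mathcomp Require Import ring lra.
Set Implicit Arguments.
Unset Strict Implicit.
Unset Printing Implicit Defensive.
Import Order.TTheory GRing.Theory Num.Theory.
Local Open Scope ring_scope.

(** Write r_s(j) for the Euclidean norm of the slice i_s = j of the coefficient
array of T, and A_s for the sum over j of r_s(j).  The norm ||T||_cb dominates
every |sum_i T(i) <X^1_(i_1) ... X^d_(i_d) v, u>| with contractions X and unit
vectors u, v of a finite-dimensional space (cb_norm_test), and two families of
contractions give everything.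

Cuts.  Put at position s arbitrary contractions W_j and around it operators that
write the other coordinates into a basis vector.  The test becomes the sum over j
of the pairings of W_j with the slice M_j, seen as a matrix whose rows are the
coordinates before s and whose columns are those after s (cut_test).  With V the
conjugate of M / ||M||, the contraction V (3 - V^* V) / 2 pairs with M to at least
||M|| plus a multiple of the squared distance of M to the rank one matrices, divided
by ||M|| (cut_rank1).  Hence A_s <= 1, and if A_s is nearly 1 then T(i) is nearly
F(i_1, ..., i_s) G(i_s, ..., i_d) (slices_bound, rank_one_cuts).

Flatness.  The arithmetic-geometric inequality gives
(d + 1) |T_i|^q <= sum_s |T_i|^2 / r_s(i_s) + prod_s r_s(i_s), and the right-hand
sides add up to sum_s A_s + prod_s A_s <= d + 1.  This is the inequality
||T||_q <= ||T||_cb, and when it is nearly an equality the defects in the pointwise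
inequalities are small in sum.  They force all slice norms that matter to be close
to one value, so that |T_i| is nearly m^(-(d+1)/2) on a box J with sides of size m
and T is negligible outside J (flatness).

Phases.  On J the factors F and G of each cut may be taken unimodular.  Comparing
the cuts at s and s + 1, and freezing the coordinates before s at a good value,
splits off a factor that depends on the coordinates s and s + 1 only; after d - 2
such steps T is close to P (phases).

Unitarity.  Put rank one operators |a><b| at every position: the test becomes a sum
of T(i) against a product of inner products of consecutive vectors (chain_test).
Use the conjugates of the H_t, t <> r, in all the links except the r-th one.  What is
left says that |sum_(p,q) tau(p,q) <v_q, w_p>| <= m for all unit vectors, with a
matrix tau that is close to H_r / sqrt m (reduced_test).  After the rows of tau are
rescaled into a matrix B, this bounds by m the sum of the norms of the columns of
B^* B, whereas the trace of B^* B is nearly m.  So B^* B is close to the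
identity outside a few columns, and a matrix with this property is close to a
unitary matrix (unitary_from_test, near_unitary).

Finally Q has completely bounded norm one because a unitary matrix acts
isometrically on families of vectors (unitary_form_cb), and P - Q is estimated by
exchanging the H_r for the sqrt m U_r one at a time (chain_distance). *)

(** * Sums over finite products *)

Lemma sum_cauchy_schwarz (R : realDomainType) (I : finType) (a b : I -> R) :
  (\sum_i a i * b i) ^+ 2 <= (\sum_i a i ^+ 2) * (\sum_i b i ^+ 2).
Proof.
have h : 0 <= \sum_i \sum_j (a i * b j - a j * b i) ^+ 2.
  by apply: sumr_ge0 => i _; apply: sumr_ge0 => j _; exact: sqr_ge0.
have E : \sum_i \sum_j (a i * b j - a j * b i) ^+ 2 =
    (\sum_i a i ^+ 2) * (\sum_i b i ^+ 2) + (\sum_i b i ^+ 2) * (\sum_i a i ^+ 2)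
     - 2 * ((\sum_i a i * b i) * (\sum_i a i * b i)).
  rewrite !big_distrlr /= mulr_sumr -big_split -sumrB /=; apply: eq_bigr => i _.
  rewrite mulr_sumr -big_split -sumrB /=; apply: eq_bigr => j _; ring.
rewrite -subr_ge0 -(pmulr_rge0 _ (ltr0n R 2)); apply: (le_trans h).
by rewrite E le_eqVlt; apply/orP; left; apply/eqP; ring.
Qed.

(** If every ratio phi i / w i exceeded E then so would the ratio of the sums; the
weight 0 < w i makes the chosen index usable for division. *)
Lemma averaging_ratio (R : realDomainType) (I : finType) (w phi : I -> R) (E : R) :
  (forall i, 0 <= w i) -> (forall i, 0 <= phi i) ->
  0 < \sum_i w i -> \sum_i phi i <= E * \sum_i w i ->
  exists2 i, 0 < w i & phi i <= E * w i.
Proof.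
move=> w0 p0 wpos h.
case: (boolP [exists i, (0 < w i) && (phi i <= E * w i)]) => [/existsP[i /andP[]]|].
  by exists i.
rewrite negb_exists => /forallP hn; exfalso.
have [i wi] : exists i, 0 < w i.
  case: (boolP [exists i, 0 < w i]) => [/existsP //|].
  rewrite negb_exists => /forallP hw; suff : \sum_i w i = 0 by move: wpos => /[swap] ->; rewrite ltxx.
  by apply: big1 => i _; apply/eqP; rewrite eq_le w0 andbT leNgt hw.
have hle j : E * w j <= phi j.
  have := hn j; rewrite negb_and; case/orP => [|]; last by rewrite -ltNge => /ltW.
  by rewrite -leNgt => hj; rewrite (_ : w j = 0) ?mulr0 //; apply/eqP; rewrite eq_le w0 hj.
have : E * \sum_i w i < \sum_i phi i.
  rewrite mulr_sumr (bigD1 i) //= [ltRHS](bigD1 i) //=.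
  apply: ltr_leD; last by apply: ler_sum.
  by have := hn i; rewrite wi /= -ltNge.
by rewrite ltNge h.
Qed.

(** The arithmetic-geometric mean inequality, with the geometric mean given by its power
so that no root has to be taken. *)
Lemma AGM_root (R : realFieldType) (d : nat) (E : 'I_d.+1 -> R) (x : R) :
  (forall i, 0 <= E i) -> 0 <= x -> x ^+ d.+1 = \prod_i E i ->
  d.+1%:R * x <= \sum_i E i.
Proof.
move=> E0 x0 h.
have [h1 _] := leif_AGM (A := [set: 'I_d.+1]) (E := E) (fun i _ => E0 i).
rewrite cardsT card_ord in h1.
rewrite (eq_bigl xpredT) in h1; last by move=> i; rewrite inE.
rewrite [X in _ <= X ^+ _](_ : _ = (\sum_i E i) / d.+1%:R) in h1; last first.
  by congr (_ / _); apply: eq_bigl => i; rewrite inE.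
rewrite -h in h1; rewrite mulrC -ler_pdivlMr ?ltr0n //.
have S0 : 0 <= (\sum_i E i) / d.+1%:R.
  by rewrite divr_ge0 // sumr_ge0.
by rewrite -(ler_pXn2r (ltn0Sn d)) ?nnegrE.
Qed.

Lemma norm_prod_sub1 (R : realFieldType) (I : Type) (s : seq I) (z : I -> R) (B : R) :
  1 <= B -> (forall i, 0 <= z i <= B) ->
  `|\prod_(i <- s) z i - 1| <= B ^+ size s * \sum_(i <- s) `|z i - 1|.
Proof.
move=> B1 hz; elim: s => [|i s IH]; first by rewrite !big_nil subrr normr0 mulr0.
rewrite !big_cons /=.
have -> : z i * \prod_(j <- s) z j - 1 = z i * (\prod_(j <- s) z j - 1) + (z i - 1) by ring.
apply: (le_trans (ler_normD _ _)); rewrite normrM mulrDr addrC.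
have /andP[z0 zB] := hz i.
apply: lerD.
  by rewrite ler_peMl ?normr_ge0 // exprn_ege1.
rewrite exprS -mulrA; apply: ler_pM => //; first by rewrite ger0_norm.
Qed.

Section Coordinates.
Variables (R : realFieldType) (d n : nat).
Local Notation I := {ffun 'I_d -> 'I_n}.

Lemma sum_prod (g : 'I_d -> 'I_n -> R) :
  \sum_(i : I) \prod_u g u (i u) = \prod_u \sum_j g u j.
Proof. by rewrite -bigA_distr_bigA. Qed.

Lemma sum_prod1 (g : 'I_d -> 'I_n -> R) (t : 'I_d) (f : 'I_n -> R) :
  \sum_(i : I) (\prod_u g u (i u)) * f (i t) =
  (\prod_(u | u != t) \sum_j g u j) * \sum_j g t j * f j.
Proof.
pose g' u j := if u == t then g u j * f j else g u j.
have := sum_prod g'; rewrite [RHS](bigD1 t) //= mulrC /g' eqxx.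
under [in X in _ = X -> _]eq_bigr => u /negPf ut do rewrite ut.
move=> <-; apply: eq_bigr => i _.
rewrite (bigD1 t) //= [RHS](bigD1 t) //= eqxx mulrAC; congr (_ * _).
by apply: eq_bigr => u /negPf ->.
Qed.

(** Exchanging the coordinate t between two independent indices preserves the product
weights, so two indices that are coupled through different coordinates s and t can be
replaced by a single one. *)
Lemma sum_swap (g : 'I_d -> 'I_n -> R) (s t : 'I_d) (f : 'I_n -> 'I_n -> R) :
  s != t ->
  \sum_(i : I) \sum_(i' : I) (\prod_u g u (i u)) * (\prod_u g u (i' u)) * f (i s) (i' t) =
  (\sum_(i : I) \prod_u g u (i u)) * \sum_(i : I) (\prod_u g u (i u)) * f (i s) (i t).
Proof.
move=> st.
pose sw (p : I * I) : I * I :=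
  ([ffun u => if u == t then p.2 u else p.1 u], [ffun u => if u == t then p.1 u else p.2 u]).
have swK : involutive sw.
  by move=> [i i']; congr pair; apply/ffunP => u; rewrite !ffunE /= ?ffunE; case: eqP.
rewrite [LHS]pair_bigA /= (reindex_inj (inv_inj swK)) /=.
rewrite mulr_suml.
transitivity (\sum_(p : I * I) (\prod_u g u (p.2 u)) *
   ((\prod_u g u (p.1 u)) * f (p.1 s) (p.1 t))); last first.
  rewrite -(pair_bigA _ (fun i i' : I => (\prod_u g u (i' u)) *
     ((\prod_u g u (i u)) * f (i s) (i t)))) exchange_big /=.
  by apply: eq_bigr => i' _; rewrite mulr_sumr.
apply: eq_bigr => -[i i'] _ /=.
rewrite !ffunE (negPf st) eqxx mulrA; congr (_ * _).
rewrite -!big_split /=; apply: eq_bigr => u _; rewrite !ffunE.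
by case: eqP => // _; rewrite mulrC.
Qed.
End Coordinates.

(** * Flatness of a near-extremal array *)

Lemma sum1_card_in (T : finType) (A : {set T}) : (\sum_(j : T) (j \in A) = #|A|)%N.
Proof. by rewrite -sum1_card [RHS]big_mkcond; apply: eq_bigr => j _; case: (j \in A). Qed.

Lemma sqr_tri (R : realDomainType) (x y z : R) :
  (x - z) ^+ 2 <= 2 * (x - y) ^+ 2 + 2 * (y - z) ^+ 2.
Proof. by have := sqr_ge0 (x - 2 * y + z); rewrite !expr2; lra. Qed.

Lemma prod_step_le (R : realFieldType) (Z P Q F S : R) : 0 <= Z -> Z <= 4 ->
  0 <= P -> P <= F * S -> 0 <= S -> Q <= S -> 1 <= F -> Z * P + Q <= 5 * F * S.
Proof.
move=> Z0 Z4 P0 h S0 hQ F1.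
have a1 : Z * P <= 4 * (F * S) by apply: ler_pM.
have a2 : S <= F * S by rewrite ler_peMl.
lra.
Qed.

Lemma le_of_1280 (R : realFieldType) (x y : R) : 1280 * x <= y -> 0 <= x -> x <= y.
Proof. by lra. Qed.

Lemma combine_errors (R : realFieldType) (x y Y : R) :
  x <= Y -> y <= 25 * 8300 * Y -> 0 <= Y -> 2 * x + 2 * y <= 500 * 1000 * Y.
Proof. by lra. Qed.

(** How the mass A inside the box, measured with the exponent q, bounds from below the
normalized Euclidean mass B. *)
Lemma mass_of_AGM (R : realFieldType) (D A B e : R) : 1 <= D ->
  (D + 1) * A <= 1 + D * B -> 1 - e <= A -> 0 <= e -> 1 - 2 * e <= B.
Proof.
move=> D1 h hA e0; have D0 : 0 < D by lra.
rewrite -(ler_pM2l D0); nra.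
Qed.

Lemma mass_margin (R : realFieldType) (D K kap dlt : R) : 0 <= D -> K <= D -> dlt <= kap -> kap <= K ->
  1 - 2500 * D <= 1 - dlt - 2000 * D.
Proof. by lra. Qed.

Lemma defect_le_half (R : realFieldType) (D k : R) : 1 <= D -> 1280 * D * k <= 10000^-1 ->
  0 <= k -> k <= 2^-1.
Proof. by move=> D1 h k0; have := ler_wpM2r k0 D1; lra. Qed.

Lemma rest_le (R : realFieldType) (x y e : R) : x + y <= 1 -> 1 - e <= x -> y <= e.
Proof. by lra. Qed.

Lemma out_mass (R : realFieldType) (X kap K L : R) :
  X <= 966 * L -> K <= L -> 1280 * kap <= K -> 0 <= K -> 2 * kap + 2 * X <= 2000 * L.
Proof. by lra. Qed.

Lemma subset_of_card (T : finType) (A : {set T}) (m : nat) : (m <= #|A|)%N ->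
  exists2 B : {set T}, B \subset A & #|B| = m.
Proof.
move=> h; exists [set x in take m (enum A)].
  by apply/subsetP => x; rewrite inE => /mem_take; rewrite mem_enum.
rewrite cardsE (card_uniqP _) ?take_uniq ?enum_uniq // size_takel // -cardE //.
Qed.

Lemma sum_sqr_sub (R : realFieldType) (T : finType) (A : {set T}) (f : T -> R) (c : R) :
  \sum_(j in A) (f j - c) ^+ 2 =
  \sum_(j in A) f j ^+ 2 - 2 * c * \sum_(j in A) f j + c * #|A|%:R * c.
Proof.
rewrite (eq_bigr (fun j => f j ^+ 2 + (- (2 * c) * f j + c * c))) => [|j _].
  by rewrite big_split /= big_split /= -mulr_sumr sumr_const -mulr_natr; ring.
by rewrite !expr2; ring.
Qed.

Lemma sqr_sum_le (R : rcfType) (T : finType) (A : {set T}) (f : T -> R) :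
  (\sum_(j in A) f j) ^+ 2 <= #|A|%:R * \sum_(j in A) f j ^+ 2.
Proof.
have := sum_cauchy_schwarz (fun j => (j \in A)%:R) (fun j => if j \in A then f j else 0).
rewrite (_ : \sum_i _ * _ = \sum_(j in A) f j); last first.
  by rewrite [RHS]big_mkcond; apply: eq_bigr => i _; case: ifP; rewrite ?mul1r ?mul0r.
move/le_trans; apply; rewrite le_eqVlt; apply/orP; left; apply/eqP; congr (_ * _).
  rewrite -sum1_card natr_sum [RHS]big_mkcond; apply: eq_bigr => i _.
  by case: (i \in A); rewrite ?expr1n ?expr0n.
by rewrite [RHS]big_mkcond; apply: eq_bigr => i _; case: ifP; rewrite // expr0n.
Qed.

Section Psi.
Variable R : rcfType.
Implicit Types x y z : R.

(** Scale-invariant, so that it measures by what factor two nonnegative numbers differ.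
*)
Definition psi x y : R := (x - y) ^+ 2 / (x ^+ 2 + y ^+ 2).

Lemma psi_ge0 x y : 0 <= psi x y.
Proof. by rewrite divr_ge0 ?sqr_ge0 // addr_ge0 ?sqr_ge0. Qed.
Lemma psiE x y : (x - y) ^+ 2 = psi x y * (x ^+ 2 + y ^+ 2).
Proof.
rewrite /psi; have [h|h] := eqVneq (x ^+ 2 + y ^+ 2) 0; last by rewrite divfK.
rewrite h mulr0; move/eqP: h; rewrite paddr_eq0 ?sqr_ge0 // !sqrf_eq0 => /andP[/eqP -> /eqP ->].
by rewrite subrr expr0n.
Qed.
Lemma psi_le x y c : 0 <= c -> (x - y) ^+ 2 <= c * (x ^+ 2 + y ^+ 2) -> psi x y <= c.
Proof.
move=> c0 h; rewrite /psi; have [h0|h0] := eqVneq (x ^+ 2 + y ^+ 2) 0.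
  by rewrite h0 invr0 mulr0.
by rewrite ler_pdivrMr // lt_def h0 addr_ge0 ?sqr_ge0.
Qed.
Lemma psi_le1 x y : 0 <= x -> 0 <= y -> psi x y <= 1.
Proof. by move=> x0 y0; apply: psi_le => //; nra. Qed.
Lemma psi_far x y : 0 <= x -> 0 < y -> 2 * x <= y \/ 2 * y <= x -> 5^-1 <= psi x y.
Proof.
move=> x0 y0 h; rewrite /psi ler_pdivlMr ?ltr_wpDl ?sqr_ge0 ?exprn_gt0 //.
by case: h => h; nra.
Qed.
(** Only the case of a large middle value needs care: there psi x y is already bounded
below, and psi x z is at most 1. *)
Lemma psi_triangle x y z : 0 <= x -> 0 <= y -> 0 <= z ->
  psi x z <= 10 * (psi x y + psi y z).
Proof.
move=> x0 y0 z0.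
have p1 := psi_ge0 x y; have p2 := psi_ge0 y z.
have [h|h] := lerP (y ^+ 2) (4 * (x ^+ 2 + z ^+ 2)).
  apply: psi_le; first by rewrite mulr_ge0 // addr_ge0.
  have := psiE x y; have := psiE y z => e1 e2.
  have : (x - z) ^+ 2 <= 2 * (x - y) ^+ 2 + 2 * (y - z) ^+ 2 by have := sqr_ge0 (x - 2 * y + z); rewrite !expr2; lra.
  rewrite e1 e2; have := sqr_ge0 x; have := sqr_ge0 z; have := sqr_ge0 y.
  move: (psi x y) (psi y z) p1 p2 h => p q p1 p2; move: (x ^+ 2) (y ^+ 2) (z ^+ 2) => X Y Z; nra.
have y1 : 0 < y by rewrite lt_def y0 andbT; apply: contraTneq h => ->; nra.
have : 5^-1 <= psi x y.
  by apply: psi_far => //; left; rewrite -[_ <= _]ler_sqr ?nnegrE ?mulr_ge0 // ; nra.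
have := psi_le1 x0 z0; lra.
Qed.
End Psi.

Section Flatness.
Variables (R : rcfType) (d n : nat).
Local Notation I := {ffun 'I_d -> 'I_n}.
Variables (a aq : I -> R).
Hypothesis a_ge0 : forall i, 0 <= a i.
Hypothesis aq_ge0 : forall i, 0 <= aq i.
Hypothesis aqE : forall i, aq i ^+ d.+1 = a i ^+ (2 * d).

Definition slice (s : 'I_d) (j : 'I_n) : R := Num.sqrt (\sum_(i : I | i s == j) a i ^+ 2).
Local Notation r := slice.
Definition rho (i : I) : R := \prod_s r s (i s).
(** In the pointwise arithmetic-geometric inequality, the d + 1 numbers compared are the
squares of these d quotients and rho i. When T is extremal they all coincide. *)
Definition rescaled (s : 'I_d) (i : I) : R := a i / Num.sqrt (r s (i s)).

Lemma slice_ge0 s j : 0 <= r s j. Proof. exact: sqrtr_ge0. Qed.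
Lemma rho_ge0 i : 0 <= rho i. Proof. by apply: prodr_ge0 => s _; exact: slice_ge0. Qed.
Lemma sqr_slice s j : r s j ^+ 2 = \sum_(i : I | i s == j) a i ^+ 2.
Proof. by rewrite sqr_sqrtr // sumr_ge0 // => i _; exact: sqr_ge0. Qed.
Lemma le_slice s (i : I) : a i <= r s (i s).
Proof.
rewrite -[leLHS]ger0_norm // -sqrtr_sqr ler_wsqrtr // (bigD1 i) //= lerDl.
by apply: sumr_ge0 => j _; exact: sqr_ge0.
Qed.
Lemma slice_eq0 s (i : I) : r s (i s) = 0 -> a i = 0.
Proof. by move=> h; apply/eqP; rewrite eq_le a_ge0 -[leRHS]h le_slice. Qed.
Lemma rescaledE s (i : I) : a i = rescaled s i * Num.sqrt (r s (i s)).
Proof.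
rewrite /rescaled; have [h|h] := eqVneq (Num.sqrt (r s (i s))) 0; last by rewrite divfK.
rewrite h mulr0; apply: (@slice_eq0 s); apply/eqP; rewrite eq_le slice_ge0 andbT.
by rewrite -sqrtr_eq0 h.
Qed.
Lemma rescaled_ge0 s (i : I) : 0 <= rescaled s i.
Proof. by rewrite divr_ge0 // sqrtr_ge0. Qed.
Lemma sqr_rescaled s (i : I) : rescaled s i ^+ 2 = a i ^+ 2 / r s (i s).
Proof. by rewrite expr_div_n sqr_sqrtr // slice_ge0. Qed.

(** The arithmetic-geometric inequality is applied after both the s-th term and rho i
are replaced by their geometric mean; what this replacement gains is exactly the square
on the left. *)
Lemma AGM_defect s (i : I) :
  (rescaled s i - Num.sqrt (rho i)) ^+ 2 + d.+1%:R * aq i <= \sum_t rescaled t i ^+ 2 + rho i.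
Proof.
have ->  : \sum_t rescaled t i ^+ 2 + rho i =
  (rescaled s i - Num.sqrt (rho i)) ^+ 2 + (2 * (rescaled s i * Num.sqrt (rho i)) + \sum_(t | t != s) rescaled t i ^+ 2).
  by rewrite (bigD1 s) //= -[in LHS](sqr_sqrtr (rho_ge0 i)); ring.
rewrite lerD2l.
(* The d + 1 numbers of the inequality; rho i is the one with index 0. *)
pose E (o : 'I_d.+1) := if unlift ord0 o is Some t then
   (if t == s then rescaled s i * Num.sqrt (rho i) else rescaled t i ^+ 2) else rescaled s i * Num.sqrt (rho i).
have g0 : 0 <= rescaled s i * Num.sqrt (rho i) by rewrite mulr_ge0 ?rescaled_ge0 ?sqrtr_ge0.
have := @AGM_root R d E (aq i) _ (aq_ge0 i).
rewrite !big_ord_recl /E /= unlift_none.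
under eq_bigr do rewrite liftK.
under [X in _ <= _ + X]eq_bigr do rewrite liftK.
rewrite (bigD1 s) //= eqxx [X in _ -> _ -> _ <= _ + X](bigD1 s) //= eqxx.
under eq_bigr => t /negPf ts do rewrite ts.
under [X in _ <= _ + (_ + X)]eq_bigr => t /negPf ts do rewrite ts.
rewrite [2 * _]mulr_natl mulr2n -addrA; apply.
  by move=> o; case: (unlift _ _) => // t; case: ifP => // _; exact: sqr_ge0.
rewrite aqE mulrA -expr2 exprMn sqr_sqrtr ?rho_ge0 // mulrAC.
have <- : \prod_t rescaled t i ^+ 2 = rescaled s i ^+ 2 * \prod_(t | t != s) rescaled t i ^+ 2.
  by rewrite (bigD1 s).
rewrite /rho -big_split /= (eq_bigr (fun=> a i ^+ 2)) => [|t _].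
  by rewrite prodr_const card_ord exprM.
rewrite sqr_rescaled; have [h|h] := eqVneq (r t (i t)) 0; last by rewrite divfK.
by rewrite h mulr0 (slice_eq0 h) expr0n.
Qed.

Variable dlt : R.
Hypothesis A_le1 : forall s, \sum_j r s j <= 1.
Hypothesis aq_sum : 1 - dlt <= \sum_i aq i.
Hypothesis dlt_ge0 : 0 <= dlt.
Local Notation kap := (d.+1%:R * dlt).

(** Dividing the square of a slice norm by the norm gives the norm back, so each term of
the right-hand side of AGM_defect sums to some A_s. *)
Lemma sum_sqr_rescaled s : \sum_i rescaled s i ^+ 2 = \sum_j r s j.
Proof.
rewrite (partition_big (fun i : I => i s) xpredT) //=; apply: eq_bigr => j _.
under eq_bigr => i /eqP ij do rewrite sqr_rescaled ij.
rewrite -mulr_suml -sqr_slice; have [->|h] := eqVneq (r s j) 0.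
  by rewrite expr0n mul0r.
by rewrite expr2 mulfK.
Qed.
Lemma sum_rho : \sum_i rho i = \prod_s \sum_j r s j.
Proof. exact: sum_prod. Qed.
Lemma prod_A_le (P : pred 'I_d) : 0 <= \prod_(s | P s) \sum_j r s j <= 1.
Proof.
rewrite prodr_ge0 /= => [|s _]; last by rewrite sumr_ge0 // => j _; exact: slice_ge0.
by apply: prodr_ile1 => s _; rewrite A_le1 sumr_ge0 // => j _; exact: slice_ge0.
Qed.
Lemma sum_rho_le1 : \sum_i rho i <= 1.
Proof. by rewrite sum_rho; have /andP[] := prod_A_le xpredT. Qed.
Lemma AM_sum : \sum_i (\sum_t rescaled t i ^+ 2 + rho i) = \sum_t \sum_j r t j + \sum_i rho i.
Proof.
rewrite big_split /= exchange_big /=; congr (_ + _).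
by apply: eq_bigr => t _; rewrite sum_sqr_rescaled.
Qed.
Lemma sum_A_le : \sum_t \sum_j r t j <= d%:R.
Proof.
have -> : d%:R = \sum_(t < d) (1 : R) by rewrite sumr_const card_ord.
exact: ler_sum.
Qed.
(** Summing AGM_defect: the right-hand sides add up to at most d + 1, and the terms with
aq to at least (d + 1) (1 - dlt), which leaves this much for the squares. *)
Lemma rescaled_rho s : \sum_i (rescaled s i - Num.sqrt (rho i)) ^+ 2 <= kap.
Proof.
have : \sum_i ((rescaled s i - Num.sqrt (rho i)) ^+ 2 + d.+1%:R * aq i) <=
   \sum_i (\sum_t rescaled t i ^+ 2 + rho i) by apply: ler_sum => i _; exact: AGM_defect.
rewrite AM_sum big_split /= -mulr_sumr => h.
have := sum_A_le; have := sum_rho_le1; have := aq_sum.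
rewrite -(ler_pM2l (ltr0Sn R d)) mulrBr mulr1 -[in X in X - _](natr1 d).
lra.
Qed.
Hypothesis d_ge2 : (2 <= d)%N.
Let d_gt0 : (0 < d)%N := ltnW d_ge2.
Lemma d_aq_le i : d.+1%:R * aq i <= \sum_t rescaled t i ^+ 2 + rho i.
Proof.
by apply: le_trans (AGM_defect (Ordinal d_gt0) i); rewrite lerDr sqr_ge0.
Qed.
Lemma AM_ge : d.+1%:R - kap <= \sum_t \sum_j r t j + \sum_i rho i.
Proof.
rewrite -AM_sum; apply: le_trans (_ : \sum_i d.+1%:R * aq i <= _); last first.
  by apply: ler_sum => i _; exact: d_aq_le.
by rewrite -mulr_sumr -[X in X - _]mulr1 -mulrBr ler_pM2l ?ltr0n.
Qed.
Lemma sum_rho_ge : 1 - kap <= \sum_i rho i.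
Proof. by have := AM_ge; have := sum_A_le; rewrite -(natr1 d); lra. Qed.
Lemma A_ge s : 1 - kap <= \sum_j r s j.
Proof.
have := AM_ge; have := sum_rho_le1; rewrite (bigD1 s) //=.
have : \sum_(t | t != s) \sum_j r t j <= d.-1%:R.
  apply: (@le_trans _ _ (\sum_(t : 'I_d | t != s) 1)); first exact: ler_sum.
  by rewrite sumr_const cardC1 card_ord.
have dpos : (0 < d)%N by case: (d) s => // -[].
by rewrite -(natr1 d) -[in d%:R](prednK dpos) -(natr1 d.-1); lra.
Qed.
(** The relations rescaled s i * sqrt r_s = a i = rescaled t i * sqrt r_t hold, so a
difference between r_s and r_t shows up as a difference between the two rescaled values,
and both are compared with sqrt (rho i). *)
Lemma rho_psi (s t : 'I_d) i : s != t ->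
  rho i * psi (Num.sqrt (r s (i s))) (Num.sqrt (r t (i t))) <=
  8 * ((rescaled s i - Num.sqrt (rho i)) ^+ 2 + (rescaled t i - Num.sqrt (rho i)) ^+ 2).
Proof.
move=> st; set p := Num.sqrt (r s (i s)); set q := Num.sqrt (r t (i t)).
set u := rescaled s i; set v := rescaled t i; set w := Num.sqrt (rho i).
have p0 : 0 <= p by exact: sqrtr_ge0.
have q0 : 0 <= q by exact: sqrtr_ge0.
have w0 : 0 <= w by exact: sqrtr_ge0.
have -> : rho i = w ^+ 2 by rewrite sqr_sqrtr ?rho_ge0.
have e : u * p = v * q by rewrite -!rescaledE.
have u0 : 0 <= u by exact: rescaled_ge0.
have v0 : 0 <= v by exact: rescaled_ge0.
have psi1 := psi_le1 p0 q0; have psi0 := psi_ge0 p q.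
have sq0 := sqr_ge0 (u - w); have sq1 := sqr_ge0 (v - w).
have [hu|hu] := lerP (2 * u) w; first by have w2 := sqr_ge0 w; nra.
have [hv|hv] := lerP (2 * v) w; first by have w2 := sqr_ge0 w; nra.
have hle : w ^+ 2 * psi p q <= 4 * (u - v) ^+ 2.
  have -> : w ^+ 2 * psi p q = (w * (p - q)) ^+ 2 / (p ^+ 2 + q ^+ 2).
    by rewrite /psi exprMn mulrA.
  have [h0|h0] := eqVneq (p ^+ 2 + q ^+ 2) 0.
    by rewrite h0 invr0 mulr0 mulr_ge0 // sqr_ge0.
  rewrite ler_pdivrMr; last by rewrite lt_def h0 addr_ge0 ?sqr_ge0.
  apply: (@le_trans _ _ ((2 * v * (p - q)) ^+ 2)).
    have hw : w ^+ 2 <= (2 * v) ^+ 2.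
      by rewrite ler_sqr ?nnegrE //; [exact: ltW | rewrite mulr_ge0].
    by rewrite (exprMn _ w) (exprMn _ (2 * v)) ler_wpM2r // sqr_ge0.
  have -> : 2 * v * (p - q) = 2 * ((v - u) * p) by rewrite mulrBl e; ring.
  have := mulr_ge0 (sqr_ge0 (u - v)) (sqr_ge0 q); rewrite !expr2; lra.
apply: (le_trans hle).
have := sqr_ge0 (u + v - 2 * w); rewrite !expr2; lra.
Qed.
(** For different positions, the coordinates i_s and i'_t may be taken from one index
(sum_swap), where rho_psi applies. *)
Lemma pair_psi (s t : 'I_d) : s != t ->
  \sum_(i : I) \sum_(i' : I) rho i * rho i' *
     psi (Num.sqrt (r s (i s))) (Num.sqrt (r t (i' t))) <= 16 * kap.
Proof.
move=> st.
rewrite (sum_swap r (fun x y => psi (Num.sqrt (r s x)) (Num.sqrt (r t y))) st).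
have h : \sum_(i : I) rho i * psi (Num.sqrt (r s (i s))) (Num.sqrt (r t (i t))) <= 16 * kap.
  apply: (@le_trans _ _ (\sum_i 8 * ((rescaled s i - Num.sqrt (rho i)) ^+ 2 +
     (rescaled t i - Num.sqrt (rho i)) ^+ 2))); first by apply: ler_sum => i _; exact: rho_psi.
  rewrite -mulr_sumr big_split /=; have := rescaled_rho s; have := rescaled_rho t; lra.
apply: le_trans h; rewrite ler_piMl //; last exact: sum_rho_le1.
by apply: sumr_ge0 => i _; rewrite mulr_ge0 ?rho_ge0 ?psi_ge0.
Qed.
Hypothesis kap_small : kap <= 2^-1.
(** The same position is handled by passing through a coordinate of another position,
which exists because d is at least 2. *)
Lemma pair_psi_all (s t : 'I_d) :
  \sum_(i : I) \sum_(i' : I) rho i * rho i' *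
     psi (Num.sqrt (r s (i s))) (Num.sqrt (r t (i' t))) <= 320 * kap.
Proof.
have k0 : 0 <= kap by rewrite mulr_ge0.
have [<-{t}|st] := eqVneq s t; last by apply: (le_trans (pair_psi st)); lra.
have [u su] : exists u : 'I_d, s != u.
  case: (eqVneq s (Ordinal (ltnW d_ge2))) => [->|]; last by exists (Ordinal (ltnW d_ge2)).
  by exists (Ordinal d_ge2).
have us : u != s by rewrite eq_sym.
have S0 : 0 < \sum_i rho i by have := sum_rho_ge; have := kap_small; lra.
rewrite -(ler_pM2l S0).
set E := \sum_(i : I) _.
pose sq (t : 'I_d) (i : I) := Num.sqrt (r t (i t)).
have sq0 t i : 0 <= sq t i by exact: sqrtr_ge0.
apply: (@le_trans _ _ (\sum_(i'' : I) \sum_(i : I) \sum_(i' : I)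
   10 * (rho i' * (rho i * rho i'' * psi (sq s i) (sq u i'')) +
         rho i * (rho i'' * rho i' * psi (sq u i'') (sq s i'))))).
  rewrite mulr_suml; apply: ler_sum => i'' _; rewrite mulr_sumr; apply: ler_sum => i _.
  rewrite mulr_sumr; apply: ler_sum => i' _.
  have := psi_triangle (sq0 s i) (sq0 u i'') (sq0 s i').
  have h : 0 <= rho i'' * rho i * rho i' by rewrite !mulr_ge0 ?rho_ge0.
  move=> /(ler_wpM2l h) h2; apply: le_trans (le_trans h2 _).
    by rewrite -/(sq s i) -/(sq s i'); rewrite le_eqVlt; apply/orP; left; apply/eqP; ring.
  by rewrite le_eqVlt; apply/orP; left; apply/eqP; ring.
under eq_bigr do under eq_bigr do rewrite -mulr_sumr big_split /= -mulr_suml -mulr_sumr.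
under eq_bigr do rewrite -mulr_sumr big_split /= -mulr_sumr -mulr_suml.
rewrite -mulr_sumr big_split /= -!mulr_sumr.
rewrite [X in 10 * (_ * X + _)]exchange_big /=.
have := ler_wpM2l (ltW S0) (pair_psi su); have := ler_wpM2l (ltW S0) (pair_psi us).
rewrite /sq; lra.
Qed.
(** The value v is the norm of some slice at the first position, chosen by averaging the
pairwise discrepancies. *)
Lemma exists_level : exists2 v : R, 0 < v &
  forall t : 'I_d, \sum_(i : I) rho i * psi (Num.sqrt v) (Num.sqrt (r t (i t))) <= 640 * d%:R * kap.
Proof.
pose s0 : 'I_d := Ordinal (ltnW d_ge2).
have S0 : 2^-1 <= \sum_i rho i by have := sum_rho_ge; have := kap_small; lra.
have k0 : 0 <= kap by rewrite mulr_ge0.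
pose phi (i : I) := \sum_(t < d) \sum_(i' : I) rho i * rho i' *
     psi (Num.sqrt (r s0 (i s0))) (Num.sqrt (r t (i' t))).
have ph0 i : 0 <= phi i.
  apply: sumr_ge0 => t _; apply: sumr_ge0 => i' _.
  by apply: mulr_ge0 (psi_ge0 _ _); apply: mulr_ge0; exact: rho_ge0.
have [|| i ri hi] := averaging_ratio (E := 640 * d%:R * kap) rho_ge0 ph0.
- by move: S0; lra.
- rewrite /phi exchange_big /=.
  apply: (@le_trans _ _ (\sum_(t < d) 320 * kap)).
    by apply: ler_sum => t _; exact: pair_psi_all.
  rewrite sumr_const card_ord -mulr_natl.
  have dk : 0 <= d%:R * kap by rewrite mulr_ge0.
  nra.
exists (r s0 (i s0)).
  rewrite lt_def slice_ge0 andbT; apply: contraTneq ri => h.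
  by rewrite /rho (bigD1 s0) //= h mul0r ltxx.
move=> t; rewrite -(ler_pM2l ri) [leRHS]mulrC; apply: le_trans hi.
rewrite /phi (bigD1 t) //= mulr_sumr.
apply: ler_wpDr; last by apply: ler_sum => i' _; rewrite -[leRHS]mulrA.
apply: sumr_ge0 => t' _; apply: sumr_ge0 => i' _.
by apply: mulr_ge0 (psi_ge0 _ _); apply: mulr_ge0; exact: rho_ge0.
Qed.

Variable v : R.
Hypothesis v_gt0 : 0 < v.
Hypothesis v_level : forall t : 'I_d,
  \sum_(i : I) rho i * psi (Num.sqrt v) (Num.sqrt (r t (i t))) <= 640 * d%:R * kap.
Local Notation K := (1280 * d%:R ^+ 2 * kap).
Hypothesis K_small : K <= 10000^-1.

Let kap_ge0 : 0 <= kap. Proof. by rewrite mulr_ge0. Qed.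
Let d_ge1 : 1 <= d%:R :> R. Proof. by rewrite ler1n. Qed.
Let K_ge : 1280 * d%:R * kap <= K.
Proof.
by rewrite ler_wpM2r // ler_wpM2l // expr2 ler_peMl // ler0n.
Qed.
Let kap_le : 1280 * kap <= K.
Proof. by apply: le_trans K_ge; rewrite ler_wpM2r // ler_peMr. Qed.
Let K_ge0 : 0 <= K.
Proof. by rewrite mulr_ge0 // mulr_ge0 // exprn_ge0. Qed.

(** Off the level set a slice norm differs from v by a factor of at least 4, hence its
discrepancy is bounded below and its total weight is small (out_level). *)
Definition level (t : 'I_d) : {set 'I_n} := [set j | (v <= 4 * r t j) && (r t j <= 4 * v)].

Lemma far_level t j : j \notin level t -> 0 < r t j ->
  5^-1 <= psi (Num.sqrt v) (Num.sqrt (r t j)).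
Proof.
rewrite inE negb_and -!ltNge => h r0.
apply: psi_far; [exact: sqrtr_ge0|by rewrite (sqrtr_gt0 (r t j))|].
have E (x : R) : 2 * Num.sqrt x = Num.sqrt (4 * x).
  have -> : 4 = 2 ^+ 2 :> R by rewrite expr2 -natrM.
  by rewrite sqrtrM ?sqr_ge0 // sqrtr_sqr ger0_norm.
rewrite (E v) (E (r t j)); case/orP: h => h; [right|left]; apply: ler_wsqrtr; exact: ltW.
Qed.
Lemma level_psi t : \sum_j r t j * psi (Num.sqrt v) (Num.sqrt (r t j)) <= K.
Proof.
have := v_level t.
rewrite (sum_prod1 r t (fun j => psi (Num.sqrt v) (Num.sqrt (r t j)))).
have h : 2^-1 <= \prod_(u | u != t) \sum_j r u j.
  apply: le_trans (_ : \sum_i rho i <= _); first by have := sum_rho_ge; have := kap_small; lra.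
  rewrite sum_rho (bigD1 t) //= ler_piMl //; first by have /andP[] := prod_A_le (fun u => u != t).
have S0 : 0 <= \sum_j r t j * psi (Num.sqrt v) (Num.sqrt (r t j)).
  by apply: sumr_ge0 => j _; rewrite mulr_ge0 ?slice_ge0 ?psi_ge0.
have := K_ge; have := ler_wpM2r S0 h; lra.
Qed.
Lemma out_level t : \sum_(j | j \notin level t) r t j <= 5 * K.
Proof.
apply: le_trans (_ : 5 * \sum_j r t j * psi (Num.sqrt v) (Num.sqrt (r t j)) <= _); last first.
  by rewrite ler_pM2l // level_psi.
rewrite [X in 5 * X](bigID (fun j => j \in level t)) /= mulrDr; apply: ler_wpDl.
  by rewrite mulr_ge0 // sumr_ge0 // => j _; rewrite mulr_ge0 ?slice_ge0 ?psi_ge0.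
rewrite mulr_sumr; apply: ler_sum => j jL.
have [->|r0] := eqVneq (r t j) 0; first by rewrite mul0r mulr0.
have rpos : 0 < r t j by rewrite lt_def r0 slice_ge0.
have := far_level jL rpos; move: (psi _ _) => p; nra.
Qed.
Lemma level_sqr t : \sum_(j in level t) (r t j - v) ^+ 2 <= 180 * v * K.
Proof.
apply: le_trans (_ : 180 * v * \sum_j r t j * psi (Num.sqrt v) (Num.sqrt (r t j)) <= _); last first.
  by rewrite ler_wpM2l ?level_psi // mulr_ge0 // ltW.
rewrite [X in _ * X](bigID (fun j => j \in level t)) /= mulrDr; apply: ler_wpDr.
  by rewrite !mulr_ge0 ?(ltW v_gt0) // sumr_ge0 // => j _; rewrite mulr_ge0 ?slice_ge0 ?psi_ge0.
rewrite mulr_sumr; apply: ler_sum => j; rewrite inE => /andP[h1 h2].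
set x := Num.sqrt v; set y := Num.sqrt (r t j).
have x0 : 0 <= x by exact: sqrtr_ge0.
have y0 : 0 <= y by exact: sqrtr_ge0.
have xE : v = x ^+ 2 by rewrite sqr_sqrtr // ltW.
have yE : r t j = y ^+ 2 by rewrite sqr_sqrtr // slice_ge0.
have p0 := psi_ge0 x y.
have yx : y <= 2 * x.
  by rewrite -ler_sqr ?nnegrE ?mulr_ge0 // exprMn -xE -yE (_ : 2 ^+ 2 = 4) // expr2 -natrM.
have e1 : (r t j - v) ^+ 2 = psi x y * (x ^+ 2 + y ^+ 2) * (x + y) ^+ 2.
  by rewrite -psiE xE yE; ring.
rewrite e1; apply: (@le_trans _ _ (psi x y * (5 * v) * (9 * v))).
  apply: ler_pM; rewrite ?sqr_ge0 //.
  - by rewrite mulr_ge0 // addr_ge0 ?sqr_ge0.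
  - by rewrite ler_wpM2l // -xE -yE; lra.
  - by rewrite xE; nra.
have : psi x y * (45 * v) * v <= psi x y * (45 * v) * (4 * r t j).
  by rewrite ler_wpM2l // mulr_ge0 // mulr_ge0 // ltW.
lra.
Qed.
Definition inside (J : 'I_d -> {set 'I_n}) (i : I) := [forall s, i s \in J s].
Lemma outside_le (J : 'I_d -> {set 'I_n}) (f : I -> R) : (forall i, 0 <= f i) ->
  \sum_(i | ~~ inside J i) f i <= \sum_s \sum_(i : I | i s \notin J s) f i.
Proof.
move=> f0; under [leRHS]eq_bigr do rewrite big_mkcond /=.
rewrite exchange_big /= big_mkcond /=; apply: ler_sum => i _.
case: ifP => [|_]; last by apply: sumr_ge0 => s _; case: ifP.
rewrite negb_forall => /existsP[s hs]; rewrite (bigD1 s) //= hs lerDl.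
by apply: sumr_ge0 => u _; case: ifP.
Qed.
(** The product weights rho have the r_t as their marginals, up to factors at most 1. *)
Lemma rho_slice t (f : pred 'I_n) : \sum_(i : I | f (i t)) rho i <= \sum_(j | f j) r t j.
Proof.
rewrite big_mkcond /=.
rewrite (eq_bigr (fun i : I => rho i * (f (i t))%:R)) => [|i _]; last first.
  by case: ifP; rewrite ?mulr1 ?mulr0.
rewrite (sum_prod1 r t (fun j => (f j)%:R)) [leRHS]big_mkcond /=.
apply: le_trans (_ : \sum_j r t j * (f j)%:R <= _); last first.
  by apply: ler_sum => j _; case: ifP; rewrite ?mulr1 ?mulr0.
have /andP[p0 p1] := prod_A_le (fun u => u != t).
by rewrite ler_piMl // sumr_ge0 // => j _; rewrite mulr_ge0 ?slice_ge0.
Qed.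
Lemma rho_outside (J : 'I_d -> {set 'I_n}) (e : R) :
  (forall t, \sum_(j | j \notin J t) r t j <= e) ->
  \sum_(i | ~~ inside J i) rho i <= d%:R * e.
Proof.
move=> h; apply: (le_trans (outside_le _ rho_ge0)).
apply: (@le_trans _ _ (\sum_(s < d) e)); last by rewrite sumr_const card_ord mulr_natl.
by apply: ler_sum => s _; apply: le_trans (h s); exact: rho_slice (fun j => j \notin J s).
Qed.
Lemma sqr_split (y w : R) : y ^+ 2 <= 2 * (y - w) ^+ 2 + 2 * w ^+ 2.
Proof. by have := sqr_ge0 (y - 2 * w); rewrite !expr2; lra. Qed.
(** The functions rescaled t and sqrt rho are close in the Euclidean norm, so mass
estimates for rho transfer to them. *)
Lemma rescaled_outside t (P : pred I) :
  \sum_(i | P i) rescaled t i ^+ 2 <= 2 * kap + 2 * \sum_(i | P i) rho i.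
Proof.
apply: le_trans (_ : \sum_(i | P i) (2 * (rescaled t i - Num.sqrt (rho i)) ^+ 2 + 2 * rho i) <= _).
  apply: ler_sum => i _; apply: le_trans (sqr_split _ (Num.sqrt (rho i))) _.
  by rewrite (sqr_sqrtr (rho_ge0 i)).
rewrite big_split /= -!mulr_sumr lerD2r ler_pM2l //.
apply: le_trans (rescaled_rho t); rewrite big_mkcond /=; apply: ler_sum => i _.
by case: ifP => // _; exact: sqr_ge0.
Qed.

Lemma rho_outside_level : \sum_(i | ~~ inside level i) rho i <= 5 / 2 * K.
Proof.
apply: (le_trans (outside_le _ rho_ge0)).
apply: (@le_trans _ _ (\sum_(s < d) 5 * (640 * d%:R * kap))); last first.
  by rewrite sumr_const card_ord -mulr_natr le_eqVlt; apply/orP; left; apply/eqP; field.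
apply: ler_sum => s _; apply: le_trans (ler_wpM2l _ (v_level s)) => //.
rewrite mulr_sumr big_mkcond /=; apply: ler_sum => i _; case: ifP => [h|_]; last first.
  by rewrite mulr_ge0 // mulr_ge0 ?rho_ge0 ?psi_ge0.
have [r0|r0] := eqVneq (r s (i s)) 0; last first.
  have := far_level h; rewrite lt_def r0 slice_ge0 => /(_ isT).
  have := rho_ge0 i; move: (psi _ _) => p; nra.
by rewrite [rho i](_ : _ = 0) ?mul0r ?mulr0 // /rho (bigD1 s) //= r0 mul0r.
Qed.
Let Sq := \sum_(i | inside level i) a i ^+ 2.
(** The mass of T in the part of the t-th level set that lies outside the box is small,
so the sum of the squared slice norms is almost independent of t. Together with the
closeness of the slice norms to v this makes the cardinals of the level sets almost
equal. *)
Lemma slices_inside t : exists2 e, 0 <= e <= 21 * v * K &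
  \sum_(j in level t) r t j ^+ 2 = Sq + e.
Proof.
exists (\sum_(i : I | (i t \in level t) && ~~ inside level i) a i ^+ 2); last first.
  have -> : \sum_(j in level t) r t j ^+ 2 = \sum_(i : I | i t \in level t) a i ^+ 2.
    rewrite (partition_big (fun i : I => i t) (fun j => j \in level t)) //=.
    apply: eq_bigr => j jL; rewrite sqr_slice; apply: eq_bigl => i.
    by case: eqP => [->|_]; rewrite ?jL ?andbF.
  rewrite (bigID (inside level)) /=; congr (_ + _); apply: eq_bigl => i.
  by case: (boolP (inside level i)) => [/forallP/(_ t) ->|_]; rewrite ?andbF.
rewrite sumr_ge0 /= => [|i _]; last exact: sqr_ge0.
apply: le_trans (_ : 4 * v * \sum_(i | ~~ inside level i) rescaled t i ^+ 2 <= _).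
  rewrite mulr_sumr big_mkcond /= [leRHS]big_mkcond /=; apply: ler_sum => i _.
  case: ifP => [/andP[h ->]|_]; last first.
    by case: ifP => // _; rewrite mulr_ge0 ?sqr_ge0 // mulr_ge0 // ltW.
  rewrite {1}(rescaledE t i) exprMn sqr_sqrtr ?slice_ge0 // mulrC ler_wpM2r ?sqr_ge0 //.
  by move: h; rewrite inE => /andP[].
have h := rescaled_outside t (fun i => ~~ inside level i).
have h2 := rho_outside_level.
have := ler_wpM2l (mulr_ge0 (ler0n R 4) (ltW v_gt0)) h; move/le_trans; apply.
have -> : 21 * v * K = 4 * v * (21 / 4 * K) by field.
apply: ler_wpM2l; first by rewrite mulr_ge0 // ltW.
by move: h2 kap_le K_ge0; set KK := K; set kp := kap; move: (\sum_(i | _) rho i) => X; lra.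
Qed.

Let cardv (t : 'I_d) : v * #|level t|%:R * v + Sq <= 2 * v + 180 * v * K.
Proof.
have [e /andP[e0 e1] eE] := slices_inside t; have := level_sqr t.
rewrite sum_sqr_sub eE.
have : \sum_(j in level t) r t j <= 1.
  apply: le_trans (A_le1 t); rewrite [leRHS](bigID (fun j => j \in level t)) /= lerDl.
  by apply: sumr_ge0 => j _; exact: slice_ge0.
move: (\sum_(j in level t) r t j) => X; have := v_gt0; rewrite expr2; nra.
Qed.
Let sum_level t : 1 - 6 * K <= \sum_(j in level t) r t j.
Proof.
have := A_ge t; rewrite (bigID (fun j => j \in level t)) /=.
by have := out_level t; have := kap_le; have := K_ge0; lra.
Qed.
Let cardv_ge (t : 'I_d) : 2 * v - 33 * v * K <= v * #|level t|%:R * v + Sq.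
Proof.
have [e /andP[e0 e1] eE] := slices_inside t.
have : 0 <= \sum_(j in level t) (r t j - v) ^+ 2 by apply: sumr_ge0 => j _; exact: sqr_ge0.
rewrite sum_sqr_sub eE.
have := sum_level t; move: (\sum_(j in level t) r t j) => X; have := v_gt0; rewrite expr2; nra.
Qed.
Let card_diff (t u : 'I_d) : v * #|level t|%:R <= v * #|level u|%:R + 213 * K.
Proof.
rewrite -(ler_pM2r v_gt0); have := cardv t; have := cardv_ge u; lra.
Qed.

(** The cardinals of the level sets agree up to a relative error of order K, so trimming
the sets to the smallest cardinal costs only a mass of order K. *)
Lemma trimmed_level : exists (m : nat) (J : 'I_d -> {set 'I_n}),
  [/\ forall t, #|J t| = m, forall t, J t \subset level t,
      forall t, 1 - 966 * K <= \sum_(j in J t) r t j,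
      8^-1 <= v * m%:R <= 4 &
      forall t, \sum_(j in J t) (m%:R * r t j - 1) ^+ 2 <= 8300 * m%:R * K].
Proof.
pose s0 : 'I_d := Ordinal d_gt0.
case: (@arg_minnP _ s0 xpredT (fun t : 'I_d => #|level t|) isT) => t0 _ tmin.
have [m mE] : exists m, #|level t0| = m by exists #|level t0|.
rewrite mE in tmin.
have [J hJ hc] := fin_all_exists2 (fun t => subset_of_card (tmin t isT)).
have J_sum t : 1 - 966 * K <= \sum_(j in J t) r t j.
  have := sum_level t; rewrite (big_setID (J t)) /= (setIidPr (hJ t)).
  have h : \sum_(j in level t :\: J t) r t j <= 4 * v * (#|level t|%:R - m%:R).
    apply: (@le_trans _ _ (\sum_(j in level t :\: J t) 4 * v)).
      by apply: ler_sum => j; rewrite !inE => /andP[_ /andP[]].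
    rewrite sumr_const -[leLHS]mulr_natr cardsD (setIidPr (hJ t)) hc natrB //.
    exact: tmin.
  have h2 : 4 * v * (#|level t|%:R - m%:R) <= 4 * (213 * K).
    rewrite -mulrA ler_pM2l // mulrBr lerBlDl.
    by have := card_diff t t0; rewrite mE.
  move: (le_trans h h2) K_ge0; set KK := K.
  move: (\sum_(i in J t) r t i) (\sum_(i in _) r t i) => X Y; lra.
have c0 : v * m%:R <= 4.
  have : \sum_(j in level t0) v <= \sum_(j in level t0) 4 * r t0 j.
    by apply: ler_sum => j; rewrite inE => /andP[].
  rewrite sumr_const -[leLHS]mulr_natr -mulr_sumr mE => /le_trans; apply.
  have : \sum_(j in level t0) r t0 j <= 1; last by lra.
  apply: le_trans (A_le1 t0); rewrite [leRHS](bigID (fun j => j \in level t0)) /= lerDl.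
  by apply: sumr_ge0 => j _; exact: slice_ge0.
have c1 : 8^-1 <= v * m%:R.
  have : \sum_(j in level t0) r t0 j <= \sum_(j in level t0) 4 * v.
    by apply: ler_sum => j; rewrite inE => /andP[].
  rewrite sumr_const -[leRHS]mulr_natr mE; have := sum_level t0; have := K_small; lra.
exists m, J; split=> // [|t]; first by rewrite c0 c1.
have m0 : 0 <= m%:R :> R by exact: ler0n.
have hs : \sum_(j in J t) (r t j - v) ^+ 2 <= 180 * v * K.
  apply: le_trans (level_sqr t); rewrite [leRHS](big_setID (J t)) /= (setIidPr (hJ t)) lerDl.
  by apply: sumr_ge0 => j _; exact: sqr_ge0.
have hv : (m%:R * v - 1) ^+ 2 <= 3400 * K.
  pose X := \sum_(j in J t) (r t j - v).
  have XE : X = \sum_(j in J t) r t j - m%:R * v.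
    by rewrite /X sumrB sumr_const hc mulr_natl.
  have X2 : X ^+ 2 <= m%:R * (180 * v * K).
    apply: (@le_trans _ _ (m%:R * \sum_(j in J t) (r t j - v) ^+ 2)); last by rewrite ler_wpM2l.
    by rewrite -(hc t) sqr_sum_le.
  have s1 : \sum_(j in J t) r t j <= 1.
    apply: le_trans (A_le1 t); rewrite [leRHS](bigID (fun j => j \in J t)) /= lerDl.
    by apply: sumr_ge0 => j _; exact: slice_ge0.
  have := J_sum t; move: XE X2 s1; move: (\sum_(j in J t) r t j) X => Y X XE X2 s1 s2.
  have e1 : m%:R * v - 1 = (Y - 1) - X by rewrite XE; ring.
  have : (Y - 1) ^+ 2 <= 966 * K by have := K_small; have := K_ge0; nra.
  have := sqr_ge0 (Y - 1 + X); rewrite e1.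
  have := K_ge0; move: c0 X2; rewrite !expr2; nra.
apply: (@le_trans _ _ (\sum_(j in J t) (2 * m%:R ^+ 2 * (r t j - v) ^+ 2 + 2 * (m%:R * v - 1) ^+ 2))).
  apply: ler_sum => j _.
  by have := sqr_ge0 (m%:R * (r t j - v) - (m%:R * v - 1)); rewrite !expr2; lra.
rewrite big_split /= -mulr_sumr sumr_const hc -[X in _ + X]mulr_natr.
have := ler_wpM2l (mulr_ge0 (ler0n R 2) (sqr_ge0 m%:R)) hs.
have := ler_wpM2r m0 hv; have := K_ge0; have := c0; have := mulr_ge0 m0 K_ge0; rewrite !expr2.
nra.
Qed.

Lemma inside_prod (J : 'I_d -> {set 'I_n}) (i : I) :
  (inside J i)%:R = \prod_u (i u \in J u)%:R :> R.
Proof.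
case: (boolP (inside J i)) => [/forallP h|]; first by rewrite big1 // => u _; rewrite h.
by rewrite negb_forall => /existsP[u /negPf hu]; rewrite (bigD1 u) //= hu mul0r.
Qed.
Lemma sum_inside1 (J : 'I_d -> {set 'I_n}) m (f : 'I_n -> R) t : (forall t, #|J t| = m) ->
  \sum_(i | inside J i) f (i t) = m%:R ^+ d.-1 * \sum_(j in J t) f j.
Proof.
move=> hJ; rewrite big_mkcond /=.
rewrite (eq_bigr (fun i : I => (\prod_u (i u \in J u)%:R) * f (i t))) => [|i _]; last first.
  by rewrite -inside_prod; case: (inside J i); rewrite ?mul1r ?mul0r.
rewrite (sum_prod1 (fun u j => (j \in J u)%:R) t f); congr (_ * _).
  rewrite (eq_bigr (fun=> m%:R)) => [|u _]; first by rewrite prodr_const cardC1 card_ord.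
  by rewrite -natr_sum sum1_card_in hJ.
by rewrite [RHS]big_mkcond; apply: eq_bigr => j _; case: (j \in J t); rewrite ?mul1r ?mul0r.
Qed.

(** Outside the box the bound comes from rho and from rescaled_outside. Inside, a i is
compared with sqrt (r_s(i_s) rho i), which is c times a product of factors close to 1.
The Euclidean mass in the box is recovered from the mass with exponent q by the
arithmetic-geometric inequality, in which equality holds at the value c. *)
Lemma flat_core : exists (m : nat) (J : 'I_d -> {set 'I_n}),
  let c := (Num.sqrt m%:R)^-1 ^+ d.+1 in
  [/\ (0 < m)%N, forall t, #|J t| = m,
      \sum_(i | ~~ inside J i) aq i <= 2000 * d%:R * K,
      \sum_(i | inside J i) (a i - c) ^+ 2 <= 500 * 1000 * 16 ^+ d * d%:R ^+ 2 * K / m%:R &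
      (forall t j, j \in J t -> r t j <= 16 / m%:R) /\
      1 - 5000 * d%:R * K <= m%:R * \sum_(i | inside J i) a i ^+ 2].
Proof.
have [m [J [hc hJ J_sum /andP[c1 c0] hsq]]] := trimmed_level.
have m_gt0 : (0 < m)%N by rewrite lt0n; apply: contraTneq c1 => ->; rewrite mulr0 -ltNge invr_gt0 ltr0n.
have mR0 : 0 < m%:R :> R by rewrite ltr0n.
have v_le : v <= 4 / m%:R by rewrite ler_pdivlMr.
have r_le t j : j \in J t -> r t j <= 16 / m%:R.
  move=> /(subsetP (hJ t)); rewrite inE => /andP[_ h]; apply: (le_trans h).
  by have := ler_wpM2l (ler0n R 4) v_le; rewrite mulrA -natrM.
have J_out t : \sum_(j | j \notin J t) r t j <= 966 * K.
  by have := A_le1 t; rewrite (bigID (fun j => j \in J t)) /= => h; exact: rest_le h (J_sum t).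
have rho_out : \sum_(i | ~~ inside J i) rho i <= d%:R * (966 * K) := rho_outside J_out.
have F1 : \sum_(i | ~~ inside J i) aq i <= 2000 * d%:R * K.
  rewrite -(ler_pM2l (ltr0Sn R d)) mulr_sumr.
  apply: le_trans (_ : \sum_(i | ~~ inside J i) (\sum_t rescaled t i ^+ 2 + rho i) <= _).
    by apply: ler_sum => i _; exact: d_aq_le.
  rewrite big_split /= exchange_big /=.
  apply: (@le_trans _ _ (\sum_(t < d) (2 * kap + 2 * \sum_(i | ~~ inside J i) rho i) + \sum_(i | ~~ inside J i) rho i)).
    by rewrite lerD2r; apply: ler_sum => t _; exact: rescaled_outside.
  rewrite sumr_const card_ord -[X in X + _]mulr_natl.
  have X0 : 0 <= \sum_(i | ~~ inside J i) rho i by apply: sumr_ge0 => i _; exact: rho_ge0.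
  move: rho_out X0; move: (\sum_(i | _) rho i) => X hX X0.
  have key : 2 * kap + 2 * X <= 2000 * d%:R * K.
    have := ler_wpM2r K_ge0 d_ge1; rewrite mul1r => dK.
    move: hX; rewrite -(mulrA 2000) mulrCA => hX; exact: out_mass hX dK kap_le K_ge0.
  have k0 := kap_ge0.
  have dS : d.+1%:R = d%:R + 1 :> R by rewrite natr1.
  rewrite [X in _ <= X * _]dS (mulrDl d%:R 1) mul1r; apply: lerD; last first.
    by apply: le_trans key; rewrite -[leLHS]add0r lerD ?mulr_ge0 // ler_peMl // ler1n.
  by rewrite ler_wpM2l.
exists m, J => c.
have sm0 : 0 < Num.sqrt m%:R :> R by rewrite sqrtr_gt0.
have c2 : c ^+ 2 = (m%:R ^+ d.+1)^-1.
  by rewrite /c -exprM mulnC exprM exprVn sqr_sqrtr ?ler0n // exprVn.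
have F2 : \sum_(i | inside J i) (a i - c) ^+ 2 <= 500 * 1000 * 16 ^+ d * d%:R ^+ 2 * K / m%:R.
  pose s0 : 'I_d := Ordinal d_gt0.
  pose z t (i : I) := Num.sqrt (m%:R * r t (i t)).
  (* The expected value of a i: the quotient rescaled s0 i replaced by sqrt (rho i). *)
  pose w (i : I) := Num.sqrt (r s0 (i s0)) * Num.sqrt (rho i).
  have wE (i : I) : w i = c * (z s0 i * \prod_t z t i).
    have zr t (j : 'I_n) : Num.sqrt (r t j) = (Num.sqrt m%:R)^-1 * Num.sqrt (m%:R * r t j).
      by rewrite sqrtrM ?ler0n // mulKf // gt_eqF.
    rewrite /w; have -> : Num.sqrt (rho i) = \prod_t Num.sqrt (r t (i t)).
      have p0 : 0 <= \prod_(t < d) Num.sqrt (r t (i t)) by apply: prodr_ge0 => t _; exact: sqrtr_ge0.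
      rewrite -[RHS]ger0_norm // -sqrtr_sqr -prodrXl; congr Num.sqrt.
      by apply: eq_bigr => t _; rewrite sqr_sqrtr // slice_ge0.
    rewrite zr; under eq_bigr do rewrite zr.
    rewrite big_split /= prodr_const card_ord /c exprS /z; ring.
  have z_bd t (i : I) : inside J i -> 0 <= z t i <= 4.
    move=> /forallP/(_ t) h; rewrite sqrtr_ge0 /=.
    have -> : 4 = Num.sqrt (4 ^+ 2) :> R by rewrite sqrtr_sqr ger0_norm.
    apply: ler_wsqrtr; have := ler_wpM2l (ler0n R m) (r_le t _ h).
    by rewrite (mulrC m%:R (16 / _)) divfK ?gt_eqF // => /le_trans; apply; rewrite expr2 -natrM.
  have z_sub t (i : I) : `|z t i - 1| ^+ 2 <= (m%:R * r t (i t) - 1) ^+ 2.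
    rewrite real_normK ?num_real //.
    have p0 : 0 <= m%:R * r t (i t) by rewrite mulr_ge0 ?ler0n ?slice_ge0.
    have -> : m%:R * r t (i t) - 1 = (z t i - 1) * (z t i + 1).
      by rewrite -{1}(sqr_sqrtr p0) -/(z t i); ring.
    rewrite exprMn ler_peMr ?sqr_ge0 // expr_ge1 // ?addr_ge0 ?sqrtr_ge0 //.
    by rewrite lerDr sqrtr_ge0.
  have prod_sub (i : I) : inside J i ->
      (z s0 i * \prod_t z t i - 1) ^+ 2 <=
      25 * 16 ^+ d * d%:R * \sum_t (m%:R * r t (i t) - 1) ^+ 2.
    move=> hi; have /andP[z0 z4] := z_bd s0 i hi.
    have h1 : `|z s0 i * \prod_t z t i - 1| <= 5 * 4 ^+ d * \sum_t `|z t i - 1|.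
      have -> : z s0 i * \prod_t z t i - 1 = z s0 i * (\prod_t z t i - 1) + (z s0 i - 1) by ring.
      apply: (le_trans (ler_normD _ _)); rewrite normrM (ger0_norm z0).
      have h2 := norm_prod_sub1 (index_enum 'I_d) (_ : 1 <= 4 :> R) (fun t => z_bd t i hi).
      have {}h2 := h2 (ler1n R 4).
      rewrite (_ : size _ = d) in h2; last by rewrite [index_enum _]unlock -enumT size_enum_ord.
      have S0 : 0 <= \sum_t `|z t i - 1| by apply: sumr_ge0 => t _; exact: normr_ge0.
      have h3 : `|z s0 i - 1| <= \sum_t `|z t i - 1|.
        by rewrite (bigD1 s0) //= lerDl; apply: sumr_ge0 => t _; exact: normr_ge0.
      have h4 : 1 <= 4 ^+ d :> R by rewrite exprn_ege1 // ler1n.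
      move: h2 S0 h3 h4 z4 z0; have := normr_ge0 (\prod_t z t i - 1).
      move: (\sum_t `|z t i - 1|) (`|\prod_t z t i - 1|) (`|z s0 i - 1|) (4 ^+ d) (z s0 i).
      move=> S P Q F Z P0 h2 S0 h3 h4 z4' z0'; exact: (prod_step_le z0' z4' P0 h2 S0 h3 h4).
    rewrite -[_ ^+ 2]real_normK ?num_real //.
    have S0 : 0 <= \sum_t `|z t i - 1| by apply: sumr_ge0 => t _; exact: normr_ge0.
    apply: (@le_trans _ _ ((5 * 4 ^+ d * \sum_t `|z t i - 1|) ^+ 2)).
      by rewrite ler_sqr // nnegrE ?normr_ge0 // mulr_ge0 // mulr_ge0 // exprn_ge0.
    move: S0; set S := \sum_t `|z t i - 1| => S0.
    have -> : (5 * 4 ^+ d * S) ^+ 2 = 25 * 16 ^+ d * S ^+ 2.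
      have -> : 16 ^+ d = (4 ^+ d) ^+ 2 :> R.
        by rewrite -exprM mulnC exprM; congr (_ ^+ d); rewrite expr2 -natrM.
      ring.
    rewrite -(mulrA (25 * _)) ler_wpM2l ?mulr_ge0 ?exprn_ge0 //.
    have := sqr_sum_le [set: 'I_d] (fun t => `|z t i - 1|); rewrite cardsT card_ord.
    under eq_bigl do rewrite inE; under [X in _ <= _ * X]eq_bigl do rewrite inE.
    move/le_trans; apply; rewrite ler_wpM2l ?ler0n //.
    by apply: ler_sum => t _; exact: z_sub.
  have e1 : \sum_(i | inside J i) (a i - w i) ^+ 2 <= 16 / m%:R * kap.
    apply: le_trans (ler_wpM2l _ (rescaled_rho s0)); last by rewrite divr_ge0 ?ler0n.
    rewrite mulr_sumr big_mkcond /=; apply: ler_sum => i _; case: ifP => [|_]; last first.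
      by rewrite mulr_ge0 ?sqr_ge0 // divr_ge0 ?ler0n.
    move=> /forallP/(_ s0) h; rewrite {1}(rescaledE s0 i) /w [X in _ - X]mulrC -mulrBl exprMn.
    by rewrite sqr_sqrtr ?slice_ge0 // mulrC ler_wpM2r ?sqr_ge0 // r_le.
  pose Y := 16 ^+ d * d%:R ^+ 2 * K / m%:R.
  have e2 : \sum_(i | inside J i) (w i - c) ^+ 2 <=
      25 * 8300 * Y.
    apply: (@le_trans _ _ (c ^+ 2 * (25 * 16 ^+ d * d%:R * \sum_t \sum_(i | inside J i) (m%:R * r t (i t) - 1) ^+ 2))).
      rewrite exchange_big /= !mulr_sumr; apply: ler_sum => i hi.
      rewrite wE -[X in _ - X]mulr1 -mulrBr exprMn ler_wpM2l ?sqr_ge0 //; exact: prod_sub.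
    apply: (@le_trans _ _ (c ^+ 2 * (25 * 16 ^+ d * d%:R * \sum_(t < d) m%:R ^+ d.-1 * (8300 * m%:R * K)))).
      rewrite ler_wpM2l ?sqr_ge0 // ler_wpM2l ?mulr_ge0 ?exprn_ge0 //.
      apply: ler_sum => t _; rewrite (sum_inside1 (fun j => (m%:R * r t j - 1) ^+ 2) t hc).
      by rewrite ler_wpM2l ?exprn_ge0 ?ler0n.
    rewrite sumr_const card_ord -[_ *+ d]mulr_natl c2.
    have -> : m%:R ^+ d.+1 = m%:R ^+ d.-1 * m%:R * m%:R :> R.
      by rewrite -[in LHS](prednK d_gt0) !exprSr.
    rewrite le_eqVlt /Y; apply/orP; left; apply/eqP; field.
    by rewrite expf_neq0 gt_eqF.
  apply: (@le_trans _ _ (\sum_(i | inside J i) (2 * (a i - w i) ^+ 2 + 2 * (w i - c) ^+ 2))).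
    by apply: ler_sum => i _; exact: sqr_tri.
  rewrite big_split /= -!mulr_sumr.
  have e3 : 16 / m%:R * kap <= Y.
    rewrite [leLHS]mulrAC ler_wpM2r ?invr_ge0 ?ler0n //.
    apply: ler_pM; rewrite ?ler0n //; last by exact: le_of_1280 kap_le kap_ge0.
    rewrite -[leLHS]mulr1; apply: ler_pM; rewrite ?ler0n ?ler01 // ?exprn_ege1 //.
    by rewrite -[leLHS]expr1 ler_weXn2l ?ler1n.
  rewrite (_ : 500 * 1000 * 16 ^+ d * d%:R ^+ 2 * K / m%:R = 500 * 1000 * Y); last first.
    by rewrite /Y; ring.
  apply: combine_errors (le_trans e1 e3) e2 _.
  by rewrite /Y divr_ge0 ?ler0n // mulr_ge0 // mulr_ge0 // exprn_ge0.
split => //; split=> //.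
have cin : \sum_(i | inside J i) c ^+ 2 = m%:R^-1.
  have := sum_inside1 (fun _ => c ^+ 2) (Ordinal d_gt0) hc; rewrite /= => ->.
  rewrite sumr_const hc -(mulr_natl (c ^+ 2) m) c2.
  have -> : m%:R ^+ d.+1 = m%:R ^+ d.-1 * m%:R * m%:R :> R.
    by rewrite -[in LHS](prednK d_gt0) !exprSr.
  by field; rewrite gt_eqF //= expf_neq0 // gt_eqF.
have pt (i : I) : d.+1%:R * (aq i / m%:R) <= c ^+ 2 + d%:R * a i ^+ 2.
  pose E (o : 'I_d.+1) := if unlift ord0 o is Some t then a i ^+ 2 else c ^+ 2.
  have := @AGM_root R d E (aq i / m%:R).
  rewrite !big_ord_recl /E /= unlift_none.
  under eq_bigr do rewrite liftK.
  under [X in _ <= _ + X]eq_bigr do rewrite liftK.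
  rewrite prodr_const sumr_const card_ord -[X in _ + X]mulr_natl; apply.
  - by move=> o; case: (unlift _ _) => [_|]; exact: sqr_ge0.
  - by rewrite divr_ge0 ?ler0n.
  - by rewrite expr_div_n aqE c2 exprM mulrC.
have : d.+1%:R / m%:R * \sum_(i | inside J i) aq i <= m%:R^-1 + d%:R * \sum_(i | inside J i) a i ^+ 2.
  rewrite -[X in _ <= X + _]cin !mulr_sumr -big_split /=; apply: ler_sum => i _.
  by rewrite -[d.+1%:R / m%:R * _]mulrA [m%:R^-1 * _]mulrC; exact: pt.
have aqin : 1 - dlt - 2000 * d%:R * K <= \sum_(i | inside J i) aq i.
  rewrite lerBlDr; apply: (le_trans aq_sum).
  by rewrite (bigID (inside J)) /= lerD2l.
move=> H.
have -> : 5000 * d%:R * K = 2 * (2500 * d%:R * K) by ring.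
apply: (@mass_of_AGM _ d%:R (\sum_(i | inside J i) aq i) _ _ d_ge1).
- have := ler_wpM2l (ler0n R m) H.
  rewrite mulrDr mulfV ?gt_eqF // mulrA mulrCA mulfV ?gt_eqF // mulr1 -natr1 => /le_trans; apply.
  by rewrite lerD2l mulrCA.
- apply: le_trans aqin.
  have h1 := ler_wpM2r K_ge0 d_ge1.
  have h2 : dlt <= kap by rewrite ler_peMl // ler1n.
  have h3 := le_of_1280 kap_le kap_ge0.
  rewrite -!(mulrA _ d%:R); move: h1 h2 h3; set D := d%:R * K; rewrite mul1r.
  by apply: mass_margin; rewrite /D mulr_ge0.
- by rewrite mulr_ge0 // mulr_ge0.
Qed.
End Flatness.

(** The bound on the slices serves the estimate of the cuts, and the last inequality the
construction of the unitary matrices. The array aq stands for the q-th powers of the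
entries, so that the statement involves integer powers only. *)
Lemma flatness (R : rcfType) (d : nat) : (2 <= d)%N ->
  exists C dlt0 : R, [/\ 0 <= C, 0 < dlt0 &
  forall (n : nat) (a aq : {ffun 'I_d -> 'I_n} -> R) (dlt : R),
  (forall i, 0 <= a i) -> (forall i, 0 <= aq i) ->
  (forall i, aq i ^+ d.+1 = a i ^+ (2 * d)) ->
  (forall s, \sum_j slice a s j <= 1) -> 1 - dlt <= \sum_i aq i ->
  0 <= dlt <= dlt0 ->
  exists (m : nat) (J : 'I_d -> {set 'I_n}),
  let c := (Num.sqrt m%:R)^-1 ^+ d.+1 in
  [/\ (0 < m)%N, forall t, #|J t| = m,
      \sum_(i | ~~ inside J i) aq i <= C * dlt,
      \sum_(i | inside J i) (a i - c) ^+ 2 <= C * dlt / m%:R &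
      (forall t j, j \in J t -> slice a t j <= 16 / m%:R) /\
      1 - C * dlt <= m%:R * \sum_(i | inside J i) a i ^+ 2]].
Proof.
move=> d2.
have d1 : 1 <= d%:R :> R by rewrite ler1n ltnW.
pose K0 : R := 1280 * d%:R ^+ 2 * d.+1%:R.
have K00 : 0 < K0 by rewrite !mulr_gt0 ?ltr0n ?exprn_gt0 ?ltr0n // ltnW.
pose C : R := 500 * 1000 * 16 ^+ d * d%:R ^+ 2 * K0.
have D2 : d%:R <= d%:R ^+ 2 :> R by rewrite expr2 ler_peMl // ler0n.
have F1 : 1 <= 16 ^+ d :> R by rewrite exprn_ege1 // ler1n.
have D3 : d%:R <= 16 ^+ d * d%:R ^+ 2 :> R.
  by rewrite -[leLHS]mul1r ler_pM // ?ler0n.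
have C5 : 5000 * d%:R * K0 <= C.
  rewrite /C ler_wpM2r ?(ltW K00) // -(mulrA (500 * 1000)) ler_pM ?ler0n //.
  by rewrite -natrM ler_nat.
exists C, ((10000 * K0)^-1); split.
- by rewrite !mulr_ge0 ?exprn_ge0 ?ler0n // ltW.
- by rewrite invr_gt0 mulr_gt0.
move=> n a aq dlt a0 aq0 aqE A1 hs /andP[dl0 dl1].
have Ksm : 1280 * d%:R ^+ 2 * (d.+1%:R * dlt) <= 10000^-1.
  have := dl1; rewrite -(ler_pM2l K00) invfM mulrCA mulfV ?gt_eqF // mulr1.
  by rewrite /K0 -(mulrA (1280 * _)).
have ks : d.+1%:R * dlt <= 2^-1.
  have k0 : 0 <= d.+1%:R * dlt by rewrite mulr_ge0.
  by apply: (@defect_le_half R (d%:R ^+ 2) _ _ Ksm k0); rewrite exprn_ege1.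
have [v v0 hv] := exists_level a0 aq0 aqE A1 hs dl0 d2 ks.
have [m [J [m0 hc h1 h2 [h3 h4]]]] := flat_core a0 aq0 aqE A1 hs dl0 d2 ks v0 hv Ksm.
exists m, J; split => //.
- apply: (le_trans h1); rewrite (mulrA (1280 * _)) mulrA -/K0; apply: (ler_wpM2r dl0).
  apply: le_trans C5; apply: (ler_wpM2r (ltW K00)); apply: (ler_wpM2r (ler0n _ _)).
  by rewrite ler_nat.
- apply: (le_trans h2); rewrite ler_wpM2r ?invr_ge0 ?ler0n //.
  by rewrite (mulrA (1280 * _)) mulrA -/K0.
split=> //; apply: le_trans h4; rewrite lerD2l lerN2 (mulrA (1280 * _)) mulrA -/K0.
by rewrite ler_wpM2r.
Qed.

From mathcomp Require Import complex.
From mathcomp Require Import all_classical all_reals all_analysis.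
Import numFieldNormedType.Exports.

(** * Real and complex scalars *)

Section Scalars.
Variable R : realType.
Variable k : ground_field.
Local Notation K := (scalars R k).
Implicit Types (x y z : K) (a b : R).
Local Notation re := (@reK R k).
Local Notation conj := (@conjK R k).

Lemma reK_is_zmod_morphism : zmod_morphism re.
Proof. by case: k => //= x y; rewrite raddfB. Qed.
HB.instance Definition _ := GRing.isZmodMorphism.Build K R re reK_is_zmod_morphism.
Lemma conjK_is_zmod_morphism : zmod_morphism conj.
Proof. by case: k => //= x y; rewrite rmorphB. Qed.
HB.instance Definition _ := GRing.isZmodMorphism.Build K K conj conjK_is_zmod_morphism.
Lemma conjK_is_monoid_morphism : monoid_morphism conj.
Proof. by case: k => //=; split => //=; [rewrite rmorph1 | move=> x y; rewrite rmorphM]. Qed.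
HB.instance Definition _ := GRing.isMonoidMorphism.Build K K conj conjK_is_monoid_morphism.
Lemma ofR_is_zmod_morphism : zmod_morphism (@ofR R k).
Proof. by case: k => //= x y; rewrite rmorphB. Qed.
HB.instance Definition _ := GRing.isZmodMorphism.Build R K (@ofR R k) ofR_is_zmod_morphism.
Lemma ofR_is_monoid_morphism : monoid_morphism (@ofR R k).
Proof. by case: k => /=; split => // x y; rewrite ?rmorphM. Qed.
HB.instance Definition _ := GRing.isMonoidMorphism.Build R K (@ofR R k) ofR_is_monoid_morphism.

Lemma conjKK x : conj (conj x) = x.
Proof. by case: k x => //= x; rewrite conjCK. Qed.
Lemma reK_conj x : re (conj x) = re x.
Proof. by case: k x => //= -[a b]. Qed.
Lemma reK_ofR a : re (ofR k a) = a. Proof. by case: k. Qed.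
Lemma conjK_ofR a : conj (ofR k a) = ofR k a.
Proof. by case: k => //=; apply/eqP; rewrite eq_complex /= oppr0 !eqxx. Qed.
Lemma reK_ofRM a x : re (ofR k a * x) = a * re x.
Proof. by case: k x => //= -[b c] /=; rewrite mul0r subr0. Qed.
Lemma normE x : `|x| = ofR k (absK x).
Proof. by rewrite /absK; case: k x => [x|[a b]]; rewrite ?normc_def. Qed.
Lemma absK_ge0 x : 0 <= absK x.
Proof. by rewrite /absK; case: k x => [x|[a b]]; rewrite ?normc_def /= ?sqrtr_ge0. Qed.
Lemma absK_ofR a : absK (ofR k a) = `|a|.
Proof. by rewrite /absK; case: k; rewrite ?normc_def //= expr0n addr0 sqrtr_sqr. Qed.
Lemma ofR_inj : injective (@ofR R k).
Proof. by move=> a b /(congr1 re); rewrite !reK_ofR. Qed.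
Lemma absKM x y : absK (x * y) = absK x * absK y.
Proof. by apply: ofR_inj; rewrite rmorphM /= -!normE normrM. Qed.
Lemma ler_ofR a b : (ofR k a <= ofR k b) = (a <= b).
Proof. by case: k => //=; rewrite lecR. Qed.
Lemma absKD x y : absK (x + y) <= absK x + absK y.
Proof. by rewrite -ler_ofR rmorphD /= -!normE ler_normD. Qed.
Lemma absK0 : absK (0 : K) = 0. Proof. by apply: ofR_inj; rewrite -normE normr0 rmorph0. Qed.
Lemma absK1 : absK (1 : K) = 1. Proof. by apply: ofR_inj; rewrite -normE normr1 rmorph1. Qed.
Lemma absKN x : absK (- x) = absK x. Proof. by apply: ofR_inj; rewrite -!normE normrN. Qed.
Lemma absK_eq0 x : (absK x == 0) = (x == 0).
Proof. by rewrite -(inj_eq ofR_inj) -normE rmorph0 normr_eq0. Qed.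
Lemma absK_conj x : absK (conj x) = absK x.
Proof. by rewrite /absK; case: k x => [x|[a b]]; rewrite ?normc_def //= sqrrN. Qed.
Lemma mulK_conj x : x * conj x = ofR k (absK x ^+ 2).
Proof.
rewrite rmorphXn /= -normE; case: k x => //= x; last by rewrite -normCK.
by rewrite -normrX ger0_norm ?sqr_ge0 // expr2.
Qed.
Lemma reK_le x : re x <= absK x.
Proof.
rewrite /absK; case: k x => [x|[a b]]; first exact: ler_norm.
rewrite normc_def /=; apply: (le_trans (ler_norm a)).
by rewrite -sqrtr_sqr ler_wsqrtr // lerDl sqr_ge0.
Qed.
Lemma reK_ge x : - absK x <= re x.
Proof. by rewrite lerNl -raddfN -absKN reK_le. Qed.
Lemma absK_prod (I : finType) (P : pred I) (f : I -> K) :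
  absK (\prod_(i | P i) f i) = \prod_(i | P i) absK (f i).
Proof.
by apply: (big_morph (fun x : K => absK x)); [exact: absKM | exact: absK1].
Qed.
Lemma absK_sum (I : finType) (P : pred I) (f : I -> K) :
  absK (\sum_(i | P i) f i) <= \sum_(i | P i) absK (f i).
Proof.
elim/big_ind2 : _ => [|x a y b xa yb|//]; first by rewrite absK0.
by apply: (le_trans (absKD _ _)); apply: lerD.
Qed.
Lemma absKV x : absK (x^-1) = (absK x)^-1.
Proof. by apply: ofR_inj; rewrite fmorphV /= -!normE normfV. Qed.
Lemma sqr_absKE x : absK x ^+ 2 = re (x * conj x).
Proof. by rewrite mulK_conj reK_ofR. Qed.
Lemma reK_mulC_conj x y : re (y * conj x) = re (x * conj y).
Proof. by rewrite -reK_conj rmorphM /= conjKK mulrC. Qed.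
Lemma sqr_absKD x y : absK (x + y) ^+ 2 = absK x ^+ 2 + absK y ^+ 2 + 2 * re (x * conj y).
Proof.
rewrite !sqr_absKE rmorphD /= mulrDl !mulrDr !raddfD /= (reK_mulC_conj x y); ring.
Qed.
Lemma sqr_absKB x y : absK (x - y) ^+ 2 = absK x ^+ 2 + absK y ^+ 2 - 2 * re (x * conj y).
Proof. by rewrite sqr_absKD absKN rmorphN /= mulrN raddfN mulrN. Qed.

(** Equal to 1 at 0, so that it is unimodular everywhere. *)
Definition sgK x : K := if x == 0 then 1 else x / ofR k (absK x).
Lemma absK_sg x : absK (sgK x) = 1.
Proof.
rewrite /sgK; case: eqVneq => [_|x0]; first exact: absK1.
by rewrite absKM absKV absK_ofR ger0_norm ?absK_ge0// mulfV // absK_eq0.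
Qed.
Lemma sgKE x : x = ofR k (absK x) * sgK x.
Proof.
rewrite /sgK; case: eqVneq => [->|x0]; first by rewrite absK0 rmorph0 mul0r.
by rewrite mulrC divfK // -(rmorph0 (@ofR R k)) (inj_eq ofR_inj) absK_eq0.
Qed.
End Scalars.

(** * Finite-dimensional Hilbert spaces *)

Section L2.
Variable R : realType.
Variable k : ground_field.
Variable N : finType.
Local Notation K := (scalars R k).

Definition nsq (f : N -> K) : R := \sum_i absK (f i) ^+ 2.
Definition ip (f g : N -> K) : K := \sum_i f i * conjK (g i).

Lemma nsq_ge0 f : 0 <= nsq f.
Proof. by apply: sumr_ge0 => i _; exact: sqr_ge0. Qed.
Lemma ip_nsq f : ip f f = ofR k (nsq f).
Proof. by rewrite /ip /nsq rmorph_sum; apply: eq_bigr => i _; rewrite mulK_conj. Qed.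
Lemma reK_sum (I : finType) (P : pred I) (f : I -> K) :
  reK (\sum_(i | P i) f i) = \sum_(i | P i) reK (f i).
Proof. exact: raddf_sum. Qed.
Lemma absK_ip f g : absK (ip f g) ^+ 2 <= nsq f * nsq g.
Proof.
have h : absK (ip f g) <= \sum_i absK (f i) * absK (g i).
  apply: (le_trans (absK_sum _ _)); apply: ler_sum => i _.
  by rewrite absKM absK_conj.
apply: (le_trans _ (sum_cauchy_schwarz _ _)).
by rewrite lerXn2r ?nnegrE ?absK_ge0// (le_trans _ h) ?absK_ge0.
Qed.
Lemma reK_ip_le f g : reK (ip f g) <= Num.sqrt (nsq f) * Num.sqrt (nsq g).
Proof.
apply: (le_trans (reK_le _)); rewrite -sqrtrM ?nsq_ge0//.
by rewrite -[leLHS]ger0_norm ?absK_ge0// -sqrtr_sqr ler_wsqrtr // absK_ip.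
Qed.
Lemma nsqD f g : nsq (fun i => f i + g i) = nsq f + nsq g + 2 * reK (ip f g).
Proof.
rewrite /nsq reK_sum mulr_sumr -!big_split; apply: eq_bigr => i _ /=.
exact: sqr_absKD.
Qed.
Lemma nsqZ (c : K) f : nsq (fun i => c * f i) = absK c ^+ 2 * nsq f.
Proof. by rewrite /nsq mulr_sumr; apply: eq_bigr => i _; rewrite absKM exprMn. Qed.
Lemma sqrt_nsqD f g : Num.sqrt (nsq (fun i => f i + g i)) <=
   Num.sqrt (nsq f) + Num.sqrt (nsq g).
Proof.
have h : 0 <= Num.sqrt (nsq f) + Num.sqrt (nsq g) by rewrite addr_ge0 ?sqrtr_ge0.
rewrite -(ger0_norm h) -sqrtr_sqr ler_wsqrtr // nsqD sqrrD !sqr_sqrtr ?nsq_ge0 //.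
have := reK_ip_le f g; lra.
Qed.
Lemma nsq_eq0 f : nsq f = 0 -> forall i, f i = 0.
Proof.
move/eqP; rewrite psumr_eq0 => [/allP h i|i _]; last exact: sqr_ge0.
by have := h i (mem_index_enum _); rewrite sqrf_eq0 absK_eq0 => /eqP.
Qed.

(** A synonym of the function space, which carries the Euclidean norm and no other. *)
Definition l2 : Type := {ffun N -> K^o}.
HB.instance Definition _ := GRing.Lmodule.on l2.
Definition l2norm (f : l2) : K := ofR k (Num.sqrt (nsq f)).
Lemma l2normD (f g : l2) : l2norm (f + g) <= l2norm f + l2norm g.
Proof.
rewrite /l2norm -rmorphD ler_ofR; apply: le_trans (sqrt_nsqD _ _).
by rewrite /nsq; under eq_bigr do rewrite ffunE.
Qed.
Lemma l2normZ (c : K) (f : l2) : l2norm (c *: f) = `|c| * l2norm f.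
Proof.
rewrite /l2norm normE -rmorphM; congr ofR.
rewrite -[absK c in RHS]ger0_norm ?absK_ge0// -sqrtr_sqr -sqrtrM ?sqr_ge0//.
by rewrite -nsqZ /nsq; under eq_bigr do rewrite ffunE.
Qed.
Lemma l2norm_eq0 (f : l2) : l2norm f = 0 -> f = 0.
Proof.
rewrite /l2norm -(rmorph0 (@ofR R k)) => /ofR_inj /eqP; rewrite sqrtr_eq0 => h.
have {}h : nsq f = 0 by apply/eqP; rewrite eq_le h nsq_ge0.
by apply/ffunP => i; rewrite (nsq_eq0 h) ffunE.
Qed.
HB.instance Definition _ := @Lmodule_isNormed.Build K l2 l2norm l2normD l2normZ l2norm_eq0.
End L2.

Local Open Scope classical_set_scope.
Lemma real_cauchy_lim (R : realType) (T : Type) (F : set_system T)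
  (FF : ProperFilter F) (f : T -> R) :
  (forall e : R, 0 < e -> \forall x & y \near F, `|f x - f y| < e) ->
  exists z : R, forall e : R, 0 < e -> \forall x \near F, `|f x - z| < e.
Proof.
move=> h.
have hc : cauchy (f @ F).
  apply/cauchy_ballP => e e0.
  by rewrite near_simpl; exact: (h _ e0).
exists (lim (f @ F)) => e e0.
have hl : f @ F --> lim (f @ F) by exact: cauchy_cvg hc.
move/cvgrPdist_lt : hl => /(_ e e0).
by apply: filterS => x; rewrite distrC.
Qed.

Lemma sum_sqr_lt (R : realFieldType) (p q e : R) : 0 <= p -> 0 <= q ->
  p < e / 2 -> q < e / 2 -> p ^+ 2 + q ^+ 2 < e ^+ 2.
Proof. by move=> p0 q0 hp hq; nra. Qed.

Lemma scalars_cauchy_lim (R : realType) (k : ground_field) (T : Type)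
  (F : set_system T) (FF : ProperFilter F) (f : T -> scalars R k) :
  (forall e : R, 0 < e -> \forall x & y \near F, absK (f x - f y) < e) ->
  exists z : scalars R k,
    forall e : R, 0 < e -> \forall x \near F, absK (f x - z) < e.
Proof.
case: k f => [|] f h; first exact: real_cauchy_lim.
have [//|a ha] := @real_cauchy_lim R T F FF (fun x => complex.Re (f x)).
  move=> e e0; apply: filterS (h e e0) => -[x y] /=; apply: le_lt_trans.
  rewrite /absK /=; case: (f x) (f y) => [? ?] [? ?].
  by rewrite /= -sqrtr_sqr ler_wsqrtr // lerDl sqr_ge0.
have [//|b hb] := @real_cauchy_lim R T F FF (fun x => complex.Im (f x)).
  move=> e e0; apply: filterS (h e e0) => -[x y] /=; apply: le_lt_trans.
  rewrite /absK /=; case: (f x) (f y) => [? ?] [? ?].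
  by rewrite /= -sqrtr_sqr ler_wsqrtr // lerDr sqr_ge0.
exists (a +i* b)%C => e e0.
have e20 : 0 < e / 2 by rewrite divr_gt0.
apply: filterS2 (ha _ e20) (hb _ e20) => x.
rewrite /absK /=; case: (f x) => [u v] /= hu hv.
rewrite /=.
have -> : (u - a) ^+ 2 + (v - b) ^+ 2 = `|u - a| ^+ 2 + `|v - b| ^+ 2.
  by rewrite !real_normK // num_real.
rewrite -[ltRHS]ger0_norm ?ltW // -[ltRHS]sqrtr_sqr ltr_sqrt ?exprn_gt0 //.
exact: (sum_sqr_lt (normr_ge0 _) (normr_ge0 _) hu hv).
Qed.

Section L2Hilbert.
Variable R : realType.
Variable k : ground_field.
Variable N : finType.
Local Notation K := (scalars R k).
Local Notation l2 := (l2 R k N).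

Lemma l2_normE (f : l2) : `|f| = ofR k (Num.sqrt (nsq f)).
Proof. by []. Qed.

Lemma absK_coord_le (f : l2) i : ofR k (absK (f i)) <= `|f|.
Proof.
rewrite l2_normE ler_ofR -[leLHS]ger0_norm ?absK_ge0// -sqrtr_sqr ler_wsqrtr //.
by rewrite /nsq (bigD1 i) //= lerDl; apply: sumr_ge0 => j _; exact: sqr_ge0.
Qed.

Lemma l2_norm_le_sum (f : l2) : `|f| <= ofR k (\sum_i absK (f i)).
Proof.
rewrite l2_normE ler_ofR.
have h : 0 <= \sum_i absK (f i) by apply: sumr_ge0 => i _; exact: absK_ge0.
rewrite -[leRHS]ger0_norm // -sqrtr_sqr ler_wsqrtr // expr2 mulr_suml.
apply: ler_sum => i _; rewrite expr2 ler_wpM2l ?absK_ge0 //.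
by rewrite (bigD1 i) //= lerDl; apply: sumr_ge0 => j _; exact: absK_ge0.
Qed.

Lemma l2_complete (F : set_system l2) : ProperFilter F -> cauchy F -> cvg F.
Proof.
move=> FF /cauchy_ballP Fc.
have hz i : exists z : K, forall e : R, 0 < e ->
    \forall x \near F, absK ((x : l2) i - z) < e.
  apply: scalars_cauchy_lim => e e0.
  have e0' : (0 : K) < ofR k e by rewrite -(rmorph0 (@ofR R k)) lt_def ler_ofR ltW // andbT (inj_eq (@ofR_inj R k)) gt_eqF.
  apply: filterS (Fc _ e0') => -[x y] /=.
  rewrite -ball_normE /= => h.
  have := le_lt_trans (absK_coord_le (x - y) i) h.
  by rewrite lt_def ler_ofR (inj_eq (@ofR_inj R k)) -lt_def !ffunE.
have [z zP] := @choice _ _ _ hz.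
apply/cvg_ex; exists ([ffun i => z i] : l2).
apply/cvgrPdist_le => /= e e0.
have ee : e = ofR k (absK e) by rewrite -normE gtr0_norm.
have a0 : 0 < absK e by rewrite lt_def absK_ge0 andbT absK_eq0 gt_eqF.
pose e' := absK e / #|N|.+1%:R.
have e'0 : 0 < e' by rewrite divr_gt0.
have : \forall x \near F, forall i, absK ((x : l2) i - z i) < e'.
  by apply: filter_forall => i; exact: zP.
apply: filterS => x hx; apply: (le_trans (l2_norm_le_sum _)).
rewrite ee ler_ofR; apply: (@le_trans _ _ (\sum_(i : N) e')).
  apply: ler_sum => i _; rewrite !ffunE -absKN opprB; exact/ltW/hx.
rewrite sumr_const -mulr_natl /e' mulrCA ger_pMr // ler_pdivrMr ?ltr0n // mul1r.
by rewrite ler_nat leqW.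
Qed.
HB.instance Definition _ := Uniform_isComplete.Build l2 l2_complete.

Definition l2ip (f g : l2) : K := ip f g.
Lemma l2ip_bilinear : bilinear_for *%R (@conjK R k \; *%R) l2ip.
Proof.
split => [g|f] c x y; rewrite /l2ip /ip /= mulr_sumr -big_split /=; apply: eq_bigr => i _.
  by rewrite !ffunE mulrDl mulrA.
by rewrite !ffunE rmorphD rmorphM /= mulrDr mulrCA.
Qed.
HB.instance Definition _ := bilinear_isBilinear.Build K l2 l2 K *%R
  (@conjK R k \; *%R) l2ip l2ip_bilinear.
Lemma l2ip_herm (x y : l2) : l2ip x y = (-1) ^+ false * conjK (l2ip y x).
Proof.
rewrite expr0 mul1r /l2ip /ip rmorph_sum; apply: eq_bigr => i _.
by rewrite rmorphM /= conjKK mulrC.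
Qed.
HB.instance Definition _ := isHermitianSesquilinear.Build K l2 false (@conjK R k) l2ip l2ip_herm.
Lemma l2ip_pos (x : l2) : x != 0 -> 0 < l2ip x x.
Proof.
move=> x0; rewrite /l2ip ip_nsq lt_def -(rmorph0 (@ofR R k)) ler_ofR nsq_ge0 andbT.
rewrite (inj_eq (@ofR_inj R k)); apply: contra_neq x0 => h.
by apply/ffunP => i; rewrite (nsq_eq0 h) ffunE.
Qed.
HB.instance Definition _ := isDotProduct.Build K l2 l2ip l2ip_pos.
Lemma l2_norm2 (x : l2) : `|x| ^+ 2 = l2ip x x.
Proof. by rewrite l2_normE -rmorphXn sqr_sqrtr ?nsq_ge0 // /l2ip ip_nsq. Qed.
Definition l2H : hilbertSpace R k := @HilbertSpace R k l2 l2ip l2_norm2.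
End L2Hilbert.

Local Close Scope classical_set_scope.
(** * Lower bounds for the completely bounded norm *)

Section Operators.
Variable R : realType.
Variable k : ground_field.
Variable N : finType.
Local Notation K := (scalars R k).
Local Notation l2 := (l2 R k N).

Definition mxop (W : N -> N -> K) (f : l2) : l2 := [ffun x => \sum_y W x y * f y].
Lemma mxop_linear W : linear (mxop W).
Proof.
move=> c f g; apply/ffunP => x; rewrite !ffunE.
rewrite scaler_sumr -big_split; apply: eq_bigr => y _ /=.
by rewrite !ffunE mulrDr; congr (_ + _); exact: mulrCA.
Qed.
HB.instance Definition _ W := GRing.isLinear.Build K l2 l2 *:%R (mxop W) (mxop_linear W).

Lemma vnorm_l2 (f : l2H R k N) : vnorm f = Num.sqrt (nsq (f : l2)).
Proof. by rewrite /vnorm; exact: (reK_ofR k). Qed.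

Lemma l2_opnorm_le1 (A : l2H R k N -> l2H R k N) :
  (forall f, nsq (A f : l2) <= nsq (f : l2)) -> (opnorm A <= 1%:E)%E.
Proof.
move=> h; apply: ge_ereal_sup => _ [f /= fle1 <-].
rewrite lee_fin; apply: (le_trans _ fle1); rewrite !vnorm_l2 ler_wsqrtr //.
Qed.
End Operators.

Section Test.
Variable R : realType.
Variable k : ground_field.
Variable N : finType.
Local Notation K := (scalars R k).
Local Notation l2 := (l2 R k N).
Variables d n : nat.
Variable T : ('I_d -> 'rV[K]_n) -> K.
Variable X : 'I_d -> 'I_n -> {linear l2 -> l2}.
Hypothesis X_contr : forall s j f, nsq (X s j f) <= nsq f.

(** The operators act on the Hilbert space l2H, which is one of those in the supremum
defining cb_norm; only the finite-dimensional spaces l2H enter the lower bounds. *)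
Lemma cb_norm_test (u v : l2) : nsq u <= 1 -> nsq v <= 1 ->
  ((absK (\sum_(i : {ffun 'I_d -> 'I_n})
     coef T i * ip (foldr (fun s y => X s (i s) y) v (enum 'I_d)) u))%:E
   <= cb_norm T)%E.
Proof.
move=> hu hv.
pose X' : 'I_d -> 'I_n -> {linear l2H R k N -> l2H R k N} := X.
apply: (@le_trans _ _ (opnorm (form_operator T X'))); last first.
  apply: ereal_sup_ubound; exists (l2H R k N), X'; split => // s j.
  by apply: l2_opnorm_le1; exact: X_contr.
apply: (@le_trans _ _ (vnorm (form_operator T X' v))%:E); last first.
  apply: ereal_sup_ubound; exists v => //=.
  by rewrite vnorm_l2 -[leRHS]sqrtr1 ler_wsqrtr.
rewrite lee_fin vnorm_l2.
have -> : \sum_(i : {ffun 'I_d -> 'I_n})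
     coef T i * ip (foldr (fun s y => X s (i s) y) v (enum 'I_d)) u =
     ip (form_operator T X' v : l2) u.
  rewrite -[RHS]/(l2ip (form_operator T X' v) u) /form_operator.
  rewrite linear_sumlz; apply: eq_bigr => i _.
  by rewrite linearZl_LR.
rewrite -[leLHS]ger0_norm ?absK_ge0// -sqrtr_sqr ler_wsqrtr //.
apply: (le_trans (absK_ip _ _)); rewrite -[leRHS]mulr1.
by apply: ler_wpM2l => //; exact: nsq_ge0.
Qed.
End Test.

Section ChainTest.
Variable R : realType.
Variable k : ground_field.
Variable N : finType.
Local Notation K := (scalars R k).
Local Notation l2 := (l2 R k N).

Definition rank1 (a b : N -> K) : N -> N -> K := fun x y => a x * conjK (b y).
Lemma rank1E a b (f : l2) : mxop (rank1 a b) f = [ffun x => ip f b * a x].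
Proof.
apply/ffunP => x; rewrite !ffunE /ip mulr_suml; apply: eq_bigr => y _.
by rewrite /rank1 mulrC mulrCA mulrC.
Qed.
Lemma nsq_ffun (f : N -> K) : nsq ([ffun x => f x] : l2) = nsq f.
Proof. by rewrite /nsq; apply: eq_bigr => i _; rewrite ffunE. Qed.
Lemma rank1_contr a b (f : l2) : nsq a <= 1 -> nsq b <= 1 ->
  nsq (mxop (rank1 a b) f) <= nsq f.
Proof.
move=> ha hb; rewrite rank1E nsq_ffun nsqZ.
have := absK_ip f b; have := nsq_ge0 f; have := nsq_ge0 b; have := nsq_ge0 a.
have := sqr_ge0 (absK (ip f b)); move: (absK _ ^+ 2) (nsq a) (nsq b) (nsq f) ha hb => x y z w; nra.
Qed.

Variables d' n : nat.
Local Notation d := d'.+1.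
Variable T : ('I_d -> 'rV[K]_n) -> K.
Variables (a b : 'I_d -> 'I_n -> N -> K).
Hypothesis ha : forall s j, nsq (a s j) <= 1.
Hypothesis hb : forall s j, nsq (b s j) <= 1.

(** A composition of rank one operators is a product of inner products of neighbouring
vectors. A fixed unit vector fills the two ends of the chain. *)
Lemma chain_test (x0 : N) :
  ((absK (\sum_(i : {ffun 'I_d -> 'I_n}) coef T i *
     \prod_(r < d.-1) ip (a (next_pos r) (i (next_pos r))) (b (pos r) (i (pos r)))))%:E
   <= cb_norm T)%E.
Proof.
pose e : l2 := [ffun x => (x == x0)%:R].
have he : nsq e = 1.
  rewrite /nsq (bigD1 x0) //= big1 => [|x /negPf xx]; rewrite ?addr0 !ffunE ?eqxx ?xx.
    by rewrite absK1 expr1n.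
  by rewrite absK0 expr0n.
pose a' (s : 'I_d) j := if s == ord0 then (e : N -> K) else a s j.
pose b' (s : 'I_d) j := if s == ord_max then (e : N -> K) else b s j.
pose X (s : 'I_d) (j : 'I_n) : {linear l2 -> l2} := mxop (rank1 (a' s j) (b' s j)).
have hX s j f : nsq (X s j f) <= nsq f.
  by apply: rank1_contr; rewrite /a' /b'; case: ifP => _ //; rewrite he.
have ee : ip e e = 1 by rewrite ip_nsq he rmorph1.
have := cb_norm_test T hX (u := e) (v := e).
rewrite he lexx => /(_ isT isT); congr (_ <= _)%E; congr (absK _)%:E.
apply: eq_bigr => i _; congr (_ * _).
have P : forall j k, (j + k = d')%N ->
   foldr (fun s y => X s (i s) y) e (drop k (enum 'I_d)) =
   [ffun x => (\prod_(r < d.-1 | (k <= r)%N)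
       ip (a (next_pos r) (i (next_pos r))) (b (pos r) (i (pos r)))) *
       a' (inord k) (i (inord k)) x].
  elim=> [|j IH] m jm.
    rewrite add0n in jm; rewrite jm.
    rewrite (drop_nth ord0) ?size_enum_ord // drop_oversize ?size_enum_ord //=.
    rewrite /X rank1E; apply/ffunP => x; rewrite !ffunE.
    have -> : nth ord0 (enum 'I_d) d' = inord d'.
      by apply: ord_inj; rewrite nth_enum_ord ?inordK // ltnW.
    rewrite big1 ?mul1r; last by move=> r; rewrite leqNgt ltn_ord.
    have -> : inord d' = ord_max :> 'I_d by apply: val_inj; rewrite /= inordK.
    by rewrite /b' eqxx ee mul1r.
  have md : (m < d')%N by rewrite -jm addSn ltnS leq_addl.
  have mlt : (m < d)%N by rewrite ltnS ltnW.
  rewrite (drop_nth ord0) ?size_enum_ord //= IH; last by rewrite addnS -addSn.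
  have -> : nth ord0 (enum 'I_d) m = inord m.
    by apply: ord_inj; rewrite nth_enum_ord ?inordK // ltnW.
  rewrite /X rank1E; apply/ffunP => x; rewrite !ffunE; congr (_ * _).
  pose r : 'I_d.-1 := Ordinal md.
  rewrite [RHS](bigD1 r) //= [RHS]mulrC.
  have -> : inord m = pos r :> 'I_d by apply: val_inj; rewrite /= inordK.
  have -> : inord m.+1 = next_pos r :> 'I_d by apply: val_inj; rewrite /= inordK.
  have -> : b' (pos r) (i (pos r)) = b (pos r) (i (pos r)).
    by rewrite /b' ifN // -val_eqE /= ltn_eqF.
  have -> : a' (next_pos r) (i (next_pos r)) = a (next_pos r) (i (next_pos r)).
    by rewrite /a'.
  have -> : \prod_(i0 < d.-1 | (m < i0)%N)
      ip (a (next_pos i0) (i (next_pos i0))) (b (pos i0) (i (pos i0))) =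
     \prod_(i0 < d.-1 | (m <= i0)%N && (i0 != r))
      ip (a (next_pos i0) (i (next_pos i0))) (b (pos i0) (i (pos i0))).
    by apply: eq_bigl => q; rewrite ltn_neqAle -val_eqE /= eq_sym andbC.
  rewrite /ip mulr_sumr; apply: eq_bigr => y _.
  by rewrite ffunE mulrA.
have := P d' 0%N (addn0 _); rewrite drop0 => ->.
rewrite /ip -[RHS]mulr1 -[X in _ * X]ee /ip mulr_sumr; apply: eq_bigr => y _.
rewrite ffunE mulrA; congr (_ * _ * _).
by rewrite /a' -val_eqE /= inordK.
Qed.
End ChainTest.

Lemma eq_foldr_in (A : eqType) B (f g : A -> B -> B) (L : seq A) (z : B) :
  (forall t y, t \in L -> f t y = g t y) -> foldr f z L = foldr g z L.
Proof.
elim: L => //= t L IH h; rewrite h ?mem_head // IH // => u y uL.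
by apply: h; rewrite inE uL orbT.
Qed.

Section CutTest.
Variable R : realType.
Variable k : ground_field.
Variables d n : nat.
Local Notation K := (scalars R k).
Local Notation I := {ffun 'I_d -> 'I_n}.
Local Notation l2 := (l2 R k I).
Variable j0 : 'I_n.

Definition upd (x : I) (t : 'I_d) (j : 'I_n) : I :=
  [ffun t' => if t' == t then j else x t'].
(** Coordinates outside A are set to the base value j0, so one basis of functions on I
accommodates the tuples that are known only in part. *)
Definition mask (A : pred 'I_d) (x : I) : I := [ffun t => if A t then x t else j0].

(** The partial isometry that moves the basis vectors with q at position t to those with
p at t. With q = j0 it writes the letter p at position t, with p = j0 it erases the
letter q. *)
Definition shift (t : 'I_d) (p q : 'I_n) (f : l2) : l2 :=
  [ffun x : I => if x t == p then f (upd x t q) else 0].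
Lemma shift_linear t p q : linear (shift t p q).
Proof.
move=> c f g; apply/ffunP => x; rewrite !ffunE; case: ifP => // _.
by rewrite scaler0 addr0.
Qed.
HB.instance Definition _ t p q :=
  GRing.isLinear.Build K l2 l2 *:%R (shift t p q) (shift_linear t p q).
Lemma shift_contr t p q f : nsq (shift t p q f) <= nsq f.
Proof.
rewrite /nsq (bigID (fun x : I => x t == p)) /=.
rewrite [X in _ + X]big1 ?addr0 => [|x /negPf h]; last first.
  by rewrite ffunE h absK0 expr0n.
rewrite [leRHS](bigID (fun x : I => x t == q)) /=.
apply: ler_wpDr; first by apply: sumr_ge0 => x _; exact: sqr_ge0.
rewrite [leRHS](reindex_onto (fun x : I => upd x t q) (fun x : I => upd x t p)) /=; last first.
  move=> x /eqP h; apply/ffunP => t'; rewrite !ffunE; case: eqP => // ->; by rewrite h.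
rewrite le_eqVlt; apply/orP; left; apply/eqP.
apply: eq_big => [x|x h]; last by rewrite ffunE h.
rewrite ffunE eqxx eqxx /=; apply/eqP/eqP => [h|<-]; last by rewrite !ffunE eqxx.
by apply/ffunP => t'; rewrite !ffunE; case: eqP => // ->.
Qed.

Definition delta (y : I) : l2 := [ffun x => (x == y)%:R].
Lemma nsq_delta y : nsq (delta y) = 1.
Proof.
rewrite /nsq (bigD1 y) //= big1 => [|x /negPf xx]; rewrite ?addr0 !ffunE ?eqxx ?xx.
  by rewrite absK1 expr1n.
by rewrite absK0 expr0n.
Qed.
Lemma mxop_delta W y : mxop W (delta y) = [ffun x => W x y].
Proof.
apply/ffunP => x; rewrite !ffunE (bigD1 y) //= big1 => [|z /negPf zy]; rewrite !ffunE ?zy ?mulr0 //.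
by rewrite eqxx mulr1 addr0.
Qed.

(** Starting from the empty word, the operators write the letters of i at the positions
of L. *)
Lemma foldr_create (i : I) (L : seq 'I_d) : uniq L ->
  foldr (fun s y => shift s (i s) j0 y) (delta [ffun=> j0]) L
  = delta (mask (mem L) i).
Proof.
elim: L => [_|s L IH /= /andP[sL uL]].
  by congr delta; apply/ffunP => t; rewrite !ffunE.
rewrite IH //; apply/ffunP => x; rewrite !ffunE; case: (eqVneq (x s) (i s)) => h.
  congr (_%:R); congr nat_of_bool; apply/eqP/eqP => /ffunP e; apply/ffunP => t; have := e t; rewrite !ffunE !inE.
    by case: eqVneq => [->|//]; rewrite h.
  by case: eqVneq => [->|//]; rewrite (negPf sL).
case: eqP => [/ffunP/(_ s)|//]; rewrite ffunE /= inE eqxx /= => h'.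
by rewrite h' eqxx in h.
Qed.

(** Pairing with the empty word after letters are erased reads off the value at the word
which contains these letters. *)
Lemma foldr_annih (i : I) (L : seq 'I_d) (z : l2) (x : I) : uniq L ->
  (forall t, t \in L -> x t = j0) ->
  (foldr (fun s y => shift s j0 (i s) y) z L) x =
  z [ffun t => if t \in L then i t else x t].
Proof.
elim: L x => [x _ _|s L IH x /= /andP[sL uL] h].
  by congr (z _); apply/ffunP => t; rewrite !ffunE.
rewrite ffunE h ?mem_head // eqxx IH //.
  congr (z _); apply/ffunP => t; rewrite !ffunE inE.
  by case: eqVneq => [->|//]; rewrite (negPf sL).
move=> t tL; rewrite ffunE; case: eqVneq => [ts|_]; first by rewrite ts (negPf sL) in tL.
by rewrite h // inE tL orbT.
Qed.

Variable T : ('I_d -> 'rV[K]_n) -> K.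
Variable s : 'I_d.
Definition lo (i : I) := mask (fun t => (t < s)%N) i.
Definition hi (i : I) := mask (fun t => (s < t)%N) i.

(** The positions after s write their letters into the vacuum, W acts, and the positions
before s erase theirs, which extracts the matrix entry of W between the two halves of i.
*)
Lemma cut_test (W : 'I_n -> I -> I -> K) :
  (forall j (f : l2), nsq (mxop (W j) f) <= nsq f) ->
  ((absK (\sum_(i : I) coef T i * W (i s) (lo i) (hi i)))%:E <= cb_norm T)%E.
Proof.
move=> hW.
pose X (t : 'I_d) (j : 'I_n) : {linear l2 -> l2} :=
  if (t < s)%N then (shift t j0 j : {linear l2 -> l2})
  else if (s < t)%N then (shift t j j0 : {linear l2 -> l2}) else mxop (W j).
have hX t j f : nsq (X t j f) <= nsq f.
  by rewrite /X; case: ifP => _; [|case: ifP => _]; rewrite ?shift_contr ?hW.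
pose x0 : I := [ffun=> j0].
have := cb_norm_test T hX (u := delta x0) (v := delta x0).
rewrite nsq_delta lexx => /(_ isT isT); congr (_ <= _)%E; congr (absK _)%:E.
apply: eq_bigr => i _; congr (_ * _).
set L1 := take s (enum 'I_d); set L2 := drop s.+1 (enum 'I_d).
have eE : enum 'I_d = L1 ++ s :: L2.
  rewrite -[LHS](cat_take_drop s) (drop_nth s) ?size_enum_ord //.
  by congr (_ ++ _ :: _); apply: ord_inj; rewrite nth_enum_ord.
have uE := enum_uniq 'I_d; rewrite eE cat_uniq cons_uniq in uE.
case/and4P: uE => u1 u12 u3 u2.
have m1 t : (t \in L1) = (t < s)%N by rewrite in_take ?mem_enum // index_enum_ord.
have m2 t : (t \in L2) = (s < t)%N.
  have : t \in enum 'I_d by rewrite mem_enum.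
  rewrite eE mem_cat inE m1; case: (ltngtP t s) => /= h.
  - move=> _; apply: contraNF u12 => h2; apply/hasP; exists t; first by rewrite inE h2 orbT.
    by rewrite /= m1.
  - by rewrite -val_eqE /= gtn_eqF //=.
  - by move=> _; rewrite (ord_inj h); apply/negbTE.
rewrite eE foldr_cat /=.
have -> : foldr (fun t y => X t (i t) y) (delta x0) L2 = delta (hi i).
  rewrite (_ : hi i = mask (mem L2) i); last first.
    by apply/ffunP => t; rewrite !ffunE /= m2.
  rewrite -foldr_create //; apply: eq_foldr_in => t y tL.
  by rewrite m2 in tL; rewrite /X ltnNge ltnW //= tL.
rewrite (eq_foldr_in (g := fun t y => shift t j0 (i t) y)); last first.
  by move=> t y tL; rewrite /X -m1 tL.
have -> : X s (i s) (delta (hi i)) = [ffun x => W (i s) x (hi i)].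
  by rewrite /X ltnn /= mxop_delta.
rewrite /ip (bigD1 x0) //= big1 ?addr0 => [|y /negPf yx]; last first.
  by rewrite [X in _ * conjK X]ffunE yx rmorph0 mulr0.
rewrite [X in _ * conjK X]ffunE eqxx rmorph1 mulr1 foldr_annih //; last by move=> t _; rewrite ffunE.
rewrite ffunE; congr (W _ _ _); apply/ffunP => t; rewrite !ffunE m1.
by [].
Qed.
End CutTest.

(** * Slices of a near-extremal form are nearly of rank one *)

Section RankOne.
Variable R : realType.
Variable k : ground_field.
Variable N : finType.
Local Notation K := (scalars R k).
Local Notation l2 := (l2 R k N).

Definition nsq2 (M : N -> N -> K) : R := \sum_x \sum_y absK (M x y) ^+ 2.

Lemma nsq2_ge0 M : 0 <= nsq2 M.
Proof. by apply: sumr_ge0 => x _; exact: nsq_ge0. Qed.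

Lemma mxop_hs M (f : l2) : nsq (mxop M f) <= nsq2 M * nsq f.
Proof.
rewrite /nsq2 mulr_suml /nsq; apply: ler_sum => x _.
rewrite ffunE.
have := absK_ip (M x) (fun y => conjK (f y)).
rewrite /ip; under eq_bigr do rewrite conjKK.
by congr (_ <= _ * _); apply: eq_bigr => y _; rewrite absK_conj.
Qed.

Definition adj (M : N -> N -> K) : N -> N -> K := fun x y => conjK (M y x).
Lemma ip_mxop M (f g : l2) : ip (mxop M f) g = ip f (mxop (adj M) g).
Proof.
rewrite /ip; under eq_bigr do rewrite ffunE mulr_suml.
rewrite exchange_big /=; apply: eq_bigr => y _.
rewrite ffunE rmorph_sum mulr_sumr; apply: eq_bigr => x _.
by rewrite rmorphM /= conjKK mulrCA mulrA.
Qed.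
Lemma ip_conj (f g : N -> K) : conjK (ip f g) = ip g f.
Proof.
by rewrite /ip rmorph_sum; apply: eq_bigr => i _; rewrite rmorphM /= conjKK mulrC.
Qed.

Lemma adjK M : adj (adj M) = M.
Proof. by apply/funext => x; apply/funext => y; rewrite /adj conjKK. Qed.
Lemma nsq_comb (a b : R) (f g : N -> K) :
  nsq (fun i => ofR k a * f i + ofR k b * g i) =
  a ^+ 2 * nsq f + b ^+ 2 * nsq g + 2 * (a * b * reK (ip f g)).
Proof.
rewrite nsqD !nsqZ !absK_ofR !real_normK ?num_real //; congr (_ + 2 * _).
rewrite /ip (_ : \sum_i _ = ofR k (a * b) * \sum_i f i * conjK (g i)) ?reK_ofRM //.
rewrite mulr_sumr; apply: eq_bigr => i _.
by rewrite !rmorphM /= conjK_ofR mulrACA.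
Qed.
Lemma reK_ipC (f g : N -> K) : reK (ip f g) = reK (ip g f).
Proof. by rewrite -ip_conj reK_conj. Qed.

Definition gram (V : N -> N -> K) : N -> N -> K :=
  fun z y => \sum_x conjK (V x z) * V x y.
(** The contraction V (3 - V^* V) / 2. It increases the singular values that are below
1, so it pairs with V better than V itself as soon as V has two nonzero singular values.
*)
Definition cubic (V : N -> N -> K) : N -> N -> K :=
  fun x y => ofR k 2^-1 * (ofR k 3 * V x y - \sum_z V x z * gram V z y).

Lemma gram_conj V z y : conjK (gram V z y) = gram V y z.
Proof.
rewrite /gram rmorph_sum; apply: eq_bigr => x _.
by rewrite rmorphM /= conjKK mulrC.
Qed.

(** For a vector f with image V f and v = V^* V f, the inequality combines the
contractivity of V at f and at f - v. *)
Lemma cubic_contr V (f : l2) : nsq2 V <= 1 -> nsq (mxop (cubic V) f) <= nsq f.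
Proof.
move=> hV.
have Vc (g : l2) : nsq (mxop V g) <= nsq g.
  by apply: (le_trans (mxop_hs _ _)); rewrite ler_piMl ?nsq_ge0.
(* v1 is V^* V f, and the image of f under cubic V is (3 V f - V v1) / 2. *)
pose v1 : l2 := mxop (adj V) (mxop V f).
have Aip (g h : l2) : ip (mxop (adj V) (mxop V g)) h = ip (mxop V g) (mxop V h).
  by rewrite ip_mxop adjK.
have WE : mxop (cubic V) f =1
    (fun x => ofR k 2^-1 * (ofR k 3 * mxop V f x + ofR k (-1) * mxop V v1 x)).
  move=> x; rewrite !ffunE rmorphN rmorph1 mulN1r.
  have -> : \sum_y V x y * v1 y = \sum_y (\sum_z V x z * gram V z y) * f y.
    under [RHS]eq_bigr do rewrite mulr_suml.
    rewrite [RHS]exchange_big /=; apply: eq_bigr => y _.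
    rewrite !ffunE mulr_sumr.
    under [LHS]eq_bigr do rewrite ffunE mulr_sumr mulr_sumr.
    rewrite [LHS]exchange_big /=; apply: eq_bigr => z _.
    rewrite /gram mulr_sumr mulr_suml; apply: eq_bigr => u _.
    by rewrite /adj !mulrA.
  by rewrite mulr_sumr -sumrB mulr_sumr; apply: eq_bigr => y _; rewrite /cubic; ring.
have -> : nsq (mxop (cubic V) f) =
   4^-1 * nsq (fun x => ofR k 3 * mxop V f x + ofR k (-1) * mxop V v1 x).
  rewrite (_ : 4^-1 = absK (ofR k (2^-1 : R)) ^+ 2).
    by rewrite -nsqZ /nsq; apply: eq_bigr => x _; rewrite WE.
  by rewrite absK_ofR ger0_norm // exprVn; congr (_^-1); rewrite expr2; ring.
have h1 : reK (ip (mxop V f) (mxop V v1)) = nsq v1.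
  by rewrite -(Aip f v1) ip_nsq reK_ofR.
have h2 : reK (ip f v1) = nsq (mxop V f).
  by rewrite reK_ipC Aip ip_nsq reK_ofR.
pose h : l2 := [ffun x => ofR k 1 * f x + ofR k (-1) * v1 x].
have e1 : nsq h = nsq f + nsq v1 - 2 * nsq (mxop V f).
  rewrite (_ : nsq h = nsq (fun x => ofR k 1 * f x + ofR k (-1) * v1 x)).
    by rewrite nsq_comb h2; ring.
  by apply: eq_bigr => x _; rewrite ffunE.
have e2 : nsq (mxop V h) = nsq (mxop V f) + nsq (mxop V v1) - 2 * nsq v1.
  rewrite (_ : nsq (mxop V h) = nsq (fun x => ofR k 1 * mxop V f x + ofR k (-1) * mxop V v1 x)).
    by rewrite nsq_comb h1; ring.
  apply: eq_bigr => x _; rewrite !ffunE !mulr_sumr -big_split; congr (absK _ ^+ 2).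
  apply: eq_bigr => y _ /=; rewrite ffunE; ring.
have := Vc h; have := Vc f; rewrite e1 e2 nsq_comb h1 !expr2.
have := nsq_ge0 f; have := nsq_ge0 h; rewrite e1.
lra.
Qed.

Lemma cubic_corr V : nsq2 V = 1 ->
  reK (\sum_x \sum_y cubic V x y * conjK (V x y)) = (3 - nsq2 (gram V)) / 2.
Proof.
move=> V1.
have -> : \sum_x \sum_y cubic V x y * conjK (V x y) =
   ofR k 2^-1 * (ofR k 3 * ofR k (nsq2 V) - ofR k (nsq2 (gram V))).
  have -> : ofR k (nsq2 V) = \sum_x \sum_y V x y * conjK (V x y).
    rewrite /nsq2 rmorph_sum; apply: eq_bigr => x _.
    by rewrite rmorph_sum; apply: eq_bigr => y _; rewrite mulK_conj.
  have -> : ofR k (nsq2 (gram V)) = \sum_x \sum_y (\sum_z V x z * gram V z y) * conjK (V x y).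
    rewrite /nsq2 rmorph_sum.
    under [RHS]eq_bigr do under eq_bigr do rewrite mulr_suml.
    under [RHS]eq_bigr do rewrite exchange_big /=.
    rewrite [RHS]exchange_big /=; apply: eq_bigr => z _.
    rewrite rmorph_sum [RHS]exchange_big /=; apply: eq_bigr => y _.
    rewrite -mulK_conj gram_conj {2}/gram mulr_sumr; apply: eq_bigr => x _; ring.
  rewrite mulr_sumr -sumrB mulr_sumr; apply: eq_bigr => x _.
  rewrite mulr_sumr -sumrB mulr_sumr; apply: eq_bigr => y _.
  by rewrite /cubic; ring.
rewrite -!rmorphM -rmorphB -rmorphM /= reK_ofR V1; ring.
Qed.

(** The sum of the squared two-by-two minors vanishes exactly on matrices of rank at
most one; it measures the loss of V^* V against the square of the Hilbert-Schmidt norm.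
*)
Lemma minors_gram V : nsq2 V = 1 ->
  \sum_x' \sum_y' \sum_x \sum_y absK (V x y * V x' y' - V x y' * V x' y) ^+ 2 =
   2 * (1 - nsq2 (gram V)).
Proof.
move=> V1.
have E : \sum_x' \sum_y' \sum_x \sum_y absK (V x y * V x' y' - V x y' * V x' y) ^+ 2 =
   nsq2 V * nsq2 V + nsq2 V * nsq2 V - 2 *
   reK (\sum_x' \sum_y' \sum_x \sum_y (V x y * V x' y' * conjK (V x y' * V x' y))).
  have -> : nsq2 V * nsq2 V + nsq2 V * nsq2 V =
    \sum_x' \sum_y' \sum_x \sum_y absK (V x y) ^+ 2 * absK (V x' y') ^+ 2 +
    \sum_x' \sum_y' \sum_x \sum_y absK (V x y') ^+ 2 * absK (V x' y) ^+ 2.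
    congr (_ + _).
      rewrite {1}/nsq2 mulr_suml; apply: eq_bigr => x' _.
      rewrite mulr_suml; apply: eq_bigr => y' _.
      rewrite /nsq2 mulr_sumr; apply: eq_bigr => x _.
      by rewrite mulr_sumr; apply: eq_bigr => y _; rewrite mulrC.
    rewrite {1}/nsq2 mulr_suml; apply: eq_bigr => x' _.
    rewrite [RHS]exchange_big /= mulrC /nsq2 mulr_suml; apply: eq_bigr => x _.
    rewrite [RHS]exchange_big /= mulrC big_distrlr /=; apply: eq_bigr => y _.
    by apply: eq_bigr => y' _; rewrite mulrC.
  rewrite raddf_sum mulr_sumr -big_split -sumrB /=; apply: eq_bigr => x' _.
  rewrite raddf_sum mulr_sumr -big_split -sumrB /=; apply: eq_bigr => y' _.
  rewrite raddf_sum mulr_sumr -big_split -sumrB /=; apply: eq_bigr => x _.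
  rewrite raddf_sum mulr_sumr -big_split -sumrB /=; apply: eq_bigr => y _.
  by rewrite sqr_absKB !absKM !exprMn.
have G : ofR k (nsq2 (gram V)) =
   \sum_x' \sum_y' \sum_x \sum_y (V x y * V x' y' * conjK (V x y' * V x' y)).
  rewrite [RHS]exchange_big /= /nsq2 rmorph_sum; apply: eq_bigr => y' _.
  under [RHS]eq_bigr do rewrite exchange_big /=.
  rewrite [RHS]exchange_big /= rmorph_sum; apply: eq_bigr => y _.
  rewrite /= -mulK_conj gram_conj /gram big_distrlr exchange_big /=.
  apply: eq_bigr => x' _; apply: eq_bigr => x _; rewrite rmorphM /=; ring.
rewrite E -G reK_ofR V1; ring.
Qed.

(** A rank one approximation is read off from one row and one column of M through an
entry chosen by averaging: the error is then made of the two-by-two minors through that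
entry, and minors_gram bounds their average by what cubic gains. *)
Lemma cut_rank1 (M : N -> N -> K) : exists (W : N -> N -> K) (f g : N -> K),
  (forall h : l2, nsq (mxop W h) <= nsq h) /\
  Num.sqrt (nsq2 M) + nsq2 (fun x y => M x y - f x * g y) / (4 * Num.sqrt (nsq2 M)) <=
   reK (\sum_x \sum_y W x y * M x y).
Proof.
set r := Num.sqrt (nsq2 M).
have [r0|rn0] := eqVneq r 0.
  exists (fun _ _ => 0), (fun _ => 0), (fun _ => 0); split => [h|].
    rewrite [leLHS]big1 ?nsq_ge0 // => x _; rewrite ffunE big1 ?absK0 ?expr0n // => y _.
    by rewrite mul0r.
  rewrite r0 (mulr0 4) invr0 mulr0 addr0 big1 ?raddf0 // => x _.
  by rewrite big1 // => y _; rewrite mul0r.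
have rpos : 0 < r by rewrite lt_def rn0 sqrtr_ge0.
have r2 : r ^+ 2 = nsq2 M by rewrite sqr_sqrtr ?nsq2_ge0.
have orn0 : ofR k r != 0 by rewrite -(rmorph0 (@ofR R k)) (inj_eq (@ofR_inj R k)).
(* The pairing with M has no conjugate, hence the conjugate here. *)
pose V : N -> N -> K := fun x y => conjK (M x y) / ofR k r.
have V1 : nsq2 V = 1.
  have -> : nsq2 V = nsq2 M / r ^+ 2.
    rewrite /nsq2 mulr_suml; apply: eq_bigr => x _; rewrite mulr_suml; apply: eq_bigr => y _.
    by rewrite /V absKM absKV absK_ofR absK_conj (ger0_norm (ltW rpos)) exprMn exprVn.
  by rewrite -r2 divff // expf_neq0.
have Vpos : 0 < \sum_(p : N * N) absK (V p.1 p.2) ^+ 2.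
  by rewrite -(pair_bigA _ (fun x y => absK (V x y) ^+ 2)) /= -/(nsq2 V) V1.
have Q0 (p : N * N) : 0 <= \sum_x \sum_y absK (V x y * V p.1 p.2 - V x p.2 * V p.1 y) ^+ 2.
  by apply: sumr_ge0 => x _; apply: sumr_ge0 => y _; exact: sqr_ge0.
have := averaging_ratio (E := 2 * (1 - nsq2 (gram V))) (fun p => sqr_ge0 _) Q0 Vpos.
case.
  rewrite -(pair_bigA _ (fun x y => absK (V x y) ^+ 2)) /= -/(nsq2 V) V1 mulr1.
  rewrite -(pair_bigA _ (fun x' y' => \sum_x \sum_y absK (V x y * V x' y' - V x y' * V x' y) ^+ 2)) /=.
  by rewrite minors_gram.
move=> [x' y'] /= V0 hV.
have Vn0 : V x' y' != 0 by apply: contraTneq V0 => ->; rewrite absK0 expr0n ltxx.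
(* The rank one matrix that agrees with M on the row x' and the column y'. *)
exists (cubic V), (fun x => ofR k r * conjK (V x y' / V x' y')), (fun y => conjK (V x' y)).
split => [h|]; first by apply: cubic_contr; rewrite V1.
have ME x y : M x y = ofR k r * conjK (V x y).
  by rewrite /V rmorphM fmorphV /= conjKK conjK_ofR mulrC divfK.
have -> : \sum_x \sum_y cubic V x y * M x y = ofR k r * \sum_x \sum_y cubic V x y * conjK (V x y).
  rewrite mulr_sumr; apply: eq_bigr => x _; rewrite mulr_sumr; apply: eq_bigr => y _.
  by rewrite ME mulrCA.
rewrite reK_ofRM cubic_corr //.
have hle : nsq2 (fun x y => M x y - ofR k r * conjK (V x y' / V x' y') * conjK (V x' y))
    <= r ^+ 2 * (2 * (1 - nsq2 (gram V))).
  apply: (@le_trans _ _ (r ^+ 2 * ((\sum_x \sum_y absK (V x y * V x' y' - V x y' * V x' y) ^+ 2) / absK (V x' y') ^+ 2))).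
    rewrite mulr_suml mulr_sumr; apply: ler_sum => x _; rewrite mulr_suml mulr_sumr; apply: ler_sum => y _.
    rewrite ME -mulrA -rmorphM -mulrBr -rmorphB /= absKM absK_conj absK_ofR (ger0_norm (ltW rpos)).
    rewrite exprMn ler_wpM2l ?sqr_ge0 // -exprVn -absKV -exprMn -absKM.
    by rewrite mulrBl mulfK // mulrAC.
  by rewrite ler_wpM2l ?sqr_ge0 // ler_pdivrMr.
have : nsq2 (fun x y => M x y - ofR k r * conjK (V x y' / V x' y') * conjK (V x' y)) / (4 * r) <=
   r * (1 - nsq2 (gram V)) / 2.
  rewrite ler_pdivrMr ?mulr_gt0 //; apply: (le_trans hle).
  by rewrite le_eqVlt; apply/orP; left; apply/eqP; field.
by rewrite -lerBrDl => /le_trans; apply; rewrite le_eqVlt; apply/orP; left; apply/eqP; field.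
Qed.
End RankOne.

Section Slices.
Variable R : realType.
Variable k : ground_field.
Variables d n : nat.
Local Notation K := (scalars R k).
Local Notation I := {ffun 'I_d -> 'I_n}.

(** Inverse to splitting an index of the slice i_s = j into its parts before and after
s. *)
Definition glue (s : 'I_d) (j : 'I_n) (x y : I) : I :=
  [ffun t : 'I_d => if (t < s)%N then x t else if (s < t)%N then y t else j].

Variable j0 : 'I_n.
Local Notation lo := (lo j0).
Local Notation hi := (hi j0).

Lemma glueK s (i : I) : glue s (i s) (lo s i) (hi s i) = i.
Proof.
apply/ffunP => t; rewrite !ffunE; case: ltngtP => // h.
by congr (i _); apply: ord_inj.
Qed.

(** The pairs of indices that really are the two masked halves of an index. *)
Definition gluable s j x y := (lo s (glue s j x y) == x) && (hi s (glue s j x y) == y).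

Lemma sum_slice (V : nmodType) (phi : I -> V) s j :
  \sum_(i : I | i s == j) phi i =
  \sum_x \sum_y (if gluable s j x y then phi (glue s j x y) else 0).
Proof.
rewrite (pair_bigA _ (fun x y => if gluable s j x y then phi (glue s j x y) else 0)) /=.
rewrite -big_mkcond /=.
rewrite (reindex_onto (fun p : I * I => glue s j p.1 p.2) (fun i => (lo s i, hi s i))) /=; last first.
  by move=> i /eqP <-; rewrite glueK.
by apply: eq_bigl => -[x y] /=; rewrite ffunE !ltnn eqxx /= xpair_eqE.
Qed.

(** Each slice is a matrix to which cut_rank1 applies, and cut_test adds up the gains.
When a slice vanishes, so does the divisor, and the corresponding error term is 0 by the
convention on division. *)
Lemma slices_bound (T : ('I_d -> 'rV[K]_n) -> K) (s : 'I_d) :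
  (cb_norm T <= 1%:E)%E ->
  exists F G : I -> K,
  [/\ forall i i' : I, (forall t : 'I_d, (t <= s)%N -> i t = i' t) -> F i = F i',
      forall i i' : I, (forall t : 'I_d, (s <= t)%N -> i t = i' t) -> G i = G i' &
      \sum_j (slice (fun i => absK (coef T i)) s j +
        (\sum_(i : I | i s == j) absK (coef T i - F i * G i) ^+ 2)
          / (4 * slice (fun i => absK (coef T i)) s j)) <= 1].
Proof.
move=> hT.
pose M (j : 'I_n) (x y : I) : K := if gluable s j x y then coef T (glue s j x y) else 0.
have [W hW] := @choice _ _ (fun j (w : (I -> I -> K) * ((I -> K) * (I -> K))) =>
  (forall h, nsq (mxop w.1 h) <= nsq h) /\
  Num.sqrt (nsq2 (M j)) + nsq2 (fun x y => M j x y - w.2.1 x * w.2.2 y) /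
    (4 * Num.sqrt (nsq2 (M j))) <= reK (\sum_x \sum_y w.1 x y * M j x y))
  (fun j => let: ex_intro w (ex_intro f (ex_intro g h)) := cut_rank1 (M j) in
     ex_intro _ (w, (f, g)) h).
have MS j : Num.sqrt (nsq2 (M j)) = slice (fun i => absK (coef T i)) s j.
  rewrite /slice sum_slice; congr Num.sqrt; apply: eq_bigr => x _.
  apply: eq_bigr => y _; rewrite /M; case: ifP => //= _.
  by rewrite absK0 expr0n.
exists (fun i : I => (W (i s)).2.1 (lo s i)), (fun i : I => (W (i s)).2.2 (hi s i)).
split=> [i i' h|i i' h|].
- rewrite h // (_ : lo s i = lo s i') //; apply/ffunP => t; rewrite !ffunE.
  by case: ifP => // /ltnW/h.
- rewrite h // (_ : hi s i = hi s i') //; apply/ffunP => t; rewrite !ffunE.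
  by case: ifP => // /ltnW/h.
have := cut_test j0 T s (W := fun j => (W j).1) (fun j => (hW j).1).
move=> /le_trans/(_ hT); rewrite lee_fin; apply: le_trans.
apply: le_trans (reK_le _).
rewrite (partition_big (fun i : I => i s) xpredT) //= raddf_sum.
apply: ler_sum => j _.
have -> : \sum_(i : I | i s == j) coef T i * (W (i s)).1 (lo s i) (hi s i) =
   \sum_x \sum_y (W j).1 x y * M j x y.
  rewrite sum_slice; apply: eq_bigr => x _; apply: eq_bigr => y _.
  rewrite /M; case: ifP => [/andP[/eqP hx /eqP hy]|_]; last by rewrite mulr0.
  by rewrite hx hy ffunE !ltnn mulrC.
apply: le_trans (hW j).2; rewrite MS lerD2l ler_wpM2r //.
  by rewrite invr_ge0 mulr_ge0 // sqrtr_ge0.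
rewrite sum_slice; apply: ler_sum => x _; apply: ler_sum => y _; rewrite /M.
case: ifP => [/andP[/eqP hx /eqP hy]|_]; last exact: sqr_ge0.
by rewrite hx hy ffunE !ltnn.
Qed.
End Slices.

(** * Factorization of the phases *)

Section Phases.
Variables (R : realType) (k : ground_field) (e n : nat).
Local Notation d := e.+2.
Local Notation K := (scalars R k).
Local Notation I := {ffun 'I_d -> 'I_n}.
Variable J : 'I_d -> {set 'I_n}.
Local Notation inside := (inside J).
Variable i0 : I.
Hypothesis i0_in : inside i0.

Definition merge (l : nat) (b i : I) : I := [ffun t : 'I_d => if (t < l)%N then b t else i t].

Lemma sum_merge l (f : I -> R) :
  \sum_(b | inside b) \sum_(i | inside i) f (merge l b i) =
  \sum_(b | inside b) \sum_(i | inside i) f i.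
Proof.
pose sw (p : I * I) := (merge l p.2 p.1, merge l p.1 p.2).
have swK : involutive sw.
  by move=> [b i]; congr pair; apply/ffunP => t; rewrite !ffunE; case: (t < l)%N.
rewrite (pair_big inside inside (fun b i => f (merge l b i))) /=.
rewrite (pair_big inside inside (fun b i => f i)) /=.
rewrite [RHS](reindex_inj (inv_inj swK)) /=.
apply: eq_bigl => -[b i] /=; apply/andP/andP => -[/forallP h1 /forallP h2]; split; apply/forallP => t.
- by rewrite ffunE; case: (t < l)%N.
- by rewrite ffunE; case: (t < l)%N.
- by have := h1 t; have := h2 t; rewrite !ffunE; case: (t < l)%N.
- by have := h1 t; have := h2 t; rewrite !ffunE; case: (t < l)%N.
Qed.

(** Two independent indices of the box can exchange their coordinates before l, so on
average over b nothing changes when these coordinates are replaced by those of b. *)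
Lemma averaging_merge l (f : I -> R) : (forall i, 0 <= f i) ->
  exists2 b, inside b & \sum_(i | inside i) f (merge l b i) <= \sum_(i | inside i) f i.
Proof.
move=> f0.
pose w b : R := (inside b)%:R.
pose phi b := if inside b then \sum_(i | inside i) f (merge l b i) else 0.
have w0 b : 0 <= w b by rewrite ler0n.
have p0 b : 0 <= phi b by rewrite /phi; case: ifP => // _; apply: sumr_ge0.
have [||b] := averaging_ratio (E := \sum_(i | inside i) f i) w0 p0.
- rewrite (bigD1 i0) //= ltr_wpDr //; first by apply: sumr_ge0.
  by rewrite /w i0_in.
- rewrite /phi -big_mkcond sum_merge /= mulr_sumr big_mkcond /=; apply: ler_sum => b _.
  by rewrite /w; case: ifP; rewrite ?mulr1 ?mulr0.
rewrite /w /phi; case: ifP => [hb _|_]; last by rewrite ltxx.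
by rewrite mulr1 => h; exists b.
Qed.

Definition crd (i : I) (r : nat) : 'I_n := i (inord r).
Definition chain (H : nat -> 'I_n -> 'I_n -> K) (l : nat) (i : I) : K :=
  \prod_(r < l) H r (crd i r) (crd i r.+1).

Lemma chain_eq H l (i i' : I) : (forall t : 'I_d, (t <= l)%N -> i t = i' t) ->
  (l < d)%N -> chain H l i = chain H l i'.
Proof.
move=> h ld; apply: eq_bigr => r _; rewrite /crd !h // inordK //.
- exact: leq_ltn_trans (ltn_ord r) ld.
- exact: ltnW (ltn_ord r).
- exact: ltn_trans (ltn_ord r) ld.
Qed.
Lemma chain_unimodular H l i : (forall r p q, absK (H r p q) = 1) -> absK (chain H l i) = 1.
Proof. by move=> h; rewrite absK_prod big1. Qed.
Lemma chainS H l i : chain H l.+1 i = chain H l i * H l (crd i l) (crd i l.+1).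
Proof. exact: big_ord_recr. Qed.

Definition upto (s : nat) (F : I -> K) := forall i i' : I,
  (forall t : 'I_d, (t <= s)%N -> i t = i' t) -> F i = F i'.
Definition from (s : nat) (F : I -> K) := forall i i' : I,
  (forall t : 'I_d, (s <= t)%N -> i t = i' t) -> F i = F i'.

Variables (t : I -> K) (c E : R).
Hypothesis c_ge0 : 0 <= c.
Hypothesis flat : \sum_(i | inside i) (absK (t i) - c) ^+ 2 <= E.
Hypothesis cuts : forall s : 'I_d, exists F G : I -> K,
  [/\ upto s F, from s G & \sum_(i | inside i) absK (t i - F i * G i) ^+ 2 <= E].

Let E_ge0 : 0 <= E.
Proof. by apply: le_trans flat; apply: sumr_ge0 => i _; exact: sqr_ge0. Qed.

Lemma sqr_absK_sum2 (x y : K) : absK (x + y) ^+ 2 <= 2 * absK x ^+ 2 + 2 * absK y ^+ 2.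
Proof.
have h := absKD x y; have h1 := absK_ge0 x; have h2 := absK_ge0 y; have h3 := absK_ge0 (x + y).
have : absK (x + y) ^+ 2 <= (absK x + absK y) ^+ 2 by rewrite ler_sqr ?nnegrE ?addr_ge0.
have := sqr_ge0 (absK x - absK y); rewrite !expr2; lra.
Qed.

Lemma absK_dist (x y : K) : `|absK x - absK y| <= absK (x - y).
Proof.
have h1 := absKD (x - y) y; have h2 := absKD (y - x) x; rewrite !subrK in h1 h2.
have h3 : absK (y - x) = absK (x - y) by rewrite -absKN opprB.
by rewrite h3 in h2; rewrite ler_norml; apply/andP; split; lra.
Qed.

(** Since |T| is nearly c, the product F G nearly has modulus c too, and replacing F and
G by their phases costs a constant factor. *)
Lemma unimodular_cuts (s : 'I_d) : exists F G : I -> K,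
  [/\ upto s F, from s G, forall i, absK (F i) = 1, forall i, absK (G i) = 1 &
  \sum_(i | inside i) absK (t i - ofR k c * (F i * G i)) ^+ 2 <= 10 * E].
Proof.
have [F [G [hF hG h]]] := cuts s.
exists (fun i => sgK (F i)), (fun i => sgK (G i)); split => //.
- by move=> i i' hi; rewrite (hF i i').
- by move=> i i' hi; rewrite (hG i i').
- by move=> i; rewrite absK_sg.
- by move=> i; rewrite absK_sg.
apply: (@le_trans _ _ (\sum_(i | inside i) (2 * (absK (t i) - c) ^+ 2 + 8 * absK (t i - F i * G i) ^+ 2))).
  apply: ler_sum => i _.
  set w := F i * G i; set u := sgK (F i) * sgK (G i).
  have uu : absK u = 1 by rewrite absKM !absK_sg mulr1.
  have wu : w = ofR k (absK w) * u.
    by rewrite /w {1}(sgKE (F i)) {1}(sgKE (G i)) absKM rmorphM /= mulrACA.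
  have -> : t i - ofR k c * u = (t i - w) + ofR k (absK w - c) * u.
    by rewrite rmorphB mulrBl -wu /= addrA subrK.
  have h1 := absKD (t i - w) (ofR k (absK w - c) * u).
  rewrite absKM uu mulr1 absK_ofR in h1.
  have h2 := absK_dist (t i) w.
  have h3 : `|absK w - c| <= `|absK (t i) - c| + absK (t i - w).
    apply: le_trans (_ : `|absK (t i) - c| + `|absK (t i) - absK w| <= _); last by rewrite lerD2l.
    have := ler_distD (absK (t i)) (absK w) c; rewrite (distrC (absK w) (absK (t i))).
    by rewrite [X in _ <= X -> _]addrC.
  have h4 : absK (t i - w + ofR k (absK w - c) * u) <= `|absK (t i) - c| + 2 * absK (t i - w) by lra.
  rewrite -[(absK (t i) - c) ^+ 2]real_normK ?num_real //.
  have := absK_ge0 (t i - w + ofR k (absK w - c) * u).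
  move: h4 (absK_ge0 (t i - w)) (normr_ge0 (absK (t i) - c)).
  move: (absK (_ + _)) (absK (t i - w)) (`|_|) => x y z h4 y0 z0 x0.
  have : x ^+ 2 <= (z + 2 * y) ^+ 2 by rewrite ler_sqr ?nnegrE // addr_ge0 // mulr_ge0.
  have := sqr_ge0 (z - 2 * y); rewrite !expr2; lra.
rewrite big_split /= -!mulr_sumr; have := flat; lra.
Qed.

(** In the inductive step the remaining factor G0 of the previous stage is compared with
the cut at l + 1. With the coordinates before l frozen at b, the chain of matrices
already found and the factor F of the cut depend on the coordinates l and l + 1 only,
and their quotient is the new matrix. *)
Lemma phases_upto (l : nat) : (l <= e)%N ->
  exists (H : nat -> 'I_n -> 'I_n -> K) (G : I -> K),
  [/\ forall r p q, absK (H r p q) = 1, from l G, forall i, absK (G i) = 1 &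
   \sum_(i | inside i) absK (t i - ofR k c * (chain H l i * G i)) ^+ 2 <= 46 ^+ l * E].
Proof.
elim: l => [_|l IH le].
  exists (fun _ _ _ => 1), (fun i => sgK (t i)); split.
  - by move=> *; rewrite absK1.
  - by move=> i i' h; rewrite (_ : i = i') //; apply/ffunP => s; exact: h.
  - by move=> i; rewrite absK_sg.
  rewrite expr0 mul1r; apply: le_trans flat; apply: ler_sum => i _.
  rewrite /chain big_ord0 mul1r {1}(sgKE (t i)) -mulrBl -rmorphB /= absKM absK_sg mulr1 absK_ofR.
  by rewrite real_normK ?num_real.
have [H [G0 [hH hG0 uG0 h0]]] := IH (ltnW le).
have l1d : (l.+1 < d)%N by rewrite ltnS leqW.
have ld : (l < d)%N by exact: ltnW.
have [F [G [hF hG uF uG h1]]] := unimodular_cuts (Ordinal l1d).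
pose f i := absK (ofR k c * (chain H l i * G0 i - F i * G i)) ^+ 2.
have [b hb hmin] := averaging_merge l (f := f) (fun i => sqr_ge0 _).
have hf : \sum_(i | inside i) f i <= 2 * (46 ^+ l * E) + 2 * (10 * E).
  apply: (@le_trans _ _ (\sum_(i | inside i) (2 * absK (t i - ofR k c * (chain H l i * G0 i)) ^+ 2
     + 2 * absK (t i - ofR k c * (F i * G i)) ^+ 2))).
    apply: ler_sum => i _; rewrite /f -(absKN (t i - ofR k c * (chain H l i * G0 i))).
    apply: le_trans (sqr_absK_sum2 _ _); rewrite le_eqVlt; apply/orP; left; apply/eqP.
    by congr (absK _ ^+ 2); ring.
  rewrite big_split /= -!mulr_sumr; lra.
(* An index with the coordinates b before l, and p, q at l and l + 1. *)
pose idx (p q : 'I_n) : I := [ffun s : 'I_d => if (s < l)%N then b s else if s == l :> nat then p else q].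
pose Hl p q := conjK (chain H l (idx p q)) * F (idx p q).
have uHl p q : absK (Hl p q) = 1.
  by rewrite absKM absK_conj (chain_unimodular _ _ hH) uF mulr1.
exists (fun r => if r == l then Hl else H r), G; split => //.
  by move=> r p q; case: ifP.
have cE i : chain (fun r => if r == l then Hl else H r) l.+1 i = chain H l i * Hl (crd i l) (crd i l.+1).
  rewrite chainS eqxx; congr (_ * _); apply: eq_bigr => r _.
  by rewrite ltn_eqF.
have idxE (i : I) (s : 'I_d) : (s <= l.+1)%N -> idx (crd i l) (crd i l.+1) s = merge l b i s.
  rewrite !ffunE /crd; case: ltngtP => // h.
    move=> h'; congr (i _); apply: ord_inj; rewrite inordK //.
    by apply/eqP; rewrite eqn_leq h' h.
  by move=> _; congr (i _); apply: ord_inj; rewrite inordK.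
have fE (i : I) : f (merge l b i) = absK (ofR k c * (G0 i - Hl (crd i l) (crd i l.+1) * G i)) ^+ 2.
  have e1 : F (merge l b i) = F (idx (crd i l) (crd i l.+1)).
    by apply: hF => s hs; rewrite idxE.
  have e2 : chain H l (merge l b i) = chain H l (idx (crd i l) (crd i l.+1)).
    by apply: chain_eq => // s hs; rewrite idxE // ltnW.
  have e3 : G0 (merge l b i) = G0 i.
    by apply: hG0 => s hs; rewrite ffunE ltnNge hs.
  have e4 : G (merge l b i) = G i.
    by apply: hG => s hs; rewrite ffunE ltnNge (ltnW hs).
  rewrite /f e1 e2 e3 e4 /Hl; set A := chain H l _; set B := F _.
  have uA : absK A = 1 by rewrite /A (chain_unimodular _ _ hH).
  have AA : A * conjK A = 1 by rewrite mulK_conj uA expr1n rmorph1.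
  have -> : A * G0 i - B * G i = A * (G0 i - conjK A * B * G i).
    by rewrite mulrBr !mulrA AA mul1r.
  by rewrite !absKM uA mul1r.
have h46 : 1 <= 46 ^+ l :> R by rewrite exprn_ege1 // ler1n.
apply: (@le_trans _ _ (\sum_(i | inside i) (2 * absK (t i - ofR k c * (chain H l i * G0 i)) ^+ 2 + 2 * f (merge l b i)))).
  apply: ler_sum => i _; rewrite fE cE.
  have -> : t i - ofR k c * (chain H l i * Hl (crd i l) (crd i l.+1) * G i) =
     (t i - ofR k c * (chain H l i * G0 i)) +
     chain H l i * (ofR k c * (G0 i - Hl (crd i l) (crd i l.+1) * G i)) by ring.
  apply: (le_trans (sqr_absK_sum2 _ _)).
  by rewrite [absK (chain H l i * _)]absKM (chain_unimodular _ _ hH) mul1r.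
rewrite big_split /= -!mulr_sumr exprS.
have := ler_wpM2r E_ge0 h46; lra.
Qed.

(** After the last step of phases_upto the remaining factor depends on the last two
coordinates only, and it is the last matrix. *)
Lemma phases : exists H : 'I_d.-1 -> 'M[K]_n,
  (forall r p q, absK (H r p q) = 1) /\
  \sum_(i | inside i) absK (t i - ofR k c *
     \prod_(r < d.-1) H r (i (pos r)) (i (next_pos r))) ^+ 2 <= 46 ^+ e * E.
Proof.
have [H [G [hH hG uG h]]] := phases_upto (leqnn e).
pose idx (p q : 'I_n) : I := [ffun s : 'I_d => if s == e :> nat then p else q].
pose H' (r : nat) := if r == e then (fun p q => G (idx p q)) else H r.
exists (fun r => \matrix_(p, q) H' r p q); split.
  by move=> r p q; rewrite mxE /H'; case: ifP.
apply: le_trans h; rewrite le_eqVlt; apply/orP; left; apply/eqP.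
apply: eq_bigr => i _; congr (absK (_ - _ * _) ^+ 2).
rewrite big_ord_recr /=; congr (_ * _).
  apply: eq_bigr => r _; rewrite mxE /H' /= ltn_eqF //.
  by congr (H _ (i _) (i _)); apply: ord_inj; rewrite /= inordK // ltnS leqW // ltnW.
rewrite mxE /H' /= eqxx; apply: hG => s hs; rewrite ffunE.
case: eqP => he; congr (i _); apply: ord_inj => /=; first by rewrite he.
move/eqP: he => he; apply/eqP; rewrite eqn_leq; apply/andP; split; last by rewrite -ltnS ltn_ord.
by rewrite ltn_neqAle eq_sym he.
Qed.
End Phases.

(** * Matrices that are nearly unitary *)

Section Polar.
Variable R : realType.
Variable k : ground_field.
Local Notation K := (scalars R k).
Local Notation "A ^*m" := (map_mx (@conjK R k) (A^T)) (at level 8, format "A ^*m").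

Lemma adjmxK m n (A : 'M[K]_(m, n)) : (A^*m)^*m = A.
Proof. by apply/matrixP => i j; rewrite !mxE conjKK. Qed.
Lemma adjmxM m n p (A : 'M[K]_(m, n)) (B : 'M[K]_(n, p)) : (A *m B)^*m = B^*m *m A^*m.
Proof. by rewrite trmx_mul map_mxM. Qed.
Lemma adjmxD m n (A B : 'M[K]_(m, n)) : (A + B)^*m = A^*m + B^*m.
Proof. by rewrite linearD map_mxD. Qed.
Lemma adjmx1 m : (1%:M : 'M[K]_m)^*m = 1%:M.
Proof. by rewrite trmx1 map_mx1. Qed.
Lemma adjmxZ m n (c : K) (A : 'M[K]_(m, n)) : (c *: A)^*m = conjK c *: A^*m.
Proof. by rewrite linearZ /= map_mxZ. Qed.

Lemma mxtrace_adj m (A : 'M[K]_m) : \tr (A^*m) = conjK (\tr A).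
Proof. by rewrite /mxtrace rmorph_sum; apply: eq_bigr => i _; rewrite !mxE. Qed.

Definition fsq m n (A : 'M[K]_(m, n)) : R := \sum_i \sum_j absK (A i j) ^+ 2.
Lemma fsq_ge0 m n (A : 'M[K]_(m, n)) : 0 <= fsq A.
Proof. by apply: sumr_ge0 => i _; apply: sumr_ge0 => j _; exact: sqr_ge0. Qed.
Lemma fsqE m n (A : 'M[K]_(m, n)) : \tr (A^*m *m A) = ofR k (fsq A).
Proof.
rewrite /mxtrace /fsq exchange_big rmorph_sum; apply: eq_bigr => j _.
rewrite mxE rmorph_sum; apply: eq_bigr => i _.
by rewrite !mxE /= -mulK_conj mulrC.
Qed.
(** The trace form of the squared Frobenius norm, which makes it invariant under unitary
matrices. *)
Lemma fsq_tr m n (A : 'M[K]_(m, n)) : fsq A = reK (\tr (A^*m *m A)).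
Proof. by rewrite fsqE reK_ofR. Qed.
Lemma fsqD m n (A B : 'M[K]_(m, n)) :
  fsq (A + B) = fsq A + fsq B + 2 * reK (\tr (A^*m *m B)).
Proof.
rewrite !fsq_tr adjmxD mulmxDl !mulmxDr !mxtraceD !raddfD /=.
have -> : reK (\tr (B^*m *m A)) = reK (\tr (A^*m *m B)).
  by rewrite -[in RHS]reK_conj -mxtrace_adj adjmxM adjmxK.
ring.
Qed.
Lemma fsqN m n (A : 'M[K]_(m, n)) : fsq (- A) = fsq A.
Proof.
by apply: eq_bigr => i _; apply: eq_bigr => j _; rewrite mxE absKN.
Qed.
Lemma fsqB_le m n (A B : 'M[K]_(m, n)) : fsq (A - B) <= 2 * fsq A + 2 * fsq B.
Proof.
have h := fsq_ge0 (A + B); have hB := fsqD A (- B); rewrite fsqN in hB.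
by move: h; rewrite fsqD hB mulmxN raddfN raddfN /=; lra.
Qed.
Lemma fsq_unitary m n (U : 'M[K]_m) (A : 'M[K]_(m, n)) :
  U^*m *m U = 1%:M -> fsq (U *m A) = fsq A.
Proof. by move=> h; rewrite !fsq_tr adjmxM -mulmxA (mulmxA U^*m) h mul1mx. Qed.
Lemma entry_le_fsq m n (A : 'M[K]_(m, n)) i j : absK (A i j) ^+ 2 <= fsq A.
Proof.
rewrite /fsq (bigD1 i) //= (bigD1 j) //= -addrA lerDl addr_ge0 //.
  by apply: sumr_ge0 => ? _; exact: sqr_ge0.
by apply: sumr_ge0 => ? _; apply: sumr_ge0 => ? _; exact: sqr_ge0.
Qed.
Lemma fsq_eq0 m n (A : 'M[K]_(m, n)) : fsq A = 0 -> A = 0.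
Proof.
move=> h; apply/matrixP => i j; rewrite mxE; apply/eqP; rewrite -absK_eq0 -sqrf_eq0.
by apply/eqP/le_anti; rewrite sqr_ge0 andbT -h entry_le_fsq.
Qed.

Definition qf m (P : 'M[K]_m) (x y : 'cV[K]_m) : K := (x^*m *m P *m y) 0 0.
Lemma qf_combl m (P : 'M[K]_m) a b (x y z : 'cV[K]_m) :
  qf P (a *: x + b *: y) z = conjK a * qf P x z + conjK b * qf P y z.
Proof.
by rewrite /qf adjmxD !adjmxZ !mulmxDl -!scalemxAl mxE [X in X + _]mxE [X in _ + X]mxE.
Qed.
Lemma qf_combr m (P : 'M[K]_m) a b (x y z : 'cV[K]_m) :
  qf P z (a *: x + b *: y) = a * qf P z x + b * qf P z y.
Proof.
by rewrite /qf !mulmxDr -!scalemxAr mxE [X in X + _]mxE [X in _ + X]mxE.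
Qed.
Lemma tr_outer m (P : 'M[K]_m) (x y : 'cV[K]_m) : \tr (x *m y^*m *m P) = qf P y x.
Proof. by rewrite -mulmxA mxtrace_mulC /qf /mxtrace big_ord1. Qed.

Definition isometric m (V : 'M[K]_m) := V *m V^*m = 1%:M.
Lemma isometric1 m : isometric (1%:M : 'M[K]_m). Proof. by rewrite /isometric adjmx1 mulmx1. Qed.
Lemma isometricM m (V W : 'M[K]_m) : isometric V -> isometric W -> isometric (V *m W).
Proof. by rewrite /isometric => hV hW; rewrite adjmxM mulmxA -(mulmxA V) hW mulmx1. Qed.
Lemma isometricT m (V : 'M[K]_m) : isometric V -> isometric V^*m.
Proof. by rewrite /isometric adjmxK; exact: mulmx1C. Qed.

(** The matrix multiplies the unit vector u by the unimodular number 1 + b and fixes its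
orthogonal complement. *)
Lemma isometric_reflection m (u : 'cV[K]_m) (b : K) : u^*m *m u = 1%:M ->
  b + conjK b + b * conjK b = 0 -> isometric (1%:M + b *: (u *m u^*m)).
Proof.
move=> hu hb; rewrite /isometric adjmxD adjmx1 adjmxZ adjmxM adjmxK.
rewrite mulmxDl mul1mx mulmxDr mulmx1 -scalemxAl -scalemxAr mulmxA -(mulmxA u u^*m u) hu mulmx1.
by rewrite scalerA -addrA -!scalerDl addrA [conjK b + b]addrC hb scale0r addr0.
Qed.

Section Maximizer.
Variables (m : nat) (P : 'M[K]_m) (eta : R).
Hypothesis P_max : forall V, isometric V -> reK (\tr (V *m P)) <= reK (\tr P) + eta.

(** Replacing the maximizer by its product with the reflection in u changes the trace by
- 2 <P u, u>. *)
Lemma max_pos (u : 'cV[K]_m) : u^*m *m u = 1%:M -> - eta <= 2 * reK (qf P u u).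
Proof.
move=> hu; have := P_max (isometric_reflection (b := - 2) hu _).
rewrite rmorphN rmorph_nat => /(_ _)/wrap[]; first by ring.
rewrite mulmxDl mul1mx mxtraceD -scalemxAl mxtraceZ tr_outer raddfD /=.
have -> : reK (- 2 * qf P u u) = - 2 * reK (qf P u u).
  by rewrite -(rmorph_nat (@ofR R k)) -rmorphN reK_ofRM.
lra.
Qed.

Lemma sqnE (x : 'cV[K]_m) : x^*m *m x = (ofR k (fsq x))%:M.
Proof. by rewrite -fsqE [LHS]mx11_scalar /mxtrace big_ord1. Qed.

Lemma max_pos_all (x : 'cV[K]_m) : - eta * fsq x <= 2 * reK (qf P x x).
Proof.
have [x0|x0] := eqVneq (fsq x) 0.
  by rewrite x0 mulr0 (fsq_eq0 x0) /qf mulmx0 mxE raddf0 mulr0.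
have xpos : 0 < fsq x by rewrite lt_def x0 fsq_ge0.
pose a := (Num.sqrt (fsq x))^-1.
have a2 : a * a * fsq x = 1.
  by rewrite -expr2 exprVn sqr_sqrtr ?fsq_ge0 // mulVf.
have := @max_pos (ofR k a *: x).
rewrite adjmxZ conjK_ofR -scalemxAl -scalemxAr sqnE scalerA -rmorphM scale_scalar_mx -rmorphM /= a2 rmorph1.
move=> /(_ erefl); have -> : qf P (ofR k a *: x) (ofR k a *: x) = ofR k (a * a) * qf P x x.
  rewrite /qf adjmxZ conjK_ofR -!scalemxAl -!scalemxAr scalerA mxE rmorphM; ring.
rewrite reK_ofRM => h.
have := ler_wpM2r (ltW xpos) h.
set q := reK _; have -> : 2 * (a * a * q) * fsq x = 2 * (a * a * fsq x) * q by ring.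
by rewrite a2 mulr1.
Qed.

(** The product of two reflections is the rotation in the plane of u and v; its
first-order effect on the trace is the antihermitian part of P. *)
Lemma max_rot (u v : 'cV[K]_m) (c s : R) : u^*m *m u = 1%:M -> v^*m *m v = 1%:M ->
  u^*m *m v = 0 -> c ^+ 2 + s ^+ 2 = 1 ->
  2 * c * s * reK (qf P u v - qf P v u) <=
    eta + 2 * s ^+ 2 * (reK (qf P u u) + reK (qf P v v)).
Proof.
move=> hu hv huv hcs.
have hvu : v^*m *m u = 0 by rewrite -[u]adjmxK -adjmxM huv trmx0 map_mx0.
have [w wdef] : exists w, w = ofR k c *: u + ofR k s *: v by eexists.
have wE : w^*m = ofR k c *: u^*m + ofR k s *: v^*m.
  by rewrite wdef adjmxD !adjmxZ !conjK_ofR.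
have hw : w^*m *m w = 1%:M.
  rewrite wE wdef mulmxDl !mulmxDr -!scalemxAl -!scalemxAr hu hv huv hvu !scaler0 addr0 add0r.
  by rewrite !scalerA -!rmorphM -scalerDl -rmorphD /= -!expr2 hcs rmorph1 scale1r.
have hwu : w^*m *m u = (ofR k c)%:M.
  by rewrite wE mulmxDl -!scalemxAl hu hvu scaler0 addr0 scale_scalar_mx mulr1.
have two : (-2 : K) + conjK (-2) + -2 * conjK (-2) = 0.
  by rewrite rmorphN rmorph_nat /=; ring.
have := P_max (isometricM (isometric_reflection hw two) (isometric_reflection hu two)).
have -> : \tr ((1%:M + (- 2) *: (w *m w^*m)) *m (1%:M + (- 2) *: (u *m u^*m)) *m P) =
   \tr P - 2 * qf P u u - 2 * qf P w w + 4 * ofR k c * qf P u w.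
  have eAB : (w *m w^*m) *m (u *m u^*m) = ofR k c *: (w *m u^*m).
    by rewrite mulmxA -(mulmxA w) hwu mul_mx_scalar -scalemxAl.
  have -> : (1%:M + (- 2) *: (w *m w^*m)) *m (1%:M + (- 2) *: (u *m u^*m)) =
     1%:M + (- 2) *: (u *m u^*m) + ((- 2) *: (w *m w^*m) + (4 * ofR k c) *: (w *m u^*m)).
    rewrite mulmxDl mul1mx mulmxDr mulmx1 -scalemxAl -scalemxAr eAB !scalerA.
    by congr (_ + (_ + _ *: _)); ring.
  rewrite !mulmxDl mul1mx -!scalemxAl !mxtraceD !mxtraceZ !tr_outer.
  ring.
have -> : \tr P - 2 * qf P u u - 2 * qf P w w + 4 * ofR k c * qf P u w =
   \tr P + ofR k (2 * (c * c) - 2) * qf P u u + ofR k (- 2 * (s * s)) * qf P v v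
   + ofR k (2 * c * s) * (qf P u v - qf P v u).
  rewrite wdef !qf_combl !qf_combr !conjK_ofR.
  rewrite ?(rmorphB, rmorphM, rmorphN, rmorph_nat) /=; ring.
have -> : 2 * (c * c) - 2 = - 2 * (s * s) by rewrite -{2}[2]mulr1 -hcs; ring.
have reD (x y : K) : reK (x + y) = reK x + reK y := raddfD _ x y.
rewrite !reD !reK_ofRM expr2; lra.
Qed.

(** The same perturbation with an arbitrary phase on the line of u shows that the
diagonal is nearly real. *)
Lemma max_phase (u : 'cV[K]_m) (z : K) : u^*m *m u = 1%:M -> absK z = 1 ->
  reK (z * qf P u u) <= reK (qf P u u) + eta.
Proof.
move=> hu hz; have := @P_max _ (isometric_reflection (b := z - 1) hu _).
have hzz : z * conjK z = 1 by rewrite mulK_conj hz expr1n rmorph1.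
have h0 : z - 1 + conjK (z - 1) + (z - 1) * conjK (z - 1) = 0.
  rewrite rmorphB rmorph1 /= (_ : _ + _ = z * conjK z - 1); first by rewrite hzz subrr.
  ring.
move=> /(_ h0); rewrite mulmxDl mul1mx mxtraceD -scalemxAl mxtraceZ tr_outer mulrBl mul1r.
have reD (x y : K) : reK (x + y) = reK x + reK y := raddfD _ x y.
have reB (x y : K) : reK (x - y) = reK x - reK y := raddfB _ x y.
rewrite reD reB; lra.
Qed.

Lemma reK_sqr (z : K) : reK (z * z) = 2 * reK z ^+ 2 - absK z ^+ 2.
Proof.
rewrite sqr_absKE; case: k z => [z|[a b]] /=; first by rewrite expr2; ring.
by rewrite expr2 mulrN opprK; ring.
Qed.

Definition ecol (i : 'I_m) : 'cV[K]_m := delta_mx i 0.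
Lemma ecolE i : (ecol i)^*m = delta_mx 0 i.
Proof. by rewrite /ecol trmx_delta map_delta_mx. Qed.
Lemma ecol_dot i j : (ecol i)^*m *m ecol j = (i == j)%:R%:M.
Proof.
rewrite ecolE /ecol mul_delta_mx_cond; apply/matrixP => x y; rewrite !ord1 !mxE /=.
by case: (i == j); rewrite ?mulr1n ?mulr0n !mxE ?eqxx.
Qed.
Lemma qf_ecol i j : qf P (ecol i) (ecol j) = P i j.
Proof.
rewrite /qf ecolE -rowE /ecol -colE; by rewrite !mxE.
Qed.

(** The gain in max_rot is linear in s while its loss is quadratic, so a near-maximizer
with eta = s^2 is hermitian up to an error of order s. *)
Lemma max_herm (b s : R) : (forall i j, absK (P i j) <= b) -> 0 < s -> s <= 2^-1 ->
  eta = s ^+ 2 ->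
  forall i j, absK (P i j - conjK (P j i)) <= s * (1 + 4 * b).
Proof.
move=> hb spos s1 etaE i j.
have s0 := ltW spos.
have b0 : 0 <= b by apply: le_trans (hb i j); exact: absK_ge0.
have [<-{j}|ij] := eqVneq i j.
  have h1 : absK (P i i) <= reK (P i i) + eta.
    have := @max_phase (ecol i) (conjK (sgK (P i i))) _ _.
    rewrite ecol_dot eqxx absK_conj absK_sg => /(_ erefl erefl).
    rewrite qf_ecol; congr (_ <= _).
    rewrite {2}(sgKE (P i i)) mulrCA [_ * sgK _]mulrC mulK_conj absK_sg expr1n rmorph1 mulr1.
    by rewrite reK_ofR.
  rewrite -ler_sqr ?nnegrE ?absK_ge0 ?mulr_ge0 ?addr_ge0 ?mulr_ge0 //.
  rewrite sqr_absKB conjKK absK_conj reK_sqr.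
  have h2 := reK_le (P i i); have h3 := hb i i; have h4 := reK_ge (P i i).
  move: h1 h2 h3 h4; rewrite etaE.
  move: (absK (P i i)) (reK (P i i)) => x y h1 h2 h3 h4.
  have e1 : (x - y) * (x + y) <= s ^+ 2 * (2 * b) by apply: ler_pM; lra.
  have e2 := mulr_ge0 (sqr_ge0 s) (sqr_ge0 (1 - 4 * b)).
  have e3 := mulr_ge0 (sqr_ge0 s) b0.
  move: e1 e2 e3; rewrite !expr2; lra.
pose z := P i j - conjK (P j i).
pose w := conjK (sgK z).
have hw : w * conjK w = 1 by rewrite mulK_conj absK_conj absK_sg expr1n rmorph1.
pose c := Num.sqrt (1 - s ^+ 2).
have s2 : s ^+ 2 <= 4^-1.
  have -> : 4^-1 = 2^-1 ^+ 2 :> R by rewrite exprVn expr2 -natrM.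
  by rewrite ler_sqr ?nnegrE.
have c2 : c ^+ 2 = 1 - s ^+ 2 by rewrite sqr_sqrtr //; lra.
have cge : 2^-1 <= c.
  rewrite -ler_sqr ?nnegrE ?sqrtr_ge0 // c2 exprVn expr2 -natrM; lra.
have hv : (w *: ecol j)^*m *m (w *: ecol j) = 1%:M.
  by rewrite adjmxZ -scalemxAl -scalemxAr scalerA mulrC hw scale1r ecol_dot eqxx.
have huv : (ecol i)^*m *m (w *: ecol j) = 0.
  by rewrite -scalemxAr ecol_dot (negPf ij) scale_scalar_mx mulr0 raddf0.
have hu : (ecol i)^*m *m ecol i = 1%:M by rewrite ecol_dot eqxx.
have hcs : c ^+ 2 + s ^+ 2 = 1 by rewrite c2; ring.
have := max_rot hu hv huv hcs.
have q1 : qf P (ecol i) (w *: ecol j) = w * P i j.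
  by rewrite -[w *: _]addr0 -(scale0r (ecol j)) qf_combr mul0r addr0 qf_ecol.
have q2 : qf P (w *: ecol j) (ecol i) = conjK w * P j i.
  by rewrite -[w *: _]addr0 -(scale0r (ecol j)) qf_combl rmorph0 mul0r addr0 qf_ecol.
have q3 : qf P (w *: ecol j) (w *: ecol j) = P j j.
  rewrite -[w *: _]addr0 -(scale0r (ecol j)) qf_combl !qf_combr rmorph0 !mul0r !addr0 qf_ecol.
  by rewrite mulrA mulrC [conjK w * w]mulrC hw mulr1.
rewrite q1 q2 q3 qf_ecol.
have -> : reK (w * P i j - conjK w * P j i) = absK z.
  have reB (x y : K) : reK (x - y) = reK x - reK y := raddfB _ x y.
  rewrite reB -(reK_conj (conjK w * _)) rmorphM /= conjKK -reB -mulrBr -/z.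
  rewrite {1}(sgKE z) mulrCA /w [_ * sgK _]mulrC mulK_conj absK_sg expr1n rmorph1 mulr1.
  by rewrite reK_ofR.
have := reK_le (P i i); have := reK_le (P j j); have := hb i i; have := hb j j.
have := absK_ge0 z; rewrite etaE.
move: (absK z) (reK (P i i)) (reK (P j j)) => x y1 y2 x0 h1 h2 h3 h4 h5.
rewrite -(ler_pM2l spos).
have e1 : s * x <= 2 * c * s * x.
  by rewrite -mulrA ler_peMl ?mulr_ge0 //; lra.
have e2 : s ^+ 2 * (y1 + y2) <= s ^+ 2 * (2 * b) by rewrite ler_wpM2l ?sqr_ge0 //; lra.
apply: (le_trans e1); apply: (le_trans h5); move: e2; rewrite !expr2; lra.
Qed.
End Maximizer.

(** A substitute for the polar decomposition. Choose a unitary U that nearly maximizes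
Re tr (U^* B); then P = U^* B is nearly positive and nearly hermitian. So the product
(P^* + 1) (P - 1) = B^* B - 1 + P - P^* is nearly B^* B - 1, and it controls P - 1
because P^* + 1 is bounded below. *)
Lemma near_unitary m (B : 'M[K]_m) : exists2 U : 'M[K]_m,
  U *m U^*m = 1%:M & fsq (B - U) <= 16 * fsq (B^*m *m B - 1%:M).
Proof.
set dl := fsq (B^*m *m B - 1%:M).
have [d0|dn0] := eqVneq dl 0.
  have hB : B^*m *m B = 1%:M by apply/eqP; rewrite -subr_eq0; apply/eqP; exact: fsq_eq0.
  exists B; first by rewrite mulmx1C.
  by rewrite subrr d0 mulr0 /fsq big1 // => i _; rewrite big1 // => j _; rewrite mxE absK0 expr0n.
have dpos : 0 < dl by rewrite lt_def dn0 fsq_ge0.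
pose b := Num.sqrt (fsq B).
have b0 : 0 <= b by exact: sqrtr_ge0.
pose M : R := m.+1%:R * (1 + 4 * b).
have M0 : 0 < M by rewrite mulr_gt0 ?ltr0n // ltr_wpDr // mulr_ge0.
pose de := Num.sqrt dl.
have de0 : 0 < de by rewrite sqrtr_gt0.
have hMd : 0 < M + 2 * de by rewrite addr_gt0 // mulr_gt0.
(* Small enough for the antihermitian defect of P to be negligible against the distance
of B^* B to the identity, and at most 1/2. *)
pose s := de / (M + 2 * de).
have s0 : 0 < s by rewrite divr_gt0.
have sM : s * M <= de.
  rewrite /s mulrAC ler_pdivrMr //; apply: ler_wpM2l; first exact: ltW.
  by rewrite lerDl mulr_ge0 // ltW.
have s1 : s <= 2^-1.
  by rewrite /s ler_pdivrMr //; move: M0 de0; lra.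
pose E : set R := fun x => exists2 U : 'M[K]_m, isometric U & x = reK (\tr (U^*m *m B)).
have hsE : has_sup E.
  split; first by exists (reK (\tr ((1%:M : 'M[K]_m)^*m *m B))), 1%:M => //; exact: isometric1.
  exists (fsq (1%:M : 'M[K]_m) + fsq B) => _ [U hU ->].
  have hU' : U^*m *m U = 1%:M by exact: mulmx1C.
  have h1 : fsq U = fsq (1%:M : 'M[K]_m) by rewrite -[U]mulmx1 fsq_unitary.
  have := fsq_ge0 (U - B); rewrite fsqD fsqN mulmxN raddfN raddfN /= h1.
  have := fsq_ge0 (1%:M : 'M[K]_m); have := fsq_ge0 B; lra.
have s20 : 0 < s ^+ 2 by rewrite exprn_gt0.
have [_ [U hU ->] hsup] := sup_adherent s20 hsE.
have hU' : U^*m *m U = 1%:M by exact: mulmx1C.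
pose P := U^*m *m B.
(* P = U^* B inherits near-maximality at the identity matrix. *)
have Pmax V : isometric V -> reK (\tr (V *m P)) <= reK (\tr P) + s ^+ 2.
  move=> hV; rewrite -lerBlDr; apply: ltW; apply: le_lt_trans hsup; rewrite lerD2r.
  apply: sup_upper_bound => //; exists (U *m V^*m); first by apply: isometricM => //; exact: isometricT.
  by rewrite adjmxM adjmxK -mulmxA.
have PB : P^*m *m P = B^*m *m B.
  by rewrite /P adjmxM adjmxK -mulmxA (mulmxA U) hU mul1mx.
have BUP : B = U *m P by rewrite /P mulmxA hU mul1mx.
have fP : fsq P = fsq B by rewrite BUP fsq_unitary.
have Pb i j : absK (P i j) <= b.
  rewrite -[leLHS]ger0_norm ?absK_ge0 // -sqrtr_sqr ler_wsqrtr // -fP; exact: entry_le_fsq.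
have herm := max_herm Pmax Pb s0 s1 erefl.
have fD : fsq (P - P^*m) <= dl.
  rewrite /dl -[leRHS]sqr_sqrtr ?fsq_ge0 // -/dl -/de.
  apply: (@le_trans _ _ (\sum_(i < m) \sum_(j < m) (s * (1 + 4 * b)) ^+ 2)).
    apply: ler_sum => i _; apply: ler_sum => j _.
    have h0 : 0 <= s * (1 + 4 * b) by apply: (le_trans _ (herm i j)); exact: absK_ge0.
    have -> : (P - P^*m) i j = P i j - conjK (P j i) by rewrite !mxE.
    by rewrite ler_sqr; [exact: herm | rewrite nnegrE absK_ge0 | rewrite nnegrE].
  set t := s * (1 + 4 * b).
  rewrite !sumr_const card_ord -mulrnA -[leLHS]mulr_natl natrM -expr2 -exprMn /t.
  have h1 : m%:R * (s * (1 + 4 * b)) <= de.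
    apply: le_trans sM; rewrite mulrCA ler_wpM2l ?(ltW s0) // /M ler_wpM2r ?ler_nat //.
    by rewrite addr_ge0 // mulr_ge0.
  have t0 : 0 <= 1 + 4 * b by move: b0; lra.
  have t1 := mulr_ge0 (ler0n R m) (mulr_ge0 (ltW s0) t0).
  by rewrite ler_sqr // nnegrE // ltW.
exists U => //.
have -> : fsq (B - U) = fsq (P - 1%:M).
  by rewrite {1}BUP -{2}[U]mulmx1 -mulmxBr fsq_unitary.
pose D := P - 1%:M.
have key : fsq (P^*m *m D + D) <= 4 * dl.
  have -> : P^*m *m D + D = (B^*m *m B - 1%:M) - (- (P - P^*m)).
    by rewrite /D mulmxBr mulmx1 PB opprK; apply/matrixP => i j; rewrite !mxE; ring.
  apply: (le_trans (fsqB_le _ _)); rewrite fsqN -/dl; lra.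
have cross : - s ^+ 2 * fsq D <= 2 * reK (\tr ((P^*m *m D)^*m *m D)).
  rewrite adjmxM adjmxK.
  have -> : fsq D = \sum_j fsq (col j D).
    rewrite /fsq exchange_big; apply: eq_bigr => j _; apply: eq_bigr => i _.
    by rewrite big_ord1 [in RHS]mxE.
  have -> : reK (\tr (D^*m *m P *m D)) = \sum_j reK (qf P (col j D) (col j D)).
    rewrite /mxtrace raddf_sum; apply: eq_bigr => j _; congr reK.
    rewrite /qf (_ : (col j D)^*m = row j D^*m); last by apply/matrixP => x y; rewrite !mxE.
    by rewrite colE -row_mul mulmxA -colE !mxE; apply: eq_bigr => x _; rewrite !mxE.
  rewrite !mulr_sumr; apply: ler_sum => j _; exact: max_pos_all.
have := fsqD (P^*m *m D) D; have := fsq_ge0 (P^*m *m D); have := fsq_ge0 D; rewrite -/D.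
have s24 : s ^+ 2 <= 4^-1.
  have -> : 4^-1 = 2^-1 ^+ 2 :> R by rewrite exprVn expr2 -natrM.
  by rewrite ler_sqr ?nnegrE ?(ltW s0).
move: key cross (ltW dpos) s24 (ltW s20).
move: (fsq (_ + _)) (fsq D) (fsq (_ *m _)) (reK _) (s ^+ 2) => X Y Z W S; nra.
Qed.
End Polar.

(** * A bilinear test for unitarity *)

(** Here x is the norm of a column of the Gram matrix and b the norm of the
corresponding column of B; a column with x > 4 must show in one of the two terms. *)
Lemma bad_weight_ge1 (R : realFieldType) (x b : R) : 4 < x -> b ^+ 2 <= x -> 0 <= b ->
  1 <= (x - b ^+ 2) + 4 * (b - 1) ^+ 2.
Proof.
rewrite !expr2 => x4 hb b0; have [h|h] := lerP b (3 / 2).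
  have h1 : b * b <= 3 / 2 * (3 / 2) by apply: ler_pM.
  have := sqr_ge0 (b - 1); rewrite expr2; lra.
have h1 : 2^-1 * 2^-1 <= (b - 1) * (b - 1) by apply: ler_pM => //; lra.
lra.
Qed.

Lemma bad_sqr_le_weight (R : realFieldType) (x b : R) : 4 < x -> b ^+ 2 <= x -> 0 <= b ->
  b ^+ 2 <= 4 * ((x - b ^+ 2) + 4 * (b - 1) ^+ 2).
Proof.
rewrite !expr2 => x4 hb b0; have [h|h] := lerP b (3 / 2).
  have h1 : b * b <= 3 / 2 * (3 / 2) by apply: ler_pM.
  have := sqr_ge0 (b - 1); rewrite expr2; lra.
have h1 : 2^-1 * b * b <= 2 * (b - 1) * b by rewrite ler_wpM2r //; lra.
have h2 : 0 <= (b - 3 / 2) * (b - 3 / 2) by rewrite -expr2 sqr_ge0.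
lra.
Qed.

Section UnitaryFromTest.
Variable R : realType.
Variable k : ground_field.
Local Notation K := (scalars R k).
Local Notation "A ^*m" := (map_mx (@conjK R k) (A^T)) (at level 8, format "A ^*m").
Variable m : nat.

Lemma sqrt_nsq_dist (f g : 'I_m -> K) :
  (Num.sqrt (nsq f) - Num.sqrt (nsq g)) ^+ 2 <= nsq (fun x => f x - g x).
Proof.
have h1 := sqrt_nsqD (fun x => f x - g x) g.
have h2 := sqrt_nsqD (fun x => g x - f x) f.
have E1 : nsq (fun x => f x - g x + g x) = nsq f by apply: eq_bigr => x _; rewrite subrK.
have E2 : nsq (fun x => g x - f x + f x) = nsq g by apply: eq_bigr => x _; rewrite subrK.
have E3 : nsq (fun x => g x - f x) = nsq (fun x => f x - g x).
  by apply: eq_bigr => x _; rewrite -absKN opprB.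
rewrite E1 in h1; rewrite E2 E3 in h2.
rewrite -[leRHS]sqr_sqrtr ?nsq_ge0 // -real_normK ?num_real // ler_sqr ?nnegrE ?sqrtr_ge0 //.
by rewrite ler_norml; apply/andP; split; lra.
Qed.

Lemma fsq_rows n (A : 'M[K]_(m, n)) : fsq A = \sum_p nsq (A p).
Proof. by []. Qed.
Lemma fsq_cols n (A : 'M[K]_(n, m)) : fsq A = \sum_q nsq (fun p => A p q).
Proof. exact: exchange_big. Qed.
Lemma fsqB3 n p (A B C D : 'M[K]_(n, p)) :
  fsq (A - D) <= 2 * fsq (A - B) + 4 * fsq (B - C) + 4 * fsq (C - D).
Proof.
have h1 := fsqB_le (A - B) (- (B - D)).
have h2 := fsqB_le (B - C) (- (C - D)).
rewrite !fsqN !opprK in h1 h2.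
have e1 : A - B + (B - D) = A - D by rewrite addrA subrK.
have e2 : B - C + (C - D) = B - D by rewrite addrA subrK.
by rewrite e1 in h1; rewrite e2 in h2; lra.
Qed.

Variables (tau h : 'M[K]_m) (E : R).
Hypothesis test : forall w v : 'I_m -> 'I_m -> K,
  (forall p, nsq (w p) <= 1) -> (forall q, nsq (v q) <= 1) ->
  absK (\sum_p \sum_q tau p q * ip (v q) (w p)) <= m%:R.
Hypothesis h_flat : forall p q, absK (h p q) ^+ 2 = m%:R^-1.
Hypothesis tau_h : fsq (tau - h) <= E * m%:R.
Hypothesis tau_ge : m%:R * (1 - E) <= fsq tau.

Let h_row p : nsq (h p) = 1.
Proof.
rewrite /nsq (eq_bigr (fun=> m%:R^-1)) // sumr_const card_ord -[LHS]mulr_natl mulfV //.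
by rewrite pnatr_eq0 -lt0n; case: (m) p => // -[].
Qed.
Let h_col q : nsq (fun p => h p q) = 1.
Proof.
rewrite /nsq (eq_bigr (fun=> m%:R^-1)) // sumr_const card_ord -[LHS]mulr_natl mulfV //.
by rewrite pnatr_eq0 -lt0n; case: (m) q => // -[].
Qed.

Let D p := Num.sqrt (nsq (tau p)).
Let D_ge0 p : 0 <= D p. Proof. exact: sqrtr_ge0. Qed.
Let D_sqr p : D p ^+ 2 = nsq (tau p). Proof. by rewrite sqr_sqrtr ?nsq_ge0. Qed.
Let D_eq0 p q : D p = 0 -> tau p q = 0.
Proof. by move=> d0; apply: (nsq_eq0 (f := tau p)); rewrite -D_sqr d0 expr0n. Qed.
Let B : 'M[K]_m := \matrix_(p, q) (ofR k (Num.sqrt (D p))^-1 * tau p q).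
Let M := B^*m *m B.

Let D_dist : \sum_p (D p - 1) ^+ 2 <= E * m%:R.
Proof.
apply: le_trans tau_h; rewrite fsq_rows; apply: ler_sum => p _.
have := sqrt_nsq_dist (tau p) (h p); rewrite h_row sqrtr1 => /le_trans; apply.
by rewrite le_eqVlt; apply/orP; left; apply/eqP; apply: eq_bigr => q _; rewrite !mxE.
Qed.
Let D_sum : m%:R * (1 - E) <= \sum_p D p.
Proof.
have h1 : \sum_p (D p - 1) ^+ 2 = fsq tau - 2 * \sum_p D p + m%:R.
  rewrite fsq_rows mulr_sumr -sumrB.
  have -> : m%:R = \sum_(p < m) (1 : R) by rewrite sumr_const card_ord.
  by rewrite -big_split; apply: eq_bigr => p _; rewrite -D_sqr /= !expr2; ring.
have := D_dist; rewrite h1; have := tau_ge; lra.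
Qed.
Let B_dist : fsq (B - h) <= 4 * (E * m%:R).
Proof.
have h1 : fsq (B - tau) <= E * m%:R.
  apply: le_trans D_dist; rewrite fsq_rows; apply: ler_sum => p _.
  pose s := Num.sqrt (D p).
  have s0 : 0 <= s by exact: sqrtr_ge0.
  have sD : D p = s ^+ 2 by rewrite sqr_sqrtr.
  have -> : nsq ((B - tau) p) = (s^-1 - 1) ^+ 2 * D p ^+ 2.
    rewrite D_sqr -[(s^-1 - 1) ^+ 2]real_normK ?num_real // -(absK_ofR k) -nsqZ.
    by apply: eq_bigr => q _; rewrite !mxE rmorphB rmorph1 mulrBl mul1r.
  have [z|nz] := eqVneq s 0; first by rewrite sD z expr0n /= expr0n /= mulr0 sqr_ge0.
  rewrite -exprMn sD.
  have -> : (s^-1 - 1) * s ^+ 2 = s * (1 - s) by field.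
  have -> : s ^+ 2 - 1 = (s + 1) * (s - 1) by ring.
  rewrite !exprMn -(sqrrN (1 - s)) opprB ler_wpM2r ?sqr_ge0 // ler_sqr ?nnegrE //; first by rewrite lerDl.
  by rewrite addr_ge0.
have := fsqB_le (B - tau) (- (tau - h)); rewrite fsqN opprK addrA subrK; have := tau_h; lra.
Qed.
Let beta q := Num.sqrt (nsq (fun p => B p q)).
Let M_diag q : M q q = ofR k (beta q ^+ 2).
Proof.
rewrite sqr_sqrtr ?nsq_ge0 // -ip_nsq /ip mxE; apply: eq_bigr => p _.
by rewrite [_^*m _ _]mxE [_^T _ _]mxE mulrC.
Qed.
Let beta_dist : \sum_q (beta q - 1) ^+ 2 <= 4 * (E * m%:R).
Proof.
apply: le_trans B_dist; rewrite fsq_cols; apply: ler_sum => q _.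
have := sqrt_nsq_dist (fun p => B p q) (fun p => h p q); rewrite h_col sqrtr1 => /le_trans; apply.
by rewrite le_eqVlt; apply/orP; left; apply/eqP; apply: eq_bigr => p _; rewrite !mxE.
Qed.
Let nu q := Num.sqrt (nsq (fun x => M x q)).
Let nu_sqr q : nu q ^+ 2 = nsq (fun x => M x q).
Proof. by rewrite sqr_sqrtr // nsq_ge0. Qed.
Let nu_sum : \sum_q nu q <= m%:R.
Proof.
(* With these vectors the p-th and q-th terms of the test combine to B^* B, since B carries
the square root of the weight D in each of its two factors. *)
pose w p x := ofR k (D p)^-1 * tau p x.
pose v q x := ofR k (nu q)^-1 * conjK (M x q).
have hw p : nsq (w p) <= 1.
  rewrite /w nsqZ -D_sqr absK_ofR real_normK ?num_real // -exprMn.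
  have [->|d0] := eqVneq (D p) 0; first by rewrite mulr0 expr0n.
  by rewrite mulVf // expr1n.
have hv q : nsq (v q) <= 1.
  rewrite /v nsqZ absK_ofR real_normK ?num_real //.
  have -> : nsq (fun x => conjK (M x q)) = nu q ^+ 2.
    by rewrite nu_sqr; apply: eq_bigr => x _; rewrite absK_conj.
  rewrite -exprMn; have [->|d0] := eqVneq (nu q) 0; first by rewrite mulr0 expr0n.
  by rewrite mulVf // expr1n.
apply: le_trans (test hw hv).
have -> : \sum_p \sum_q tau p q * ip (v q) (w p) = ofR k (\sum_q nu q).
  rewrite exchange_big rmorph_sum; apply: eq_bigr => q _ /=.
  have -> : ofR k (nu q) = \sum_x v q x * M x q.
    rewrite (eq_bigr (fun x => ofR k (nu q)^-1 * (M x q * conjK (M x q)))) => [|x _]; last by rewrite /v; ring.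
    rewrite -mulr_sumr -/(ip (fun x => M x q) (fun x => M x q)) ip_nsq -nu_sqr -rmorphM.
    have [->|d0] := eqVneq (nu q) 0; first by rewrite expr0n mulr0.
    by rewrite expr2 mulKf.
  rewrite /ip; under eq_bigr do rewrite mulr_sumr.
  rewrite exchange_big; apply: eq_bigr => x _.
  rewrite mxE mulr_sumr; apply: eq_bigr => p _.
  rewrite /w [_^*m _ _]mxE [_^T _ _]mxE !mxE !rmorphM /= !conjK_ofR.
  have [d0|d0] := eqVneq (D p) 0; first by rewrite (D_eq0 q d0) !mulr0 mul0r.
  have -> : ofR k (D p)^-1 = ofR k (Num.sqrt (D p))^-1 * ofR k (Num.sqrt (D p))^-1.
    by rewrite -rmorphM -invfM -expr2 sqr_sqrtr.
  ring.
by apply: le_trans (reK_le _); rewrite reK_ofR.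
Qed.
Let beta_sum : \sum_q beta q ^+ 2 = \sum_p D p.
Proof.
transitivity (\sum_q nsq (fun p => B p q)).
  by apply: eq_bigr => q _; rewrite sqr_sqrtr ?nsq_ge0.
rewrite -fsq_cols fsq_rows; apply: eq_bigr => p _.
have -> : nsq (B p) = ((Num.sqrt (D p))^-1) ^+ 2 * D p ^+ 2.
  rewrite D_sqr -[(_^-1) ^+ 2]real_normK ?num_real // -(absK_ofR k) -nsqZ.
  by apply: eq_bigr => q _; rewrite !mxE.
have [->|d0] := eqVneq (D p) 0; first by rewrite expr0n mulr0.
by rewrite exprVn sqr_sqrtr // expr2 mulKf.
Qed.
Let nu_ge q : beta q ^+ 2 <= nu q.
Proof.
have b0 : 0 <= beta q ^+ 2 by exact: sqr_ge0.
rewrite -[leLHS]ger0_norm // -sqrtr_sqr ler_wsqrtr //.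
rewrite /nsq (bigD1 q) //= M_diag absK_ofR real_normK ?num_real // lerDl.
by apply: sumr_ge0 => x _; exact: sqr_ge0.
Qed.
Let defect : \sum_q (nu q - beta q ^+ 2) <= E * m%:R.
Proof. by rewrite sumrB beta_sum; have := nu_sum; have := D_sum; lra. Qed.

Let good q := nu q <= 4.
Let B' : 'M[K]_m := \matrix_(p, q) (if good q then B p q else 0).
Let nu_ge0 q : 0 <= nu q. Proof. exact: sqrtr_ge0. Qed.
Let beta_ge0 q : 0 <= beta q. Proof. exact: sqrtr_ge0. Qed.
Let bad1 q : ~~ good q -> 1 <= (nu q - beta q ^+ 2) + 4 * (beta q - 1) ^+ 2.
Proof. by rewrite /good -ltNge => h4; exact: bad_weight_ge1 (nu_ge q) (beta_ge0 q). Qed.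
Let weight : \sum_q ((nu q - beta q ^+ 2) + 4 * (beta q - 1) ^+ 2) <= 17 * (E * m%:R).
Proof. by rewrite big_split /= -mulr_sumr; have := defect; have := beta_dist; lra. Qed.

Let gram_B' : fsq (B'^*m *m B' - 1%:M) <= 9 * (17 * (E * m%:R)).
Proof.
apply: (@le_trans _ _ (9 * \sum_q ((nu q - beta q ^+ 2) + 4 * (beta q - 1) ^+ 2))); last first.
  by rewrite ler_pM2l // weight.
rewrite fsq_cols mulr_sumr; apply: ler_sum => q _.
have ent x : (B'^*m *m B' - 1%:M) x q = (if good x && good q then M x q else 0) - (x == q)%:R.
  rewrite !mxE; congr (_ - _); case: (boolP (good x && good q)) => [/andP[gx gq]|].
    by apply: eq_bigr => p _; rewrite [_^*m _ _]mxE [_^T _ _]mxE [B' _ _]mxE [in X in conjK X * _]mxE gx mxE gq !mxE.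
  rewrite negb_and => hb; apply: big1 => p _; rewrite [_^*m _ _]mxE [_^T _ _]mxE [B' _ _]mxE [B' _ _]mxE.
  by case/orP: hb => /negPf ->; rewrite ?rmorph0 ?mul0r ?mulr0.
rewrite /nsq; under eq_bigr do rewrite ent.
case: (boolP (good q)) => [gq|bq]; last first.
  rewrite (bigD1 q) //= (negPf bq) andbF sub0r absKN eqxx absK1 expr1n.
  rewrite big1 ?addr0 => [|x /negPf xq]; last by rewrite andbF xq subr0 absK0 expr0n.
  by have := bad1 bq; lra.
apply: (@le_trans _ _ (\sum_x (absK (M x q - (x == q)%:R)) ^+ 2 )).
  apply: ler_sum => x _; rewrite andbT; case: ifP => [//|gx].
  have xq : (x == q) = false by apply: contraFF gx => /eqP ->.
  by rewrite xq !subr0 absK0 expr0n sqr_ge0.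
have e1 : \sum_x (absK (M x q - (x == q)%:R)) ^+ 2 = nu q ^+ 2 - 2 * beta q ^+ 2 + 1.
  rewrite nu_sqr /nsq (bigD1 q) //= [in RHS](bigD1 q) //= eqxx M_diag -(rmorph1 (@ofR R k)) -rmorphB /=.
  rewrite !absK_ofR !real_normK ?num_real //.
  rewrite (eq_bigr (fun x => absK (M x q) ^+ 2)) => [|x /negPf xq]; last by rewrite xq subr0.
  ring.
rewrite e1; have := gq; rewrite /good => g4; have := nu_ge q; have := beta_ge0 q; have := nu_ge0 q.
have b2 : beta q <= 2 by rewrite -ler_sqr ?nnegrE // (le_trans (nu_ge q)) // expr2 -natrM.
have -> : nu q ^+ 2 - 2 * beta q ^+ 2 + 1 =
  (nu q - beta q ^+ 2) * (nu q + beta q ^+ 2) + (beta q - 1) ^+ 2 * (beta q + 1) ^+ 2 by ring.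
move=> n0 bq0 nb.
have f1 : (nu q - beta q ^+ 2) * (nu q + beta q ^+ 2) <= (nu q - beta q ^+ 2) * 8.
  by apply: ler_wpM2l; [rewrite subr_ge0 | move: g4 nb; lra].
have f2 : (beta q - 1) ^+ 2 * (beta q + 1) ^+ 2 <= (beta q - 1) ^+ 2 * 9.
  apply: ler_wpM2l; first exact: sqr_ge0.
  by move: b2 bq0; rewrite expr2; nra.
have := sqr_ge0 (beta q - 1); move: f1 f2; lra.
Qed.

(** Divide the p-th row of tau by the square root of its norm to get B. The test with
suitable unit vectors bounds the sum of the norms nu q of the columns of B^* B by m,
while their diagonal entries, which are at most nu q, add up to nearly m. Hence the
off-diagonal parts are small in the columns where nu q <= 4, and the other columns are
few enough to be discarded. *)
Lemma unitary_from_test : exists2 U : 'M[K]_m, U *m U^*m = 1%:M &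
  fsq (h - U) <= 20000 * (E * m%:R).
Proof.
have [U hU hd] := near_unitary B'.
exists U => //.
have BB : fsq (B - B') <= 4 * (17 * (E * m%:R)).
  apply: (@le_trans _ _ (4 * \sum_q ((nu q - beta q ^+ 2) + 4 * (beta q - 1) ^+ 2))); last first.
    by rewrite ler_pM2l // weight.
  rewrite fsq_cols mulr_sumr; apply: ler_sum => q _.
  case: (boolP (good q)) => [gq|bq].
    rewrite [leLHS]big1 => [|p _]; last by rewrite !mxE gq subrr absK0 expr0n.
    apply: mulr_ge0 => //; apply: addr_ge0; first by rewrite subr_ge0 nu_ge.
    by rewrite mulr_ge0 // sqr_ge0.
  have -> : nsq (fun p => (B - B') p q) = beta q ^+ 2.
    rewrite sqr_sqrtr ?nsq_ge0 //; apply: eq_bigr => p _.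
    by rewrite !mxE (negPf bq) subr0.
  by apply: bad_sqr_le_weight (nu_ge q) (beta_ge0 q); move: bq; rewrite /good -ltNge.
have := fsqB3 h B B' U; have hB := B_dist.
have -> : fsq (h - B) = fsq (B - h) by rewrite -fsqN opprB.
have E0 := le_trans (fsq_ge0 _) tau_h.
have := gram_B'; lra.
Qed.
End UnitaryFromTest.

(** * Reduction of the form to one of its links *)

Section Enumeration.
Variables (n m : nat) (A : {set 'I_n}) (hA : #|A| = m).
(** The indices of A listed by 'I_m. All the sets J_s have the same cardinal m, but
these cardinals are not convertible to each other. *)
Definition enumer (x : 'I_m) : 'I_n := enum_val (cast_ord (esym hA) x).
Lemma enumer_in x : enumer x \in A. Proof. exact: enum_valP. Qed.
Lemma enumer_inj : injective enumer.
Proof. by move=> x y /enum_val_inj/cast_ord_inj. Qed.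
Lemma sum_enumer (V : nmodType) (phi : 'I_n -> V) :
  \sum_x phi (enumer x) = \sum_(j in A) phi j.
Proof.
rewrite [RHS]big_enum_val (reindex (cast_ord hA)) /=.
  by apply: eq_bigr => i _; rewrite /enumer cast_ordK.
by exists (cast_ord (esym hA)) => x _; rewrite ?cast_ordK ?cast_ordKV.
Qed.
Lemma sum_enumer_eq (V : nmodType) (phi : V) j :
  \sum_x (if enumer x == j then phi else 0) = if j \in A then phi else 0.
Proof.
rewrite (sum_enumer (fun y => if y == j then phi else 0)) -big_mkcondr /=.
case: ifP => hj.
  by rewrite (eq_bigl (pred1 j)) ?big_pred1_eq // => y /=; case: eqP => [->|]; rewrite ?hj ?andbF.
by rewrite big_pred0 // => y; case: eqP => [->|]; rewrite ?hj ?andbF.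
Qed.
End Enumeration.

(** Pythagoras for the projection of t onto the line of the unimodular vector g. *)
Lemma projection_identity (R : realType) (k : ground_field) (I : finType) (P : pred I)
  (t g : I -> scalars R k) (z : scalars R k) (M : R) :
  0 < M -> \sum_(i | P i) 1 = M -> (forall i, absK (g i) = 1) ->
  \sum_(i | P i) absK (t i - z * g i) ^+ 2 =
  \sum_(i | P i) absK (t i) ^+ 2 - absK (\sum_(i | P i) t i * conjK (g i)) ^+ 2 / M
   + M * absK (z - (\sum_(i | P i) t i * conjK (g i)) / ofR k M) ^+ 2.
Proof.
move=> M0 hM hg; set A := \sum_(i | P i) t i * conjK (g i).
have -> : \sum_(i | P i) absK (t i - z * g i) ^+ 2 =
   \sum_(i | P i) absK (t i) ^+ 2 + M * absK z ^+ 2 - 2 * reK (A * conjK z).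
  rewrite -hM mulr_suml -big_split /A mulr_suml raddf_sum mulr_sumr -sumrB /=.
  apply: eq_bigr => i _; rewrite sqr_absKB absKM hg mulr1 mul1r rmorphM /=.
  by congr (_ - 2 * reK _); ring.
have M0' : M != 0 by rewrite gt_eqF.
have oM0 : ofR k M != 0 by rewrite -(rmorph0 (@ofR R k)) (inj_eq (@ofR_inj R k)).
rewrite sqr_absKB absKM absKV absK_ofR (ger0_norm (ltW M0)) rmorphM fmorphV /= conjK_ofR.
have -> : z * (conjK A / ofR k M) = ofR k M^-1 * (z * conjK A) by rewrite fmorphV /=; ring.
rewrite reK_ofRM (reK_mulC_conj A z).
by rewrite exprMn exprVn; field; rewrite ?M0' ?oM0.
Qed.

Section Reduction.
Variables (R : realType) (k : ground_field) (e n m : nat).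
Local Notation d := e.+2.
Local Notation K := (scalars R k).
Local Notation I := {ffun 'I_d -> 'I_n}.
Variable T : ('I_d -> 'rV[K]_n) -> K.
Hypothesis T_cb : (cb_norm T <= 1%:E)%E.
Variable J : 'I_d -> {set 'I_n}.
Hypothesis hJ : forall s, #|J s| = m.
Hypothesis m_gt0 : (0 < m)%N.
Variable H : 'I_d.-1 -> 'M[K]_n.
Hypothesis H_uni : forall r p q, absK (H r p q) = 1.
Local Notation f := (fun s => enumer (hJ s)).
Let sm : R := (Num.sqrt m%:R)^-1.
Let mR : 0 < m%:R :> R. Proof. by rewrite ltr0n. Qed.
Let sm2 : sm ^+ 2 = m%:R^-1. Proof. by rewrite exprVn sqr_sqrtr ?ler0n. Qed.
Let sm_ge0 : 0 <= sm. Proof. by rewrite invr_ge0 sqrtr_ge0. Qed.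
Variable r : 'I_d.-1.

(** The phase of all the links but the r-th one. *)
Definition others (i : I) : K := \prod_(r' | r' != r) H r' (i (pos r')) (i (next_pos r')).

Lemma nsq_enum_delta s j : nsq (fun x : 'I_m => (f s x == j)%:R : K) <= 1.
Proof.
rewrite /nsq (eq_bigr (fun x => if f s x == j then 1 else 0)) => [|x _]; last first.
  by case: eqP; rewrite ?absK1 ?absK0 ?expr1n ?expr0n.
by rewrite (sum_enumer_eq (hJ s) (1 : R) j); case: ifP.
Qed.

Lemma nsq_flat (g : 'I_m -> K) : (forall x, absK (g x) = 1) ->
  nsq (fun x => ofR k sm * g x) <= 1.
Proof.
move=> hg; rewrite nsqZ absK_ofR (ger0_norm sm_ge0) sm2 /nsq.
rewrite (eq_bigr (fun=> 1)) => [|x _]; last by rewrite hg expr1n.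
by rewrite sumr_const card_ord mulVf // gt_eqF.
Qed.

(** A family of vectors indexed by 'I_m becomes a family indexed by the elements of J s,
extended by 0. *)
Definition spread s (w : 'I_m -> 'I_m -> K) (j : 'I_n) (x : 'I_m) : K :=
  \sum_p (if f s p == j then w p x else 0).
Lemma nsq_spread s w j : (forall p, nsq (w p) <= 1) -> nsq (spread s w j) <= 1.
Proof.
move=> hw; have [/existsP[p /eqP <-]|] := boolP [exists p, f s p == j].
  apply: le_trans (hw p); rewrite le_eqVlt; apply/orP; left; apply/eqP.
  apply: eq_bigr => x _; rewrite /spread (bigD1 p) //= eqxx big1 ?addr0 // => q qp.
  by rewrite (inj_eq (@enumer_inj _ _ _ (hJ s))) (negPf qp).
rewrite negb_exists => /forallP h; rewrite /nsq big1 ?ler01 // => x _.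
by rewrite /spread big1 ?absK0 ?expr0n // => p _; rewrite (negPf (h p)).
Qed.

Definition fibre p q (i : I) := [&& inside J i, i (pos r) == f (pos r) p & i (next_pos r) == f (next_pos r) q].

Lemma sum_fibre (V : nmodType) (phi : I -> V) :
  \sum_p \sum_q \sum_(i | fibre p q i) phi i = \sum_(i | inside J i) phi i.
Proof.
under eq_bigr do under eq_bigr do rewrite big_mkcond.
under eq_bigr do rewrite exchange_big.
rewrite exchange_big /= [RHS]big_mkcond; apply: eq_bigr => i _.
rewrite /fibre; case: (boolP (inside J i)) => [/forallP hi|_] /=; last first.
  by apply: big1 => p _; apply: big1.
transitivity (\sum_p (if f (pos r) p == i (pos r) then
    \sum_q (if f (next_pos r) q == i (next_pos r) then phi i else 0) else 0)).
  apply: eq_bigr => p _; rewrite [f _ p == _]eq_sym; case: ifP => _; last by rewrite big1.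
  by apply: eq_bigr => q _; rewrite eq_sym.
by rewrite !sum_enumer_eq !hi.
Qed.

Lemma card_fibre p q : \sum_(i | fibre p q i) 1 = m%:R ^+ e :> R.
Proof.
pose g (u : 'I_d) (j : 'I_n) : R := if u == pos r then (j == f (pos r) p)%:R else
   if u == next_pos r then (j == f (next_pos r) q)%:R else (j \in J u)%:R.
have nn : next_pos r == pos r = false by rewrite -val_eqE /= gtn_eqF.
rewrite big_mkcond (eq_bigr (fun i : I => \prod_u g u (i u))) => [|i _].
  rewrite sum_prod (bigD1 (pos r)) //= (bigD1 (next_pos r)) ?nn //=.
  have E1 (a : 'I_n) : \sum_j (j == a)%:R = 1 :> R.
    by rewrite (bigD1 a) //= eqxx big1 ?addr0 // => j /negPf ->.
  rewrite {1}/g eqxx E1 {1}/g nn eqxx E1 !mul1r.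
  rewrite (eq_bigr (fun=> m%:R)) => [|u /andP[/negPf u1 /negPf u2]]; last first.
    by rewrite /g u1 u2 -natr_sum sum1_card_in hJ.
  rewrite prodr_const; congr (_ ^+ _).
  have := cardsD1 (pos r) [set: 'I_d]; rewrite inE cardsT card_ord add1n => -[h1].
  have := cardsD1 (next_pos r) ([set: 'I_d] :\ pos r); rewrite !inE nn -h1 add1n => -[h2].
  by apply: (etrans _ (esym h2)); apply: eq_card => u; rewrite !inE andbT andbC.
rewrite /fibre; case: (boolP (inside J i)) => [/forallP hi|] /=.
  rewrite (bigD1 (pos r)) //= (bigD1 (next_pos r)) ?nn //= {1}/g eqxx {1}/g nn eqxx.
  rewrite big1 ?mulr1 => [|u /andP[/negPf u1 /negPf u2]]; last by rewrite /g u1 u2 hi.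
  by case: eqP; case: eqP; rewrite ?mul1r ?mul0r.
rewrite negb_forall => /existsP[u hu]; apply/esym.
suff gz : g u (i u) = 0 by rewrite (bigD1 u) //= gz mul0r.
rewrite /g; case: eqP => [eu|_].
  by rewrite eu in hu *; case: eqP => // h; rewrite h enumer_in in hu.
case: eqP => [eu|_]; last by rewrite (negPf hu).
by rewrite eu in hu *; case: eqP => // h; rewrite h enumer_in in hu.
Qed.

(** Up to normalization, the average of T over the indices with given coordinates at r
and r + 1, after the phases of the other links have been removed. *)
Definition tau : 'M[K]_m := \matrix_(p, q)
  (ofR k (m%:R * sm ^+ e) * \sum_(i | fibre p q i) coef T i * conjK (others i)).

(** In chain_test the links before r use the coordinate to their left as the summation
variable and those after r the coordinate to their right. So each of them contributes
exactly the conjugate of H_t / sqrt m, and the free vectors w and v remain at the link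
r. *)
Lemma reduced_test (w v : 'I_m -> 'I_m -> K) :
  (forall p, nsq (w p) <= 1) -> (forall q, nsq (v q) <= 1) ->
  absK (\sum_p \sum_q tau p q * ip (v q) (w p)) <= m%:R.
Proof.
move=> hw hv.
(* The vectors of the links: unit vectors of the basis on the side of the summation
variable, rows or columns of H on the other side. *)
pose b (s : 'I_d) (j : 'I_n) (x : 'I_m) : K :=
  if (s < r)%N then (f s x == j)%:R else if s == r :> nat then spread s w j x else
  ofR k sm * H (inord s) j (f (inord s.+1) x).
pose a (s : 'I_d) (j : 'I_n) (x : 'I_m) : K :=
  if (s <= r)%N then ofR k sm * conjK (H (inord s.-1) (f (inord s.-1) x) j)
  else if s == r.+1 :> nat then spread s v j x else (f s x == j)%:R.
have hb s j : nsq (b s j) <= 1.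
  rewrite /b; case: (s < r)%N; first exact: nsq_enum_delta.
  by case: (s == r :> nat); [exact: nsq_spread | exact: nsq_flat].
have ha s j : nsq (a s j) <= 1.
  rewrite /a; case: (s <= r)%N; first by apply: nsq_flat => x; rewrite absK_conj.
  by case: (s == r.+1 :> nat); [exact: nsq_spread | exact: nsq_enum_delta].
have := le_trans (chain_test T ha hb (Ordinal m_gt0)) T_cb.
rewrite lee_fin.

have ind s j (y : 'I_m -> K) : \sum_x (if f s x == j then y x else 0) =
    if j \in J s then \sum_x (if f s x == j then y x else 0) else 0.
  case: ifP => // hj; apply: big1 => x _; case: eqP => // hx.
  by rewrite -hx enumer_in in hj.
have pick s j (y : 'I_n -> K) : \sum_x (if f s x == j then y (f s x) else 0) =
    if j \in J s then y j else 0.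
  rewrite -(sum_enumer_eq (hJ s)); apply: eq_bigr => x _.
  by case: eqP => // ->.
have factor (i : I) (r' : 'I_d.-1) : r' != r ->
    ip (a (next_pos r') (i (next_pos r'))) (b (pos r') (i (pos r'))) =
    if (r' < r)%N then (if i (pos r') \in J (pos r') then ofR k sm * conjK (H r' (i (pos r')) (i (next_pos r'))) else 0)
    else (if i (next_pos r') \in J (next_pos r') then ofR k sm * conjK (H r' (i (pos r')) (i (next_pos r'))) else 0).
  move=> rr; rewrite /ip /a /b /=.
  have E1 : inord r' = r' :> 'I_e.+1 by apply: ord_inj; rewrite inordK.
  have E2 : inord r' = pos r' :> 'I_d by apply: ord_inj; rewrite inordK //= ltnW // ltnS.
  have E3 : inord r'.+1 = next_pos r' :> 'I_d by apply: ord_inj; rewrite inordK //= ltnS.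
  rewrite eqSS; case: (ltngtP r' r) => [h|h|h]; last by rewrite (ord_inj h) eqxx in rr.
    rewrite E1 E2 -(pick (pos r') (i (pos r')) (fun y => ofR k sm * conjK (H r' y (i (next_pos r'))))).
    by apply: eq_bigr => x _; case: eqP => _; rewrite ?rmorph1 ?rmorph0 ?mulr1 ?mulr0.
  rewrite E1 E3 -(pick (next_pos r') (i (next_pos r')) (fun y => ofR k sm * conjK (H r' (i (pos r')) y))).
  apply: eq_bigr => x _; case: eqP => _; rewrite ?mul1r ?mul0r //.
  by rewrite rmorphM /= conjK_ofR.
have mid (i : I) : ip (a (next_pos r) (i (next_pos r))) (b (pos r) (i (pos r))) =
    \sum_p \sum_q (if (i (pos r) == f (pos r) p) && (i (next_pos r) == f (next_pos r) q)
       then ip (v q) (w p) else 0).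
  rewrite /a /b /= ?ltnn !eqxx /ip /spread.
  transitivity (\sum_x \sum_p \sum_q (if (i (pos r) == f (pos r) p) && (i (next_pos r) == f (next_pos r) q)
       then v q x * conjK (w p x) else 0)).
    apply: eq_bigr => x _; rewrite rmorph_sum mulrC big_distrlr /=.
    apply: eq_bigr => p _; apply: eq_bigr => q _.
    rewrite [i (pos r) == _]eq_sym [i (next_pos r) == _]eq_sym.
    by case: eqP => _; case: eqP => _; rewrite /= ?rmorph0 ?mul0r ?mulr0 // mulrC.
  rewrite exchange_big; apply: eq_bigr => p _; rewrite exchange_big; apply: eq_bigr => q _.
  by case: ifP => // _; exact: big1.
have prodE (i : I) : \prod_(r' < d.-1) ip (a (next_pos r') (i (next_pos r'))) (b (pos r') (i (pos r'))) =
   if inside J i then ofR k (sm ^+ e) * conjK (others i) * ip (a (next_pos r) (i (next_pos r))) (b (pos r) (i (pos r))) else 0.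
  rewrite (bigD1 r) //= mulrC; case: (boolP (inside J i)) => [/forallP hi|].
    congr (_ * _); rewrite /others rmorph_prod.
    rewrite (eq_bigr (fun r' => ofR k sm * conjK (H r' (i (pos r')) (i (next_pos r'))))) => [|r' rr]; last first.
      by rewrite factor // !hi; case: ifP.
    rewrite big_split /= prodr_const cardC1 card_ord rmorphXn; congr (_ * _).
  rewrite negb_forall => /existsP[s hs].
  case: (ltngtP s r) => h.
  - pose r' : 'I_d.-1 := Ordinal (ltn_trans h (ltn_ord r)).
    have rr : r' != r by rewrite -val_eqE /= ltn_eqF.
    have sE : s = pos r' by exact: ord_inj.
    by rewrite (bigD1 r') //= factor // h -sE (negPf hs) !mul0r.
  - case: (ltngtP s r.+1) => h2; first by rewrite ltnS leqNgt h in h2.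
      have sp : (0 < s)%N by exact: leq_ltn_trans h.
      have s1 : (s.-1 < d.-1)%N by rewrite -ltnS prednK // ltn_ord.
      pose r' : 'I_d.-1 := Ordinal s1.
      have rr : r' != r.
        by rewrite -val_eqE /= gtn_eqF // -ltnS prednK.
      have sE : s = next_pos r' by apply: ord_inj; rewrite /= prednK.
      have lt : (r' < r)%N = false by apply/negbTE; rewrite -leqNgt /= -ltnS prednK // ltnW.
      by rewrite (bigD1 r') //= factor // lt -sE (negPf hs) !mul0r.
    have sE : s = next_pos r by exact: ord_inj.
    rewrite mid [X in _ * X]big1 ?mulr0 // => p _; apply: big1 => q _; case: ifP => // /andP[_ /eqP hq].
    by rewrite sE hq enumer_in in hs.
  - have sE : s = pos r by exact: ord_inj.
    rewrite mid [X in _ * X]big1 ?mulr0 // => p _; apply: big1 => q _; case: ifP => // /andP[/eqP hq _].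
    by rewrite sE hq enumer_in in hs.
have -> : \sum_(i : I) coef T i * \prod_(r' < d.-1) ip (a (next_pos r') (i (next_pos r'))) (b (pos r') (i (pos r')))
   = ofR k (m%:R^-1) * \sum_p \sum_q tau p q * ip (v q) (w p).
  transitivity (\sum_p \sum_q \sum_(i : I) (if fibre p q i then
      ofR k (sm ^+ e) * (coef T i * conjK (others i)) * ip (v q) (w p) else 0)); last first.
    rewrite mulr_sumr; apply: eq_bigr => p _; rewrite mulr_sumr; apply: eq_bigr => q _.
    move: (ip (v q) (w p)) => y; apply/esym; rewrite mxE mulrA mulrA -rmorphM mulKf ?gt_eqF //= mulr_sumr mulr_suml -big_mkcond /=.
    by apply: eq_bigr.
  under [RHS]eq_bigr do rewrite exchange_big.
  rewrite [RHS]exchange_big; apply: eq_bigr => i _; rewrite prodE /fibre.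
  case: (boolP (inside J i)) => hi /=; last by rewrite mulr0 big1 // => p _; rewrite big1.
  rewrite mid !mulr_sumr; apply: eq_bigr => p _; rewrite !mulr_sumr; apply: eq_bigr => q _.
  by case: ifP => _; rewrite ?mulr0 //; ring.
rewrite absKM absK_ofR ger0_norm ?invr_ge0 ?ler0n // mulrC ler_pdivrMr // mul1r.
by [].
Qed.

Variable E : R.
Hypothesis near : \sum_(i | inside J i) absK (coef T i - ofR k (sm ^+ e.+3) *
   \prod_(r' < d.-1) H r' (i (pos r')) (i (next_pos r'))) ^+ 2 <= E / m%:R.
Hypothesis mass : 1 - E <= m%:R * \sum_(i | inside J i) absK (coef T i) ^+ 2.

(** By projection_identity on each fibre, the distance of T to the product of the H_t
controls both the distance of tau to H_r / sqrt m and the mass that tau retains. *)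
Lemma unitary_factor : exists2 U : 'M[K]_m, U *m (map_mx (@conjK R k) U^T) = 1%:M &
  fsq ((\matrix_(p, q) (ofR k sm * H r (f (pos r) p) (f (next_pos r) q))) - U) <= 20000 * (2 * E * m%:R).
Proof.
set h : 'M[K]_m := \matrix_(p, q) _.
have m0 : m%:R != 0 :> R by rewrite gt_eqF.
have M0 : 0 < m%:R ^+ e :> R by rewrite exprn_gt0.
have smM : sm ^+ e ^+ 2 * m%:R ^+ e = 1 by rewrite -exprM mulnC exprM sm2 -exprMn mulVf // expr1n.
have smM' : m%:R * sm ^+ e * (m%:R ^+ e * sm ^+ e.+3) = sm.
  transitivity ((m%:R * sm ^+ 2) * (sm ^+ e ^+ 2 * m%:R ^+ e) * sm); first by rewrite !exprS expr0; ring.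
  by rewrite smM sm2 mulfV // !mul1r.
have others1 i : absK (others i) = 1 by rewrite absK_prod big1.
pose A p q := \sum_(i | fibre p q i) coef T i * conjK (others i).
pose z p q := ofR k (sm ^+ e.+3) * H r (f (pos r) p) (f (next_pos r) q).
pose S p q := \sum_(i | fibre p q i) absK (coef T i) ^+ 2.
pose D p q := m%:R ^+ e * absK (z p q - A p q / ofR k (m%:R ^+ e)) ^+ 2.
have near' : \sum_p \sum_q (S p q - absK (A p q) ^+ 2 / m%:R ^+ e + D p q) <= E / m%:R.
  apply: le_trans near; rewrite -sum_fibre; apply: ler_sum => p _; apply: ler_sum => q _.
  rewrite -(projection_identity (coef T) (z p q) M0 (card_fibre p q) others1).
  apply: ler_sum => i /and3P[_ /eqP hp /eqP hq].
  by rewrite (bigD1 r) //= hp hq mulrA.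
have SA p q : 0 <= S p q - absK (A p q) ^+ 2 / m%:R ^+ e.
  have := projection_identity (coef T) (A p q / ofR k (m%:R ^+ e)) M0 (card_fibre p q) others1.
  rewrite subrr absK0 expr0n /= mulr0 addr0 => <-.
  by apply: sumr_ge0 => i _; exact: sqr_ge0.
have D0 p q : 0 <= D p q by rewrite mulr_ge0 ?sqr_ge0 // ltW.
have tauh p q : absK ((tau - h) p q) ^+ 2 = m%:R ^+ 2 * D p q.
  have -> : (tau - h) p q = ofR k (- (m%:R * sm ^+ e * m%:R ^+ e)) * (z p q - A p q / ofR k (m%:R ^+ e)).
    have -> : ofR k (- (m%:R * sm ^+ e * m%:R ^+ e)) = - (ofR k (m%:R * sm ^+ e) * ofR k (m%:R ^+ e)).
      by rewrite rmorphN rmorphM.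
    have smK : ofR k sm = ofR k (m%:R * sm ^+ e) * (ofR k (m%:R ^+ e) * ofR k (sm ^+ e.+3)).
      by rewrite -!rmorphM /= smM'.
    have N0 : ofR k (m%:R ^+ e : R) != 0.
      apply/eqP => h0; have := ofR_inj (etrans h0 (esym (rmorph0 (@ofR R k)))).
      by move/eqP; rewrite gt_eqF.
    rewrite !mxE -/(A p q) /z smK; move: N0.
    move: (ofR k (m%:R ^+ e)) (ofR k (m%:R * sm ^+ e)) (ofR k (sm ^+ e.+3)) (A p q) (H _ _ _) => N0 x u t y hN.
    by rewrite -{1}(divfK hN t); move: (t / N0) => t'; ring.
  rewrite absKM exprMn absK_ofR real_normK ?num_real // sqrrN /D !exprMn.
  move: (absK _ ^+ 2) => X.
  transitivity (m%:R ^+ 2 * (sm ^+ e ^+ 2 * m%:R ^+ e) * (m%:R ^+ e * X)); first by ring.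
  by rewrite smM mulr1.
have tauA p q : absK (tau p q) ^+ 2 = m%:R ^+ 2 * (absK (A p q) ^+ 2 / m%:R ^+ e).
  rewrite mxE -/(A p q) absKM exprMn absK_ofR real_normK ?num_real // exprMn -mulrA; congr (_ * _).
  by rewrite mulrC; congr (_ * _); apply: (mulIf (lt0r_neq0 M0)); rewrite smM mulVf ?gt_eqF.
have fh : fsq (tau - h) = m%:R ^+ 2 * \sum_p \sum_q D p q.
  by rewrite mulr_sumr; apply: eq_bigr => p _; rewrite mulr_sumr; apply: eq_bigr => q _; rewrite tauh.
have ft : fsq tau = m%:R ^+ 2 * \sum_p \sum_q (absK (A p q) ^+ 2 / m%:R ^+ e).
  by rewrite mulr_sumr; apply: eq_bigr => p _; rewrite mulr_sumr; apply: eq_bigr => q _; rewrite tauA.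
have sumS : \sum_p \sum_q S p q = \sum_(i | inside J i) absK (coef T i) ^+ 2 by rewrite -sum_fibre.
pose SD := \sum_p \sum_q D p q; pose SAA := \sum_p \sum_q (absK (A p q) ^+ 2 / m%:R ^+ e).
pose SS := \sum_p \sum_q S p q.
have split3 : \sum_p \sum_q (S p q - absK (A p q) ^+ 2 / m%:R ^+ e + D p q) = SS - SAA + SD.
  rewrite /SS /SAA /SD -sumrB -big_split; apply: eq_bigr => p _.
  by rewrite -sumrB -big_split.
have le1 : 0 <= SS - SAA.
  rewrite /SS /SAA -sumrB; apply: sumr_ge0 => p _; rewrite -sumrB; exact: sumr_ge0.
have le2 : 0 <= SD by apply: sumr_ge0 => p _; exact: sumr_ge0.
rewrite split3 in near'; have mass' := mass; rewrite -sumS -/SS in mass'; rewrite -/SD in fh; rewrite -/SAA in ft.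
have mm : m%:R ^+ 2 * (E / m%:R) = E * m%:R by field.
have m2 : 0 <= m%:R ^+ 2 :> R by rewrite sqr_ge0.
have E0 : 0 <= E * m%:R.
  by rewrite -mm mulr_ge0 //; apply: le_trans near'; exact: addr_ge0.
have tau_h : fsq (tau - h) <= 2 * E * m%:R.
  apply: (@le_trans _ _ (m%:R ^+ 2 * (E / m%:R))).
    by rewrite fh ler_wpM2l //; move: near' le1; lra.
  by rewrite mm -mulrA ler_peMl // ler1n.
have tau_big : m%:R * (1 - 2 * E) <= fsq tau.
  have a1 : m%:R * (1 - E) <= m%:R ^+ 2 * SS by rewrite expr2 -mulrA ler_wpM2l // ltW.
  have a2 : m%:R ^+ 2 * (SS - E / m%:R) <= fsq tau.
    by rewrite ft ler_wpM2l //; move: near' le2; lra.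
  by move: a2; rewrite mulrBr mm; move: a1; lra.
have h_entry p q : absK (h p q) ^+ 2 = m%:R^-1.
  by rewrite mxE absKM H_uni mulr1 absK_ofR real_normK ?num_real //.
have [U hU hd] := unitary_from_test reduced_test h_entry tau_h tau_big.
by exists U.
Qed.
End Reduction.

(** * Products along a chain of matrices *)

Section Resampling.
Variables (d' n m : nat).
Local Notation d := d'.+1.
Local Notation I := {ffun 'I_d -> 'I_n}.
Variable J : 'I_d -> {set 'I_n}.
Hypothesis hJ : forall s, #|J s| = m.

(** An index together with a new value at s is turned, by exchanging the new value and
the old one, into another such pair. *)
Lemma sum_resample (V : nmodType) (F : I -> V) (s : 'I_d) :
  (\sum_(i | inside J i) F i) *+ m = \sum_(i | inside J i) \sum_(q in J s) F (upd i s q).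
Proof.
pose sw (p : I * 'I_n) := (upd p.1 s p.2, p.1 s).
have swK : involutive sw.
  move=> [i q]; congr pair => /=; last by rewrite ffunE eqxx.
  by apply/ffunP => t; rewrite !ffunE; case: eqP => [->|].
rewrite (pair_big (inside J) (fun q => q \in J s) (fun i q => F (upd i s q))) /=.
transitivity (\sum_(i | inside J i) \sum_(q in J s) F i).
  by rewrite -sumrMnl; apply: eq_bigr => i _; rewrite sumr_const hJ.
rewrite pair_big /= (reindex_inj (inv_inj swK)) /=.
apply: eq_bigl => -[i q] /=; apply/andP/andP => -[/forallP h1 h2]; split; try apply/forallP => t; rewrite ?ffunE ?eqxx //.
- by have := h1 t; rewrite ffunE; case: eqP => // ->.
- by have := h1 s; rewrite ffunE eqxx.
- by case: eqP => // ->.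
Qed.

(** The links before l; it involves the coordinates up to l only. *)
Definition below (S : comPzRingType) (G : 'I_d.-1 -> 'I_n -> 'I_n -> S) (l : nat) (i : I) : S :=
  \prod_(r < d.-1 | (r < l)%N) G r (i (pos r)) (i (next_pos r)).

Lemma belowS (S : comPzRingType) (G : 'I_d.-1 -> 'I_n -> 'I_n -> S) (r : 'I_d.-1) i :
  below G r.+1 i = below G r i * G r (i (pos r)) (i (next_pos r)).
Proof.
rewrite /below (bigD1 r) //= mulrC; congr (_ * _); apply: eq_bigl => t.
by rewrite ltnS ltn_neqAle andbC.
Qed.

Lemma below_upd (S : comPzRingType) (G : 'I_d.-1 -> 'I_n -> 'I_n -> S) (r : 'I_d.-1) i q :
  below G r (upd i (next_pos r) q) = below G r i.
Proof.
apply: eq_bigr => t tr; rewrite !ffunE -!val_eqE /= eqSS !ltn_eqF //.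
exact: ltnW.
Qed.

Lemma belowT (S : comPzRingType) (G : 'I_d.-1 -> 'I_n -> 'I_n -> S) i :
  below G d.-1 i = \prod_r G r (i (pos r)) (i (next_pos r)).
Proof. by apply: eq_bigl => r; rewrite ltn_ord. Qed.

Lemma upd_pos (r : 'I_d.-1) (i : I) q : upd i (next_pos r) q (pos r) = i (pos r).
Proof. by rewrite ffunE -val_eqE /= ltn_eqF. Qed.
Lemma upd_next (r : 'I_d.-1) (i : I) q : upd i (next_pos r) q (next_pos r) = q.
Proof. by rewrite ffunE eqxx. Qed.

(** The last coordinate of a partial product occurs in a single link, so it can be
summed out by resampling it. *)
Lemma chain_rows (R : realFieldType) (G : 'I_d.-1 -> 'I_n -> 'I_n -> R) (w : R) (l : nat) j :
  (forall (r : 'I_d.-1) p, (l <= r)%N -> p \in J (pos r) -> \sum_(q in J (next_pos r)) G r p q = w) ->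
  (l + j <= d.-1)%N ->
  m%:R ^+ j * \sum_(i | inside J i) below G (l + j) i = w ^+ j * \sum_(i | inside J i) below G l i.
Proof.
move=> hG; elim: j => [|j IH] lj; first by rewrite addn0 !mul1r.
rewrite addnS in lj.
rewrite [w ^+ _]exprS -mulrA -IH ?(ltnW lj) // mulrCA exprSr -mulrA; congr (_ * _).
rewrite mulr_natl (sum_resample _ (next_pos (Ordinal lj))) mulr_sumr; apply: eq_bigr => i /forallP hi.
rewrite addnS -(hG (Ordinal lj) (i (pos (Ordinal lj)))) ?leq_addr // mulr_suml.
apply: eq_bigr => q _.
by rewrite (belowS G (Ordinal lj)) (below_upd G (Ordinal lj)) upd_pos upd_next mulrC.
Qed.

End Resampling.

Section Distance.
Variables (R : realType) (k : ground_field) (e n m : nat).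
Local Notation d := e.+2.
Local Notation K := (scalars R k).
Local Notation I := {ffun 'I_d -> 'I_n}.
Variable J : 'I_d -> {set 'I_n}.
Hypothesis hJ : forall s, #|J s| = m.
Hypothesis m_gt0 : (0 < m)%N.

Lemma sum_pair (g : 'I_n -> 'I_n -> R) (r : 'I_d.-1) :
  \sum_(i | inside J i) g (i (pos r)) (i (next_pos r)) =
  m%:R ^+ e * \sum_(p in J (pos r)) \sum_(q in J (next_pos r)) g p q.
Proof.
rewrite -(sum_fibre hJ r).
rewrite -(sum_enumer (hJ (pos r)) (fun p => \sum_(q in J (next_pos r)) g p q)) mulr_sumr.
apply: eq_bigr => p _.
rewrite -(sum_enumer (hJ (next_pos r)) (g _)) mulr_sumr; apply: eq_bigr => q _.
rewrite -(card_fibre R hJ r p q) mulr_suml; apply: eq_bigr => i /and3P[_ /eqP -> /eqP ->].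
by rewrite mul1r.
Qed.

Variables (H W : 'I_d.-1 -> 'I_n -> 'I_n -> K) (dlt : R).
Hypothesis H_uni : forall r p q, absK (H r p q) = 1.
Hypothesis W_rows : forall r p, p \in J (pos r) -> \sum_(q in J (next_pos r)) absK (W r p q) ^+ 2 = m%:R.
Hypothesis HW : forall r, \sum_(p in J (pos r)) \sum_(q in J (next_pos r)) absK (H r p q - W r p q) ^+ 2 <= dlt.

Definition mixed (l : nat) (i : I) : K :=
  \prod_(r < d.-1) (if (r < l)%N then H r else W r) (i (pos r)) (i (next_pos r)).

(** Only the l-th link changes. The links before it have modulus 1 and those after it
are summed out by chain_rows. *)
Lemma mixed_step (l : 'I_d.-1) :
  \sum_(i | inside J i) absK (mixed l.+1 i - mixed l i) ^+ 2 <= m%:R ^+ e * dlt.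
Proof.
(* The squared modulus of the difference of the two products, link by link. *)
pose G (r : 'I_d.-1) (p q : 'I_n) : R := if (r < l)%N then 1 else if r == l then absK (H r p q - W r p q) ^+ 2
  else absK (W r p q) ^+ 2.
have GE i : absK (mixed l.+1 i - mixed l i) ^+ 2 = \prod_r G r (i (pos r)) (i (next_pos r)).
  rewrite /mixed [in X in X - _](bigD1 l) //= [in X in _ - X](bigD1 l) //= ltnSn ltnn.
  rewrite (eq_bigr (fun r : 'I_d.-1 => (if (r < l)%N then H r else W r) (i (pos r)) (i (next_pos r)))); last first.
    by move=> r rl; rewrite ltnS leq_eqVlt val_eqE (negPf rl).
  rewrite -mulrBl absKM exprMn [RHS](bigD1 l) //= {1}/G ltnn eqxx; congr (_ * _).
  rewrite absK_prod -prodrXl; apply: eq_bigr => r rl; rewrite /G (negPf rl).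
  by case: (r < l)%N; rewrite ?H_uni ?expr1n.
under eq_bigr do rewrite GE -(belowT G).
have m0 : 0 < m%:R :> R by rewrite ltr0n.
have := @chain_rows e.+1 n m J hJ R G m%:R l.+1 (d.-1 - l.+1).
rewrite subnKC ?ltn_ord // leqnn => h.
have {}h := h _ isT; apply: (@le_trans _ _ (\sum_(i | inside J i) below G l.+1 i)).
  rewrite le_eqVlt; apply/orP; left; apply/eqP.
  apply: (@mulfI _ (m%:R ^+ (d.-1 - l.+1))); first by rewrite expf_neq0 // gt_eqF.
  apply: h => r p lr pJ; rewrite -(W_rows pJ); apply: eq_bigr => q _.
  by rewrite /G ltnNge (ltnW lr) /= -val_eqE gtn_eqF.
rewrite (eq_bigr (fun i : I => absK (H l (i (pos l)) (i (next_pos l)) - W l (i (pos l)) (i (next_pos l))) ^+ 2)).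
  rewrite (sum_pair (fun p q => absK (H l p q - W l p q) ^+ 2)).
  by apply: ler_wpM2l (HW l); rewrite exprn_ge0 // ltW.
move=> i _; rewrite belowS {2}/G ltnn eqxx /below big1 ?mul1r // => r rl.
by rewrite /G rl.
Qed.

Lemma chain_distance : \sum_(i | inside J i) absK (\prod_r H r (i (pos r)) (i (next_pos r)) -
    \prod_r W r (i (pos r)) (i (next_pos r))) ^+ 2 <= d.-1%:R ^+ 2 * m%:R ^+ e * dlt.
Proof.
pose x (l : 'I_d.-1) i := mixed l.+1 i - mixed l i.
have E (i : I) : \prod_r H r (i (pos r)) (i (next_pos r)) - \prod_r W r (i (pos r)) (i (next_pos r)) = \sum_(l < d.-1) x l i.
  rewrite -(big_mkord xpredT (fun l => mixed l.+1 i - mixed l i)) telescope_sumr //.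
  by congr (_ - _); apply: eq_bigr => r _; rewrite ?ltn_ord.
apply: (@le_trans _ _ (\sum_(i | inside J i) d.-1%:R * \sum_(l < d.-1) absK (x l i) ^+ 2)).
  apply: ler_sum => i _; rewrite E.
  apply: (@le_trans _ _ ((\sum_(l < d.-1) absK (x l i)) ^+ 2)).
    by rewrite ler_sqr ?nnegrE ?absK_ge0 ?absK_sum //; apply: sumr_ge0 => l _; exact: absK_ge0.
  have := @sum_cauchy_schwarz R 'I_d.-1 (fun=> 1) (fun l => absK (x l i)).
  rewrite (eq_bigr (fun l => absK (x l i))) => [|l _]; last by rewrite mul1r.
  move=> /le_trans; apply; rewrite ler_wpM2r //; first by apply: sumr_ge0 => l _; exact: sqr_ge0.
  by rewrite (eq_bigr (fun=> 1)) => [|l _]; rewrite ?expr1n // sumr_const card_ord.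
rewrite -mulr_sumr exchange_big /= expr2 -!mulrA ler_wpM2l ?ler0n //.
apply: (@le_trans _ _ (\sum_(l < d.-1) m%:R ^+ e * dlt)).
  by apply: ler_sum => l _; exact: mixed_step.
by rewrite sumr_const card_ord -[leLHS]mulr_natl.
Qed.
End Distance.

(** * Forms built from unitary matrices *)

Section Contractions.
Variables (R : realType) (k : ground_field) (H : hilbertSpace R k).
Local Notation K := (scalars R k).
Implicit Types x y : H.

Lemma norm_vnorm x : `|x| = ofR k (vnorm x).
Proof. by rewrite -[LHS]normr_id normE; congr (ofR k _); rewrite /absK normr_id. Qed.
Lemma vnorm_ge0 x : 0 <= vnorm x.
Proof. by rewrite -(@ler_ofR R k) rmorph0 /= -norm_vnorm. Qed.
Lemma vnormD x y : vnorm (x + y) <= vnorm x + vnorm y.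
Proof. by rewrite -(@ler_ofR R k) rmorphD /= -!norm_vnorm ler_normD. Qed.
Lemma vnorm0 : vnorm (0 : H) = 0.
Proof. by apply: (@ofR_inj R k); rewrite -norm_vnorm normr0 rmorph0. Qed.
Lemma vnormZ (c : K) x : vnorm (c *: x) = absK c * vnorm x.
Proof. by apply: (@ofR_inj R k); rewrite rmorphM /= -!norm_vnorm -normE normrZ. Qed.
Lemma vnorm_sum (I : finType) (P : pred I) (f : I -> H) :
  vnorm (\sum_(i | P i) f i) <= \sum_(i | P i) vnorm (f i).
Proof.
elim/big_ind2 : _ => [|x a y b xa yb|//]; first by rewrite vnorm0.
by apply: (le_trans (vnormD _ _)); apply: lerD.
Qed.
Lemma inner_vnorm x : inner H x x = ofR k (vnorm x ^+ 2).
Proof. by rewrite -hilbert_normE norm_vnorm rmorphXn. Qed.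

(** The operator norm is defined through the unit ball, hence the rescaling. *)
Lemma contraction_le (X : {linear H -> H}) x : (opnorm X <= 1%:E)%E -> vnorm (X x) <= vnorm x.
Proof.
move=> hX; have [x0|x0] := eqVneq x 0; first by rewrite x0 linear0.
have vx : 0 < vnorm x.
  rewrite lt_neqAle vnorm_ge0 andbT eq_sym -(inj_eq (@ofR_inj R k)) -norm_vnorm rmorph0.
  by rewrite normr_eq0.
pose c : K := ofR k (vnorm x)^-1.
have : ((vnorm (X (c *: x)))%:E <= 1%:E)%E.
  apply: le_trans hX; apply: ereal_sup_ubound; exists (c *: x) => //=.
  by rewrite vnormZ absK_ofR ger0_norm ?invr_ge0 ?vnorm_ge0 // mulVf // gt_eqF.
rewrite lee_fin linearZ /= vnormZ absK_ofR ger0_norm ?invr_ge0 ?vnorm_ge0 //.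
by rewrite mulrC ler_pdivrMr // mul1r.
Qed.

Variables (n m : nat) (A B : {set 'I_n}) (U : 'I_n -> 'I_n -> K).
Hypothesis U_cols : forall q q', q \in B -> q' \in B ->
  \sum_(p in A) U p q * conjK (U p q') = (q == q')%:R.

(** A matrix with orthonormal columns acts isometrically on families of vectors of any
Hilbert space. *)
Lemma isometry_sum (y : 'I_n -> H) :
  \sum_(p in A) vnorm (\sum_(q in B) U p q *: y q) ^+ 2 = \sum_(q in B) vnorm (y q) ^+ 2.
Proof.
apply: (@ofR_inj R k); rewrite !rmorph_sum /=.
transitivity (\sum_(p in A) \sum_(q in B) \sum_(q' in B) U p q * conjK (U p q') * inner H (y q) (y q')).
  apply: eq_bigr => p _; rewrite -inner_vnorm linear_sumlz /=; apply: eq_bigr => q _.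
  rewrite linear_sumr; apply: eq_bigr => q' _.
  by rewrite linearZl_LR linearZr_LR /=; rewrite /= mulrA.
rewrite exchange_big; apply: eq_bigr => q qB /=.
rewrite exchange_big (bigD1 q) //= -mulr_suml U_cols // eqxx mul1r inner_vnorm.
rewrite big1 ?addr0 // => q' /andP[q'B q'q]; rewrite -mulr_suml U_cols //.
by rewrite eq_sym (negPf q'q) mul0r.
Qed.
End Contractions.

Section UnitaryForm.
Variables (R : realType) (k : ground_field) (e n m : nat).
Local Notation d := e.+2.
Local Notation K := (scalars R k).
Local Notation I := {ffun 'I_d -> 'I_n}.
Variable J : 'I_d -> {set 'I_n}.
Hypothesis hJ : forall s, #|J s| = m.
Hypothesis m_gt0 : (0 < m)%N.
Variable U : 'I_d.-1 -> 'I_n -> 'I_n -> K.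
Hypothesis U_cols : forall r q q', q \in J (next_pos r) -> q' \in J (next_pos r) ->
  \sum_(p in J (pos r)) U r p q * conjK (U r p q') = (q == q')%:R.
Hypothesis U_rows : forall r p, p \in J (pos r) ->
  \sum_(q in J (next_pos r)) absK (U r p q) ^+ 2 = 1.
Variable Q : ('I_d -> 'rV[K]_n) -> K.
Hypothesis QE : forall i : I, coef Q i =
  if inside J i then m%:R^-1 * \prod_(r < d.-1) U r (i (pos r)) (i (next_pos r)) else 0.

Let mR : 0 < m%:R :> R. Proof. by rewrite ltr0n. Qed.

(** The rows of each link have norm 1, so the links are summed out one after the other.
*)
Lemma sum_sqr_unitary : \sum_(i | inside J i) \prod_(r < d.-1) absK (U r (i (pos r)) (i (next_pos r))) ^+ 2 = m%:R.
Proof.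
pose G (r : 'I_d.-1) p q : R := absK (U r p q) ^+ 2.
rewrite (eq_bigr (fun i : I => below G d.-1 i)) => [|i _]; last by rewrite belowT.
have := @chain_rows e.+1 n m J hJ R G 1 0 d.-1; rewrite add0n leqnn expr1n mul1r => h.
have {}h := h (fun r p _ => @U_rows r p) isT.
apply: (@mulfI _ (m%:R ^+ d.-1)); first by rewrite expf_neq0 // gt_eqF.
rewrite h (eq_bigr (fun=> 1)) => [|i _]; last by rewrite /below big1.
by rewrite (sum_inside1 (fun=> 1) ord0 hJ) sumr_const hJ.
Qed.

Lemma frobenius_unitary_form : coef_frobenius Q = (Num.sqrt m%:R)^-1.
Proof.
rewrite /coef_frobenius -sqrtrV ?ler0n //; congr Num.sqrt.
rewrite (eq_bigr (fun i => if inside J i then m%:R^-1 ^+ 2 * \prod_(r < d.-1) absK (U r (i (pos r)) (i (next_pos r))) ^+ 2 else 0)).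
  rewrite -big_mkcond /= -mulr_sumr sum_sqr_unitary expr2 -mulrA mulVf ?mulr1 //.
  by rewrite gt_eqF.
move=> i _; rewrite QE; case: ifP => _; last by rewrite absK0 expr0n.
rewrite absKM exprMn absK_prod prodrXl; congr (_ ^+ 2 * _).
have -> : m%:R^-1 = ofR k (m%:R^-1 : R) :> K by rewrite fmorphV /= rmorph_nat.
by rewrite absK_ofR ger0_norm // invr_ge0 ltW.
Qed.

(** In chain_test take the conjugate of U_r in the r-th link: the value of the test is
then the sum of the squared moduli divided by m. *)
Lemma unitary_form_cb_ge : (1%:E <= cb_norm Q)%E.
Proof.
pose b (s : 'I_d) (j : 'I_n) (x : 'I_n) : K := (x == j)%:R.
pose a (s : 'I_d) (j : 'I_n) (x : 'I_n) : K :=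
  if (x \in J (inord s.-1)) && (j \in J s) && (0 < s)%N then conjK (U (inord s.-1) x j) else 0.
have hb s j : nsq (b s j) <= 1.
  rewrite /nsq (bigD1 j) //= /b eqxx absK1 expr1n big1 ?addr0 // => x /negPf ->.
  by rewrite absK0 expr0n.
have inordE (r : 'I_d.-1) : (inord r = r :> 'I_d.-1) /\ (inord r = pos r :> 'I_d).
  by split; apply: ord_inj; rewrite inordK //= ltnW // ltnS.
have ha s j : nsq (a s j) <= 1.
  rewrite /nsq /a; case: (boolP (j \in J s)) => hj; last first.
    by rewrite big1 ?ler01 // => x _; rewrite andbF absK0 expr0n.
  case: (posnP s) => s0.
    by rewrite big1 ?ler01 // => x _; rewrite andbF absK0 expr0n.
  have s1 : (s.-1 < d.-1)%N by rewrite -ltnS prednK // ltn_ord.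
  pose r : 'I_d.-1 := Ordinal s1.
  have sE : s = next_pos r by apply: ord_inj; rewrite /= prednK.
  have [E1 E2] := inordE r; rewrite /= in E1 E2; rewrite E1 E2.
  rewrite (eq_bigr (fun x => if x \in J (pos r) then absK (U r x j) ^+ 2 else 0)); last first.
    by move=> x _; rewrite !andbT; case: ifP => _; rewrite ?absK_conj // absK0 expr0n.
  rewrite -big_mkcond /= -(@ler_ofR R k) rmorph_sum rmorph1 /=.
  rewrite sE in hj; rewrite -[leRHS]/((true)%:R) -(eqxx j) -(U_cols hj hj).
  by under eq_bigr do rewrite -mulK_conj.
have := chain_test Q ha hb (Ordinal (ltn_ord (enumer (hJ ord0) (Ordinal m_gt0)))).
apply: le_trans; rewrite lee_fin.
have -> : \sum_(i : I) coef Q i * \prod_(r < d.-1) ip (a (next_pos r) (i (next_pos r))) (b (pos r) (i (pos r)))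
  = ofR k (m%:R^-1 * \sum_(i | inside J i) \prod_(r < d.-1) absK (U r (i (pos r)) (i (next_pos r))) ^+ 2).
  rewrite mulr_sumr rmorph_sum [RHS]big_mkcond /=; apply: eq_bigr => i _.
  rewrite QE; case: (boolP (inside J i)) => [/forallP hi|_]; last by rewrite mul0r.
  rewrite rmorphM fmorphV /= rmorph_nat -mulrA; congr (_ * _).
  rewrite rmorph_prod -big_split; apply: eq_bigr => r _ /=.
  rewrite -mulK_conj; congr (_ * _).
  rewrite /ip (bigD1 (i (pos (r : 'I_d.-1)))) //= big1 => [|x /negPf xi]; last by rewrite /b xi rmorph0 mulr0.
  have [E1 E2] := inordE r.
  by rewrite /b eqxx rmorph1 mulr1 addr0 /a /= E1 E2 !hi.
by rewrite sum_sqr_unitary mulVf ?gt_eqF // rmorph1 absK1.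
Qed.

Section Operator.
Variables (H : hilbertSpace R k) (X : 'I_d -> 'I_n -> {linear H -> H}).
Hypothesis X_contr : forall s j, (opnorm (X s j) <= 1%:E)%E.
Variable h : H.
Hypothesis h_le1 : vnorm h <= 1.

Definition prefix_op (l : nat) (i : I) (v : H) : H :=
  foldr (fun s y => X s (i s) y) v (take l (enum 'I_d)).

Lemma prefix_opS (s : 'I_d) i v : prefix_op s.+1 i v = prefix_op s i (X s (i s) v).
Proof.
rewrite /prefix_op (take_nth ord0) ?size_enum_ord // nth_ord_enum.
by rewrite -cats1 foldr_cat.
Qed.
Lemma prefix_op_linear l i : linear (prefix_op l i).
Proof.
rewrite /prefix_op; elim: (take _ _) => //= s t IH c u v.
by rewrite IH linearP.
Qed.
HB.instance Definition _ l i := GRing.isLinear.Build K H H *:%R (prefix_op l i) (prefix_op_linear l i).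

Lemma prefix_op_upd (s : 'I_d) i q v l : (l <= s)%N -> prefix_op l (upd i s q) v = prefix_op l i v.
Proof.
move=> ls; rewrite /prefix_op; have : {in take l (enum 'I_d), forall t, t != s}.
  move=> t /(nthP ord0)[j]; rewrite size_take size_enum_ord (leq_ltn_trans ls (ltn_ord s)) => jl.
  have jd : (j < d)%N by exact: leq_trans jl (leq_trans ls (ltnW (ltn_ord s))).
  rewrite nth_take // => <-; rewrite -val_eqE /= nth_enum_ord //.
  by rewrite ltn_eqF // (leq_trans jl).
elim: (take _ _) => //= t l' IH ht.
rewrite IH => [|u hu]; last by apply: ht; rewrite inE hu orbT.
by rewrite ffunE (negPf (ht t _)) // inE eqxx.
Qed.

(** The coordinates are summed out from the last one: the vectors y collect the part of
the operator to the right of position d - 1 - l, and the sum of their squared norms does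
not increase, since the contractions and the unitary matrices do not increase it. *)
Lemma fold_chain l : (l <= d.-1)%N -> exists y : 'I_n -> H,
  \sum_(p in J (inord (d.-1 - l))) vnorm (y p) ^+ 2 <= m%:R /\
  (\sum_(i | inside J i) below U d.-1 i *: prefix_op d i h) *+ m ^ l =
  \sum_(i | inside J i) below U (d.-1 - l) i *: prefix_op (d.-1 - l) i (y (i (inord (d.-1 - l)))).
Proof.
elim: l => [_|l IH ld].
  exists (fun j => X ord_max j h); rewrite subn0.
  have -> : inord d.-1 = ord_max :> 'I_d by apply: ord_inj; rewrite inordK.
  split.
    rewrite -[X in X%:R](hJ ord_max) -sumr_const; apply: ler_sum => p _.
    rewrite -[leRHS](expr1n _ 2) ler_sqr ?nnegrE ?vnorm_ge0 //.
    exact: le_trans (contraction_le _ (X_contr _ _)) h_le1.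
  rewrite mulr1n; apply: eq_bigr => i _; congr (_ *: _).
  exact: (prefix_opS ord_max).
have [y [hy IHE]] := IH (ltnW ld).
have rlt : (d.-1 - l.+1 < d.-1)%N by rewrite subnS prednK ?subn_gt0 // leq_subr.
pose r : 'I_d.-1 := Ordinal rlt.
have rS : (d.-1 - l)%N = r.+1 by rewrite /= subnS prednK // subn_gt0.
have E1 : inord (d.-1 - l) = next_pos r by apply: ord_inj; rewrite inordK rS //= ltnS.
have E2 : inord (d.-1 - l.+1) = pos r by apply: ord_inj; rewrite inordK //= ltnW.
rewrite E1 rS in IHE; rewrite E1 in hy; rewrite E2.
exists (fun p => X (pos r) p (\sum_(q in J (next_pos r)) U r p q *: y q)); split.
  apply: le_trans hy; rewrite -(isometry_sum (@U_cols r) y); apply: ler_sum => p _.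
  by rewrite ler_sqr ?nnegrE ?vnorm_ge0 //; exact: contraction_le.
rewrite expnSr mulrnA IHE (sum_resample hJ _ (next_pos r)).
apply: eq_bigr => i _; rewrite -[(d.-1 - l.+1)%N]/(nat_of_ord r) !linear_sum.
apply: eq_bigr => q _; rewrite belowS below_upd upd_pos upd_next.
rewrite (prefix_opS (pos r)) prefix_op_upd ?upd_pos //.
rewrite [X _ _ (_ *: _)]linearZ /= [prefix_op _ _ (_ *: _)]linearZ /=.
by rewrite scalerA.
Qed.

(** Once everything but the first coordinate is summed out, Cauchy-Schwarz on m vectors
whose squared norms add up to at most m gives the factor m that Q divides by. *)
Lemma unitary_form_contracts : vnorm (form_operator Q X h) <= 1.
Proof.
have [y [hy E]] := fold_chain (leqnn _).
rewrite subnn in hy E.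
have inord00 : inord 0 = ord0 :> 'I_d by apply: ord_inj; rewrite inordK.
rewrite inord00 in hy E.
have opE : form_operator Q X h = m%:R^-1 *: \sum_(i | inside J i) below U d.-1 i *: prefix_op d i h.
  rewrite /form_operator scaler_sumr [RHS]big_mkcond; apply: eq_bigr => i _ /=.
  rewrite QE belowT /prefix_op take_oversize ?size_enum_ord //.
  by case: ifP => _; rewrite ?scale0r // scalerA.
set S := \sum_(i | inside J i) _ in opE E.
have hS : vnorm S <= m%:R.
  have h1 : m%:R ^+ d.-1 * vnorm S <= m%:R ^+ d.-1 * \sum_(j in J ord0) vnorm (y j).
    rewrite -(sum_inside1 (fun j => vnorm (y j)) ord0 hJ).
    have -> : m%:R ^+ d.-1 * vnorm S = vnorm (S *+ m ^ d.-1).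
      rewrite -scaler_nat vnormZ -(rmorph_nat (@ofR R k)) absK_ofR normr_nat natrX.
      by [].
    rewrite E; apply: (le_trans (vnorm_sum _ _)); apply: ler_sum => i _.
    by rewrite /below big1 ?scale1r // /prefix_op take0.
  rewrite ler_pM2l ?exprn_gt0 // in h1; apply: (le_trans h1).
  rewrite -ler_sqr ?nnegrE ?ler0n //; last by apply: sumr_ge0 => j _; exact: vnorm_ge0.
  apply: le_trans (sqr_sum_le (J ord0) (fun j => vnorm (y j))) _.
  by rewrite hJ expr2 ler_wpM2l ?ler0n.
rewrite opE vnormZ absKV -(rmorph_nat (@ofR R k)) absK_ofR normr_nat.
by rewrite mulrC ler_pdivrMr // mul1r.
Qed.
End Operator.

Lemma unitary_form_cb : cb_norm Q = 1%:E.
Proof.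
apply/eqP; rewrite eq_le unitary_form_cb_ge andbT.
apply: ge_ereal_sup => _ [H [X [hX ->]]].
apply: ge_ereal_sup => _ [h /= hh <-]; rewrite lee_fin.
exact: unitary_form_contracts.
Qed.
End UnitaryForm.

(** * The coefficient norm, indices, and slices *)

Section FormOfCoefficients.
Variables (R : realType) (k : ground_field) (d n : nat).
Local Notation K := (scalars R k).
Local Notation I := {ffun 'I_d -> 'I_n}.

Definition form_of (w : I -> K) (x : 'I_d -> 'rV[K]_n) : K :=
  \sum_i w i * \prod_s x s 0 (i s).

Lemma form_of_multilinear w : multilinear (form_of w).
Proof.
move=> s x c u v; rewrite /form_of mulr_sumr -big_split; apply: eq_bigr => i _ /=.
rewrite [in LHS](bigD1 s) //= [in X in _ = X + _](bigD1 s) //= [in X in _ = _ + X](bigD1 s) //=.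
rewrite !dfwithin !mxE.
have E y : \prod_(t | t != s) @dfwith 'I_d (fun=> 'rV[K]_n) x s y t 0 (i t) =
    \prod_(t | t != s) x t 0 (i t).
  by apply: eq_bigr => t ts; rewrite dfwithout // eq_sym.
by rewrite !E; ring.
Qed.

Lemma coef_form_of w i : coef (form_of w) i = w i.
Proof.
rewrite /coef /form_of (bigD1 i) //= [X in _ * X]big1 => [|s _]; last by rewrite mxE !eqxx.
rewrite mulr1 big1 ?addr0 // => j ji.
have /existsP[s hs] : [exists s, j s != i s].
  rewrite -negb_forall; apply: contra ji => /forallP h; apply/eqP/ffunP => s.
  by apply/eqP.
by rewrite (bigD1 s) //= mxE eqxx (negPf hs) mul0r mulr0.
Qed.
End FormOfCoefficients.

Section Exponent.
Variables (R : realType) (d : nat).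
Hypothesis d_ge2 : (2 <= d)%N.
Let q : R := (2 * d)%:R / d.+1%:R.
Let d1 : 0 < d.+1%:R :> R. Proof. by rewrite ltr0n. Qed.

Lemma exponent_bounds : 1 <= q <= 2.
Proof.
rewrite /q ler_pdivlMr // ler_pdivrMr // mul1r -natrM !ler_nat.
by rewrite leq_mul2l /= leqnSn mul2n -addnn -addn1 leq_add2l (leq_trans _ d_ge2).
Qed.
Let q0 : 0 < q. Proof. by have /andP[h _] := exponent_bounds; exact: lt_le_trans h. Qed.

Lemma powR_exponent (x : R) : 0 <= x -> (x `^ q) ^+ d.+1 = x ^+ (2 * d).
Proof.
move=> x0; rewrite -powR_mulrn ?powR_ge0 // -powRrM /q divfK ?gt_eqF //.
by rewrite powR_mulrn.
Qed.

Lemma powR_sqrt_exponent (m : nat) : (0 < m)%N ->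
  ((Num.sqrt m%:R)^-1 ^+ d.+1) `^ q = m%:R ^- d.
Proof.
move=> m0; set s : R := Num.sqrt _.
have s0 : 0 <= s^-1 by rewrite invr_ge0 sqrtr_ge0.
rewrite -powR_mulrn // -powRrM mulrC /q divfK ?gt_eqF // powR_mulrn // exprM.
by rewrite exprVn sqr_sqrtr ?ler0n // exprVn.
Qed.

(** A crude substitute for Young's inequality, sufficient because q <= 2. *)
Lemma le_sqr_powR (x : R) : 0 <= x -> x `^ q <= x ^+ 2 + 1.
Proof.
move=> x0; have /andP[_ q2] := exponent_bounds.
have [x1|/ltW x1] := leP x 1.
  apply: (@le_trans _ _ 1); last by rewrite lerDr sqr_ge0.
  have := ge0_ler_powR (ltW q0); rewrite /{homo _ : _ _ / _ >-> _} => /(_ x 1).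
  by rewrite !nnegrE powR1; apply.
apply: (@le_trans _ _ (x ^+ 2)); last by rewrite lerDl.
by rewrite -powR_mulrn // ler_powR.
Qed.

(** Hoelder's inequality up to a factor 2: le_sqr_powR is applied after scaling by the
root mean square t of the entries. *)
Lemma sum_powR_le (T : finType) (P : pred T) (z : T -> R) (m : nat) (beta : R) :
  (forall i, 0 <= z i) -> (0 < m)%N -> 0 <= beta -> \sum_(i | P i) 1 = m%:R ^+ d :> R ->
  \sum_(i | P i) z i ^+ 2 <= beta / m%:R ->
  \sum_(i | P i) z i `^ q <= 2 * beta `^ (q / 2).
Proof.
move=> z0 m0; have mR : 0 < m%:R :> R by rewrite ltr0n.
rewrite le_eqVlt => /orP[/eqP <-|b0] hP h.
  rewrite mul0r in h; rewrite big1 ?mulr_ge0 ?powR_ge0 // => i Pi.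
  have : z i ^+ 2 <= 0.
    by apply: le_trans h; rewrite (bigD1 i) //= lerDl; apply: sumr_ge0 => j _; exact: sqr_ge0.
  rewrite -[leRHS](expr0n R 2) ler_sqr ?nnegrE // => zi.
  have -> : z i = 0 by apply/eqP; rewrite eq_le zi z0.
  by rewrite powR0 // gt_eqF.
(* t^2 is beta / m divided by the number m^d of terms. *)
pose t : R := Num.sqrt beta * (Num.sqrt m%:R)^-1 ^+ d.+1.
have t0 : 0 < t by rewrite mulr_gt0 ?exprn_gt0 ?invr_gt0 ?sqrtr_gt0.
have t2 : t ^+ 2 * m%:R ^+ d = beta / m%:R.
  rewrite /t exprMn sqr_sqrtr ?(ltW b0) // -mulrA; congr (_ * _).
  rewrite exprAC exprVn sqr_sqrtr ?ler0n // exprS -mulrA -exprMn mulVf ?gt_eqF //.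
  by rewrite expr1n mulr1.
have tq : t `^ q * m%:R ^+ d = beta `^ (q / 2).
  rewrite /t powRM ?sqrtr_ge0 ?exprn_ge0 ?invr_ge0 ?sqrtr_ge0 // powR_sqrt_exponent //.
  rewrite mulfVK ?expf_neq0 ?gt_eqF //.
  by rewrite -powR12_sqrt ?(ltW b0) // -powRrM mulrC.
apply: (@le_trans _ _ (\sum_(i | P i) t `^ q * ((z i / t) ^+ 2 + 1))).
  apply: ler_sum => i _.
  have -> : z i `^ q = t `^ q * (z i / t) `^ q.
    by rewrite -powRM ?(ltW t0) ?divr_ge0 ?(ltW t0) // mulrC divfK // gt_eqF.
  by rewrite ler_wpM2l ?powR_ge0 // le_sqr_powR // divr_ge0 // ltW.
rewrite -mulr_sumr big_split /= hP mulrDr tq mulr2n mulrDl mul1r lerD2r -tq.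
rewrite ler_wpM2l ?powR_ge0 //.
rewrite (eq_bigr (fun i => z i ^+ 2 * t ^- 2)) => [|i _]; last by rewrite exprMn exprVn.
by rewrite -mulr_suml ler_pdivrMr ?exprn_gt0 // mulrC t2.
Qed.

(** The condition B * eps <= 1 makes the part outside P, which is linear in eps, smaller
than the part inside, which is of the order of eps to the power q / 2. *)
Lemma norm_from_sums (T : finType) (P : pred T) (z : T -> R) (m : nat) (B eps : R) :
  (forall i, 0 <= z i) -> (0 < m)%N -> 1 <= B -> 0 <= eps -> B * eps <= 1 ->
  \sum_(i | P i) 1 = m%:R ^+ d :> R ->
  \sum_(i | P i) z i ^+ 2 <= B * eps / m%:R ->
  \sum_(i | ~~ P i) z i `^ q <= B * eps ->
  (\sum_i z i `^ q) `^ q^-1 <= 3 * B * Num.sqrt eps.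
Proof.
move=> z0 m0 B1 e0 Be1 hP hin hout; have /andP[q1 q2] := exponent_bounds.
have B0 : 0 <= B by exact: le_trans B1.
have Be0 : 0 <= B * eps by rewrite mulr_ge0.
have hin' := sum_powR_le z0 m0 Be0 hP hin.
have out' : B * eps <= (B * eps) `^ (q / 2).
  move: Be0; rewrite le_eqVlt => /orP[/eqP <-|bp]; first exact: powR_ge0.
  rewrite -[leLHS](powRr1 (ltW bp)) ger_powR ?bp //.
  by rewrite ler_pdivrMr // mul1r.
have tot : \sum_i z i `^ q <= 3 * (B * eps) `^ (q / 2).
  by rewrite (bigID P) /=; move: hin' hout out'; lra.
have q'0 : 0 <= q^-1 by rewrite invr_ge0 ltW.
have s0 : 0 <= \sum_i z i `^ q by apply: sumr_ge0 => i _; exact: powR_ge0.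
have p0 : 0 <= 3 * (B * eps) `^ (q / 2) by rewrite mulr_ge0 ?powR_ge0.
have := ge0_ler_powR q'0; rewrite /{homo _ : _ _ / _ >-> _} => /(_ _ _ _ _ tot).
rewrite !nnegrE => /(_ s0 p0) /le_trans; apply.
rewrite powRM ?powR_ge0 // -powRrM mulrAC mulfV ?gt_eqF // mul1r powR12_sqrt //.
rewrite -mulrA sqrtrM // ler_pM ?powR_ge0 ?mulr_ge0 ?sqrtr_ge0 //.
  by rewrite ler1_powR ?invf_le1 ?ler1n.
rewrite ler_wpM2r ?sqrtr_ge0 // -[leRHS]ger0_norm // -sqrtr_sqr ler_wsqrtr //.
by rewrite expr2 ler_peMl.
Qed.
End Exponent.

Section Transport.
Variables (R : realType) (k : ground_field) (n m : nat) (A B : {set 'I_n}).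
Hypotheses (hA : #|A| = m) (hB : #|B| = m).
Local Notation K := (scalars R k).
Local Notation f := (enumer hA).
Local Notation g := (enumer hB).

Lemma frobenius_restr (M : 'M[K]_n) :
  frobenius (restr A B M) = Num.sqrt (\sum_(p in A) \sum_(q in B) absK (M p q) ^+ 2).
Proof.
congr Num.sqrt; rewrite [RHS]big_enum_val; apply: eq_bigr => a _.
by rewrite [RHS]big_enum_val; apply: eq_bigr => b _; rewrite mxE.
Qed.

Lemma unitary_restr (M : 'M[K]_n) :
  (forall p p', p \in A -> p' \in A -> \sum_(q in B) M p q * conjK (M p' q) = (p == p')%:R) ->
  unitary (restr A B M).
Proof.
move=> h; apply/matrixP => a a'; rewrite !mxE.
rewrite -(inj_eq enum_val_inj) -h ?enum_valP // [RHS]big_enum_val.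
by apply: eq_bigr => b _; rewrite !mxE.
Qed.

(** The matrices of the statement have order n and are only read on A x B. *)
Definition transport (V : 'M[K]_m) : 'M[K]_n :=
  \matrix_(p, q) \sum_x \sum_y (if (f x == p) && (g y == q) then V x y else 0).

Lemma transportE V x y : transport V (f x) (g y) = V x y.
Proof.
rewrite mxE (bigD1 x) //= (bigD1 y) //= !eqxx big1 => [|y' rescaled]; last first.
  by rewrite (inj_eq (@enumer_inj _ _ _ hB)) (negPf rescaled) andbF.
rewrite big1 ?addr0 // => x' xx; rewrite big1 // => y' _.
by rewrite (inj_eq (@enumer_inj _ _ _ hA)) (negPf xx).
Qed.

Lemma enumer_surj (C : {set 'I_n}) (hC : #|C| = m) p : p \in C -> exists x, enumer hC x = p.
Proof.
move=> pC; exists (cast_ord hC (enum_rank_in pC p)).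
by rewrite /enumer cast_ordK enum_rankK_in.
Qed.

Lemma transport_rows V : V *m (map_mx (@conjK R k) V^T) = 1%:M ->
  forall p p', p \in A -> p' \in A ->
  \sum_(q in B) transport V p q * conjK (transport V p' q) = (p == p')%:R.
Proof.
move=> hV p p' /(enumer_surj hA)[x <-] /(enumer_surj hA)[x' <-].
rewrite -(sum_enumer hB (fun q => transport V (f x) q * conjK (transport V (f x') q))).
rewrite (inj_eq (@enumer_inj _ _ _ hA)); have /matrixP/(_ x x') := hV.
rewrite !mxE => <-; apply: eq_bigr => y _.
by rewrite !transportE !mxE.
Qed.

Lemma transport_cols V : V *m (map_mx (@conjK R k) V^T) = 1%:M ->
  forall q q', q \in B -> q' \in B ->
  \sum_(p in A) transport V p q * conjK (transport V p q') = (q == q')%:R.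
Proof.
move=> hV q q' /(enumer_surj hB)[y <-] /(enumer_surj hB)[y' <-].
rewrite -(sum_enumer hA (fun p => transport V p (g y) * conjK (transport V p (g y')))).
rewrite (inj_eq (@enumer_inj _ _ _ hB)); have /matrixP/(_ y' y) := mulmx1C hV.
rewrite !mxE eq_sym => <-; apply: eq_bigr => x _.
by rewrite !transportE !mxE mulrC.
Qed.

Lemma sum_transport V (M : 'M[K]_n) (s : R) : s != 0 ->
  \sum_(p in A) \sum_(q in B) absK (M p q - ofR k s * transport V p q) ^+ 2 =
  s ^+ 2 * fsq ((\matrix_(x, y) (ofR k s^-1 * M (f x) (g y))) - V).
Proof.
move=> s0; rewrite -(sum_enumer hA (fun p => \sum_(q in B) absK (M p q - ofR k s * transport V p q) ^+ 2)).
rewrite mulr_sumr; apply: eq_bigr => x _.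
rewrite -(sum_enumer hB (fun q => absK (M (f x) q - ofR k s * transport V (f x) q) ^+ 2)).
rewrite mulr_sumr; apply: eq_bigr => y _; rewrite transportE !mxE.
have -> : M (f x) (g y) - ofR k s * V x y = ofR k s * (ofR k s^-1 * M (f x) (g y) - V x y).
  by rewrite mulrBr mulrA -rmorphM mulfV // rmorph1 mul1r.
by rewrite absKM exprMn absK_ofR real_normK ?num_real.
Qed.
End Transport.

Section RankOneCuts.
Variables (R : realType) (k : ground_field) (d n : nat).
Local Notation K := (scalars R k).
Local Notation I := {ffun 'I_d -> 'I_n}.
Variable T : ('I_d -> 'rV[K]_n) -> K.
Hypothesis T_cb : (cb_norm T <= 1%:E)%E.
Variable j0 : 'I_n.
Local Notation S s j := (slice (fun i => absK (coef T i)) s j).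

Lemma slices_le1 s : \sum_j S s j <= 1.
Proof.
have [F [G [_ _ h]]] := slices_bound j0 s T_cb.
apply: le_trans h; apply: ler_sum => j _; rewrite lerDl.
by rewrite divr_ge0 ?mulr_ge0 ?sqrtr_ge0 //; apply: sumr_ge0 => i _; exact: sqr_ge0.
Qed.

(** On a slice of norm 0 the estimate of slices_bound is void, so F is set to 0 there.
*)
Lemma rank_one_cuts (s : 'I_d) (A : {set 'I_n}) (b kap : R) : 0 <= b ->
  (forall j, j \in A -> S s j <= b) -> 1 - kap <= \sum_j S s j ->
  exists F G : I -> K,
  [/\ forall i i' : I, (forall t : 'I_d, (t <= s)%N -> i t = i' t) -> F i = F i',
      forall i i' : I, (forall t : 'I_d, (s <= t)%N -> i t = i' t) -> G i = G i' &
      \sum_(i : I | i s \in A) absK (coef T i - F i * G i) ^+ 2 <= 4 * b * kap].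
Proof.
move=> b0 hb hk; have [F [G [hF hG h]]] := slices_bound j0 s T_cb.
have S0 j : 0 <= S s j by exact: sqrtr_ge0.
(* F' still depends on the coordinates up to s only. *)
pose F' (i : I) := if S s (i s) == 0 then 0 else F i.
exists F', G; split => //.
  by move=> i i' ii; rewrite /F' ii // (hF _ _ ii).
pose D j := \sum_(i : I | i s == j) absK (coef T i - F i * G i) ^+ 2.
have D0 j : 0 <= D j by apply: sumr_ge0 => i _; exact: sqr_ge0.
have {}h : \sum_j D j / (4 * S s j) <= kap.
  by move: h hk; rewrite big_split /= -/D; lra.
apply: (@le_trans _ _ (\sum_j 4 * b * (D j / (4 * S s j)))); last first.
  by rewrite -mulr_sumr ler_wpM2l // mulr_ge0.
rewrite (partition_big (fun i : I => i s) (mem A)) //= big_mkcond; apply: ler_sum => j _ /=.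
have Q0 : 0 <= D j / (4 * S s j) by rewrite divr_ge0 ?mulr_ge0.
case: ifP => jA; last by apply: mulr_ge0 => //; exact: mulr_ge0.
have [Sz|Sz] := eqVneq (S s j) 0.
  rewrite big1 => [|i /andP[_ /eqP ij]]; first by apply: mulr_ge0 => //; exact: mulr_ge0.
  rewrite /F' ij Sz eqxx mul0r subr0.
  have := @slice_eq0 R d n (fun i => absK (coef T i)) (fun i => absK_ge0 _) s i.
  by rewrite ij Sz => ->; rewrite // expr0n.
have -> : \sum_(i : I | (i s \in A) && (i s == j)) absK (coef T i - F' i * G i) ^+ 2 = D j.
  apply: eq_big => [i|i /andP[_ /eqP ij]]; first by case: eqP => [->|]; rewrite ?jA ?andbF.
  by rewrite /F' ij (negPf Sz).
have Sp : 0 < S s j by rewrite lt_def Sz S0.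
have -> : 4 * b * (D j / (4 * S s j)) = D j * (b / S s j) by field.
by rewrite ler_peMr // ler_pdivlMr // mul1r hb.
Qed.
End RankOneCuts.

(** * Structure of near-extremal forms *)

Section Structure.
Variables (R : realType) (e : nat).
Local Notation d := e.+2.
Local Notation q := ((2 * d)%:R / d.+1%:R : R).

(** All the estimates in terms of coefficients, with one constant B, before they become
statements about forms and restricted matrices. *)
Lemma near_extremal_structure : exists B dlt0 : R, [/\ 1 <= B, 0 < dlt0 &
  forall (k : ground_field) (n : nat) (T : ('I_d -> 'rV[scalars R k]_n) -> scalars R k) (eps : R),
  'I_n -> (cb_norm T <= 1%:E)%E ->
  1 - 2 * eps <= \sum_i absK (coef T i) `^ q -> 0 <= eps -> 2 * eps <= dlt0 ->
  exists (m : nat) (J : 'I_d -> {set 'I_n}) (H U : 'I_d.-1 -> 'M[scalars R k]_n),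
  [/\ [/\ (0 < m)%N, forall s, #|J s| = m & forall r p p', absK (H r p p') = 1],
      (forall r p p', p \in J (pos r) -> p' \in J (pos r) ->
        \sum_(s in J (next_pos r)) U r p s * conjK (U r p' s) = (p == p')%:R) /\
      (forall r s s', s \in J (next_pos r) -> s' \in J (next_pos r) ->
        \sum_(p in J (pos r)) U r p s * conjK (U r p s') = (s == s')%:R),
      \sum_(i | inside J i) absK (coef T i - ofR k ((Num.sqrt m%:R)^-1 ^+ d.+1) *
          \prod_(r < d.-1) H r (i (pos r)) (i (next_pos r))) ^+ 2 <= B * eps / m%:R /\
      \sum_(i | inside J i) absK (coef T i - m%:R^-1 *
          \prod_(r < d.-1) U r (i (pos r)) (i (next_pos r))) ^+ 2 <= B * eps / m%:R,
      \sum_(i | ~~ inside J i) absK (coef T i) `^ q <= B * eps &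
      forall r, \sum_(p in J (pos r)) \sum_(s in J (next_pos r))
         absK (H r p s - ofR k (Num.sqrt m%:R) * U r p s) ^+ 2 <= B * eps * m%:R ^+ 2]].
Proof.
have [C [dlt0 [C0 dlt00 flat]]] := @flatness R d isT.
pose C2 : R := 2 * C + 2 * 64 * d.+1%:R.
pose C3 : R := 46 ^+ e * C2.
have C20 : 0 <= C2 by rewrite addr_ge0 ?mulr_ge0.
have C23 : C2 <= C3 by rewrite ler_peMl // exprn_ege1 // ler1n.
have C30 : 0 <= C3 by exact: le_trans C23.
have [C4 C4E C40] : exists2 C4 : R, C4 = 20000 * (2 * C3) & 0 <= C4.
  exists (20000 * (2 * C3)); [reflexivity | apply: mulr_ge0; [exact: ler0n | exact: mulr_ge0]].
pose C5 : R := d.-1%:R ^+ 2 * C4.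
have C50 : 0 <= C5 by rewrite mulr_ge0 // exprn_ge0 // ler0n.
have C2C : 2 * C <= C2 by rewrite lerDl mulr_ge0.
have C2d : 2 * 64 * d.+1%:R <= C2 by rewrite lerDr mulr_ge0.
exists (1 + (2 * C3 + 2 * C5 + C4)), dlt0; split => //; first by rewrite lerDl !addr_ge0 ?mulr_ge0.
have X0 : 0 <= 2 * C3 + 2 * C5 by rewrite addr_ge0 // mulr_ge0.
set B := 1 + _.
have BC5 : 2 * C3 + 2 * C5 <= B by rewrite /B addrCA lerDl addr_ge0.
have BC4 : C4 <= B by rewrite /B addrA lerDr addr_ge0.
have BC3 : C3 <= B.
  apply: le_trans BC5; rewrite -[leLHS]addr0 lerD ?mulr_ge0 //.
  by rewrite ler_peMl // ler1n.
move=> k n T eps j0 Tcb Tq eps0 epsd.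
have aq0 (i : {ffun 'I_d -> 'I_n}) : 0 <= absK (coef T i) `^ q by exact: powR_ge0.
have a0 (i : {ffun 'I_d -> 'I_n}) : 0 <= absK (coef T i) by exact: absK_ge0.
have aqE (i : {ffun 'I_d -> 'I_n}) := powR_exponent d (a0 i).
have sl := slices_le1 Tcb j0.
have hd : 0 <= 2 * eps <= dlt0 by rewrite epsd mulr_ge0.
have [m [J [m0 hJ hout hflat [hslice hmass]]]] := flat n _ _ _ a0 aq0 aqE sl Tq hd.
have mR : 0 < m%:R :> R by rewrite ltr0n.
pose c : R := (Num.sqrt m%:R)^-1 ^+ d.+1.
have c0 : 0 <= c by rewrite exprn_ge0 // invr_ge0 sqrtr_ge0.
have Age := A_ge a0 aq0 aqE sl Tq isT.
have le_div (x y : R) : x <= y -> x * eps / m%:R <= y * eps / m%:R.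
  by move=> xy; rewrite ler_wpM2r ?invr_ge0 ?(ltW mR) // ler_wpM2r.
pose i0 : {ffun 'I_d -> 'I_n} := [ffun s => enumer (hJ s) (Ordinal m0)].
have i0in : inside J i0 by apply/forallP => s; rewrite ffunE enumer_in.
have flat' : \sum_(i | inside J i) (absK (coef T i) - c) ^+ 2 <= C2 * eps / m%:R.
  by apply: (le_trans hflat); rewrite mulrA [C * 2]mulrC le_div.
have cuts (s : 'I_d) : exists F G : {ffun 'I_d -> 'I_n} -> scalars R k,
    [/\ upto s F, from s G & \sum_(i | inside J i) absK (coef T i - F i * G i) ^+ 2 <= C2 * eps / m%:R].
  have b0 : 0 <= 16 / m%:R :> R by rewrite divr_ge0 // ltW.
  have [F [G [hF hG h]]] := rank_one_cuts Tcb j0 b0 (hslice s) (Age s).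
  exists F, G; split => //.
  apply: (@le_trans _ _ (\sum_(i : {ffun 'I_d -> 'I_n} | i s \in J s) absK (coef T i - F i * G i) ^+ 2)).
    rewrite big_mkcond [leRHS]big_mkcond; apply: ler_sum => i _.
    case: (boolP (inside J i)) => [/forallP/(_ s) ->//|_].
    by case: ifP => // _; exact: sqr_ge0.
  apply: (le_trans h); apply: le_trans (le_div _ _ C2d).
  rewrite le_eqVlt; apply/orP; left; apply/eqP; ring.
have [H [hH hP]] := phases i0in flat' cuts.
have hP3 : \sum_(i | inside J i) absK (coef T i - ofR k c *
     \prod_(r < d.-1) H r (i (pos r)) (i (next_pos r))) ^+ 2 <= C3 * eps / m%:R.
  by apply: (le_trans hP); rewrite /C3 !mulrA.
have hmass3 : 1 - C3 * eps <= m%:R * \sum_(i | inside J i) absK (coef T i) ^+ 2.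
  apply: le_trans hmass; rewrite lerD2l lerN2 mulrA [C * 2]mulrC ler_wpM2r //.
  exact: le_trans C23.
pose h r : 'M[scalars R k]_m := \matrix_(x, y) (ofR k (Num.sqrt m%:R)^-1 *
   H r (enumer (hJ (pos r)) x) (enumer (hJ (next_pos r)) y)).
have /choice[V hV] : forall r, exists V : 'M[scalars R k]_m,
    V *m (map_mx (@conjK R k) V^T) = 1%:M /\ fsq (h r - V) <= C4 * eps * m%:R.
  move=> r; have [V hV1 hV2] := unitary_factor Tcb hJ m0 hH r hP3 hmass3.
  exists V; split=> //; apply: (le_trans hV2); rewrite C4E le_eqVlt.
  by apply/orP; left; apply/eqP; rewrite -!mulrA; congr (_ * _); rewrite mulrCA.
pose U r := transport (hJ (pos r)) (hJ (next_pos r)) (V r).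
have s0 : 0 < Num.sqrt m%:R :> R by rewrite sqrtr_gt0.
have s2 : Num.sqrt m%:R ^+ 2 = m%:R :> R by rewrite sqr_sqrtr // ltW.
have U_rows r := transport_rows (hJ (pos r)) (hJ (next_pos r)) (hV r).1.
have U_cols r := transport_cols (hJ (pos r)) (hJ (next_pos r)) (hV r).1.
have HU r : \sum_(p in J (pos r)) \sum_(s in J (next_pos r))
   absK (H r p s - ofR k (Num.sqrt m%:R) * U r p s) ^+ 2 <= C4 * eps * m%:R ^+ 2.
  rewrite sum_transport ?gt_eqF // s2 expr2 mulrA [leRHS]mulrC ler_wpM2l ?(ltW mR) //.
  exact: (hV r).2.
have hQP : \sum_(i | inside J i) absK (ofR k c * \prod_(r < d.-1) H r (i (pos r)) (i (next_pos r)) -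
     m%:R^-1 * \prod_(r < d.-1) U r (i (pos r)) (i (next_pos r))) ^+ 2 <= C5 * eps / m%:R.
  pose W r p s := ofR k (Num.sqrt m%:R) * U r p s.
  have W_rows r p : p \in J (pos r) -> \sum_(s in J (next_pos r)) absK (W r p s) ^+ 2 = m%:R.
    move=> pJ; apply: (@ofR_inj R k); rewrite rmorph_sum /=.
    rewrite (eq_bigr (fun s => ofR k m%:R * (U r p s * conjK (U r p s)))) => [|s _].
      by rewrite -mulr_sumr (U_rows r p p pJ pJ) eqxx mulr1.
    by rewrite mulK_conj -rmorphM absKM exprMn absK_ofR real_normK ?num_real // s2.
  have dist := chain_distance hJ m0 hH W_rows HU.
  have cW (i : {ffun 'I_d -> 'I_n}) : m%:R^-1 * \prod_(r < d.-1) U r (i (pos r)) (i (next_pos r)) =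
      ofR k c * \prod_(r < d.-1) W r (i (pos r)) (i (next_pos r)).
    rewrite big_split /= prodr_const card_ord mulrA; congr (_ * _).
    have -> : (m%:R^-1 : scalars R k) = ofR k (m%:R^-1 : R) by rewrite fmorphV /= rmorph_nat.
    rewrite -rmorphXn -rmorphM; congr (ofR k _).
    have E3 : e.+3 = (e.+1 + 2)%N by rewrite addn2.
    rewrite /c E3 exprD exprVn mulrAC mulVf ?mul1r; last by rewrite expf_neq0 // gt_eqF.
    by rewrite exprVn s2.
  apply: (@le_trans _ _ (c ^+ 2 * (d.-1%:R ^+ 2 * m%:R ^+ e * (C4 * eps * m%:R ^+ 2)))); last first.
    rewrite /C5 /c exprAC exprVn s2 le_eqVlt; apply/orP; left; apply/eqP.
    have mz : m%:R != 0 :> R by rewrite gt_eqF.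
    have -> : m%:R^-1 ^+ e.+3 * (d.-1%:R ^+ 2 * m%:R ^+ e * (C4 * eps * m%:R ^+ 2)) =
       d.-1%:R ^+ 2 * C4 * eps * (m%:R^-1 * m%:R) ^+ e.+2 / m%:R.
      by rewrite exprMn !exprS expr0; ring.
    by rewrite mulVf // expr1n mulr1.
  apply: le_trans (ler_wpM2l (sqr_ge0 c) dist); rewrite mulr_sumr; apply: ler_sum => i _.
  by rewrite cW -mulrBr absKM exprMn absK_ofR real_normK ?num_real.
exists m, J, H, U; split => //.
- split; first by apply: (le_trans hP3); exact: le_div.
  apply: le_trans (le_div _ _ BC5).
  apply: (@le_trans _ _ (2 * (C3 * eps / m%:R) + 2 * (C5 * eps / m%:R))); last first.
    by rewrite le_eqVlt; apply/orP; left; apply/eqP; ring.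
  apply: (@le_trans _ _ (2 * \sum_(i | inside J i) absK (coef T i - ofR k c *
     \prod_(r < d.-1) H r (i (pos r)) (i (next_pos r))) ^+ 2 +
     2 * \sum_(i | inside J i) absK (ofR k c * \prod_(r < d.-1) H r (i (pos r)) (i (next_pos r)) -
     m%:R^-1 * \prod_(r < d.-1) U r (i (pos r)) (i (next_pos r))) ^+ 2)).
    rewrite !mulr_sumr -big_split; apply: ler_sum => i _ /=.
    by apply: le_trans (sqr_absK_sum2 _ _); rewrite addrA subrK.
  by rewrite lerD // ler_pM2l.
- apply: (le_trans hout); rewrite mulrA [C * 2]mulrC ler_wpM2r //.
  exact: le_trans C2C (le_trans C23 BC3).
- move=> r; apply: (le_trans (HU r)); rewrite ler_wpM2r ?sqr_ge0 // ler_wpM2r //.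
Qed.
End Structure.

(** * The theorem *)

Theorem theoremC (R : realType) (d : nat) (hd : (2 <= d)%N) :
  exists C epsd : R, 0 < epsd /\
  forall (k : ground_field) (n : nat) (hn : (1 <= n)%N)
    (T : ('I_d -> 'rV[scalars R k]_n) -> scalars R k) (eps : R),
  let q : R := (2 * d)%:R / d.+1%:R in
  multilinear T ->
  cb_norm T = 1%:E ->
  1 - eps <= coef_norm q T ->
  0 <= eps <= epsd ->
  exists (m : nat) (J : 'I_d -> {set 'I_n})
    (H U : 'I_d.-1 -> 'M[scalars R k]_n),
  let Hr r := restr (J (pos r)) (J (next_pos r)) (H r) in
  let Ur r := restr (J (pos r)) (J (next_pos r)) (U r) in
  let inJ (i : {ffun 'I_d -> 'I_n}) := [forall s, i s \in J s] in
  [/\ (1 <= m <= n)%N,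
      forall s, #|J s| = m,
      forall r, unimodular (Hr r) &
      forall r, unitary (Ur r)] /\
  (exists P : ('I_d -> 'rV[scalars R k]_n) -> scalars R k,
    [/\ multilinear P,
        forall i : {ffun 'I_d -> 'I_n}, coef P i =
          if inJ i then
            ofR k (m%:R `^ (- (d.+1%:R / 2))) *
              \prod_(r < d.-1) H r (i (pos r)) (i (next_pos r))
          else 0,
        coef_norm q (T \- P) <= C * Num.sqrt eps,
        coef_norm q P = 1 &
        \sum_(i : {ffun 'I_d -> 'I_n} | ~~ inJ i) absK (coef T i) `^ q
          <= C * eps]) /\
  (exists Q : ('I_d -> 'rV[scalars R k]_n) -> scalars R k,
    [/\ multilinear Q,
        forall i : {ffun 'I_d -> 'I_n}, coef Q i =
          if inJ i then
            m%:R^-1 * \prod_(r < d.-1) U r (i (pos r)) (i (next_pos r))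
          else 0,
        coef_norm q (T \- Q) <= C * Num.sqrt eps,
        cb_norm Q = 1%:E &
        coef_frobenius Q = m%:R `^ (- (1 / 2))]) /\
  \big[Num.max/0]_(r < d.-1)
      (frobenius (Hr r - ofR k (Num.sqrt m%:R) *: Ur r) / m%:R)
    <= C * Num.sqrt eps /\
  (k = RealField -> forall r : 'I_d.-1,
    (forall i j, i \in J (pos r) -> j \in J (next_pos r) ->
       H r i j = 1 \/ H r i j = - 1) /\
    Ur r *m (Ur r)^T = 1%:M).
Proof.
case: d hd => [|[|e]] // _; pose d := e.+2.
have [B [dlt0 [B1 dlt00 hS]]] := near_extremal_structure R e.
have B0 : 0 < B by exact: lt_le_trans B1.
(* The three conditions on eps are: positivity of 1 - eps in the lower bound for the sum
of q-th powers, the range of near_extremal_structure, and that of norm_from_sums. *)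
exists (3 * B), (Num.min (2^-1) (Num.min (dlt0 / 2) B^-1)); split.
  by rewrite !lt_min invr_gt0 ltr0n divr_gt0 // invr_gt0.
move=> k n hn T eps q Tmul Tcb Tq /andP[eps0]; rewrite !le_min => /and3P[eps1 eps2 eps3].
have j0 : 'I_n by exact: (Ordinal hn).
have /andP[q1 q2] : 1 <= q <= 2 by exact: (@exponent_bounds R d isT).
have q0 : 0 < q by exact: lt_le_trans q1.
have Tq' : 1 - 2 * eps <= \sum_i absK (coef T i) `^ q.
  have e1 : 0 < 1 - eps by move: eps1; lra.
  set S := \sum_i _; have S0 : 0 <= S by apply: sumr_ge0 => i _; exact: powR_ge0.
  have h1 : (1 - eps) `^ q <= S.
    have := ge0_ler_powR (ltW q0); rewrite /{homo _ : _ _ / _ >-> _} => /(_ _ _ _ _ Tq).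
    rewrite !nnegrE powR_ge0 (ltW e1) => /(_ isT isT) /le_trans; apply.
    by rewrite /coef_norm -powRrM mulVf ?gt_eqF // powRr1.
  (* Bounding the power by a square loses only a factor 2 in eps. *)
  apply: (le_trans _ h1); apply: (@le_trans _ _ ((1 - eps) `^ 2)).
    by rewrite powR_mulrn ?(ltW e1) //; have := sqr_ge0 eps; rewrite !expr2; lra.
  by apply: ger_powR q2; rewrite e1 lerBlDr lerDl.
have eps2' : 2 * eps <= dlt0 by move: eps2; rewrite ler_pdivlMr // mulrC.
have Be1 : B * eps <= 1 by rewrite -ler_pdivlMl // mulr1.
have Tcb' : (cb_norm T <= 1%:E)%E by rewrite Tcb.
have [m [J [H [U [[m0 hJ hH] [U_rows U_cols] [hP hQ] hout hHU]]]]] := hS k n T eps j0 Tcb' Tq' eps0 eps2'.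
have mR : 0 < m%:R :> R by rewrite ltr0n.
have card_in : \sum_(i | inside J i) 1 = m%:R ^+ d :> R.
  by rewrite (sum_inside1 (fun=> 1) ord0 hJ) sumr_const hJ -exprSr.
have sqrt_pow : (Num.sqrt m%:R)^-1 = m%:R `^ (- 2^-1) :> R by rewrite powRN powR12_sqrt // ltW.
have c_pow : m%:R `^ (- (d.+1%:R / 2)) = (Num.sqrt m%:R)^-1 ^+ d.+1 :> R.
  by rewrite sqrt_pow -powR_mulrn ?powR_ge0 // -powRrM mulNr [d.+1%:R / 2]mulrC.
have norm_le (Z : ('I_d -> 'rV[scalars R k]_n) -> scalars R k) :
   \sum_(i | inside J i) absK (coef T i - coef Z i) ^+ 2 <= B * eps / m%:R ->
   (forall i, ~~ inside J i -> coef Z i = 0) -> coef_norm q (T \- Z) <= 3 * B * Num.sqrt eps.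
  move=> h1 h2; apply: (norm_from_sums (d := d) isT (fun i => absK_ge0 _) m0 B1 eps0 Be1 card_in h1).
  apply: le_trans hout; rewrite le_eqVlt; apply/orP; left; apply/eqP.
  by apply: eq_bigr => i /h2 zi; rewrite /coef /= -/(coef Z i) zi subr0.
exists m, J, H, U; cbv zeta; split.
  split => //.
  - by rewrite m0 /= -(hJ ord0) (leq_trans (max_card _)) // card_ord.
  - by move=> r a b; rewrite mxE.
  - by move=> r; apply: unitary_restr => p p'; exact: U_rows.
split.
  pose w (i : {ffun 'I_d -> 'I_n}) := if inside J i then
    ofR k (m%:R `^ (- (d.+1%:R / 2))) * \prod_(r < d.-1) H r (i (pos r)) (i (next_pos r)) else 0.
  exists (form_of w); apply: And5.
  - exact: form_of_multilinear.
  - by move=> i; rewrite coef_form_of.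
  - apply: norm_le => [|i hi]; last by rewrite coef_form_of /w (negPf hi).
    apply: le_trans hP; rewrite le_eqVlt; apply/orP; left; apply/eqP.
    by apply: eq_bigr => i hi; rewrite coef_form_of /w hi c_pow.
  - rewrite /coef_norm (eq_bigr (fun i => if inside J i then (m%:R ^+ d)^-1 else 0)) => [|i _].
      rewrite -big_mkcond /= -[X in \sum_(i | _) X]mul1r -mulr_suml card_in mulfV ?expf_neq0 ?gt_eqF //.
      by rewrite powR1.
    rewrite coef_form_of /w; case: ifP => _; last by rewrite absK0 powR0 ?gt_eqF.
    rewrite absKM absK_prod big1 => [|r _]; last exact: hH.
    rewrite mulr1 absK_ofR ger0_norm ?powR_ge0 // c_pow.
    exact: (powR_sqrt_exponent R d m0).
  - by apply: (le_trans hout); rewrite -mulrA ler_peMl ?mulr_ge0 ?(ltW B0) // ler1n.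
split.
  pose w (i : {ffun 'I_d -> 'I_n}) := if inside J i then
    m%:R^-1 * \prod_(r < d.-1) U r (i (pos r)) (i (next_pos r)) else 0.
  have U_norm (r : 'I_d.-1) p : p \in J (pos r) -> \sum_(s in J (next_pos r)) absK (U r p s) ^+ 2 = 1.
    move=> pJ; apply: (@ofR_inj R k); rewrite rmorph_sum rmorph1 /=.
    by under eq_bigr do rewrite -mulK_conj; rewrite U_rows // eqxx.
  exists (form_of w); apply: And5.
  - exact: form_of_multilinear.
  - by move=> i; rewrite coef_form_of.
  - apply: norm_le => [|i hi]; last by rewrite coef_form_of /w (negPf hi).
    apply: le_trans hQ; rewrite le_eqVlt; apply/orP; left; apply/eqP.
    by apply: eq_bigr => i hi; rewrite coef_form_of /w hi.
  - by apply: (unitary_form_cb hJ m0 U_cols U_norm) => i; rewrite coef_form_of.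
  - rewrite (frobenius_unitary_form hJ m0 U_norm) => [|i]; last by rewrite coef_form_of.
    by rewrite sqrt_pow mul1r.
split.
  apply: bigmax_le => [|r _]; first by rewrite !mulr_ge0 ?sqrtr_ge0 // ltW.
  have -> : restr (J (pos r)) (J (next_pos r)) (H r) -
     ofR k (Num.sqrt m%:R) *: restr (J (pos r)) (J (next_pos r)) (U r) =
     restr (J (pos r)) (J (next_pos r)) (H r - ofR k (Num.sqrt m%:R) *: U r).
    by apply/matrixP => a b; rewrite !mxE.
  rewrite frobenius_restr ler_pdivrMr //.
  apply: (@le_trans _ _ (Num.sqrt (B * eps * m%:R ^+ 2))).
    rewrite ler_wsqrtr //; apply: le_trans (hHU r); rewrite le_eqVlt; apply/orP; left; apply/eqP.
    by apply: eq_bigr => p _; apply: eq_bigr => s _; rewrite !mxE.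
  rewrite sqrtrM ?mulr_ge0 ?(ltW B0) // sqrtr_sqr ger0_norm ?(ltW mR) // ler_wpM2r ?(ltW mR) //.
  rewrite sqrtrM ?(ltW B0) // ler_wpM2r ?sqrtr_ge0 //.
  apply: (@le_trans _ _ B); last by rewrite ler_peMl ?(ltW B0) // ler1n.
  by rewrite -[leRHS]ger0_norm ?(ltW B0) // -sqrtr_sqr ler_wsqrtr // expr2 ler_peMl // ltW.
move=> kR; subst k; move=> r; split => [p s _ _|].
  have := hH r p s; rewrite /absK /= => h.
  by case: (ger0P (H r p s)) h => _ h; [left | right; rewrite -h opprK].
have := unitary_restr (fun p p' => U_rows r p p'); rewrite /unitary /=.
by rewrite map_mx_id.
Qed.
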